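(* Let $\mathbb{T}=\mathbb{C}/\Gamma$ be a 2-torus. Then any Hamiltonian stationary conformal Lagrangian immersion $X:\mathbb{T}\to\mathbb{R}^4$ is of finite type.
   Context: $\mathbb{R}^4$ has its standard inner product and symplectic form $\omega=dx^1\wedge dx^2+dx^3\wedge dx^4$. A conformal Lagrangian immersion $X$ satisfies $|X_x|=|X_y|=e^f$, $\langle X_x,X_y\rangle=0$, $X^*\omega=0$; its Lagrangian angle $\beta$ is given by $(dx^1+i\,dx^2)\wedge(dx^3+i\,dx^4)(e^{-f}X_x,e^{-f}X_y)=e^{i\beta}$, and $X$ is Hamiltonian stationary iff $\Delta\beta=0$ (known to be equivalent to criticality of area under compactly supported Hamiltonian variations). Identify $\mathbb{R}^4$ with the quaternions by $(x^1,x^2,x^3,x^4)\mapsto x^1+ix^2+jx^3+kx^4$; $L_p$ (resp. $R_p$) is the matrix of left (resp. right) multiplication by $p$. $\mathcal{G}_0=\{q^1\mathbf 1-q^2R_i-q^3R_j-q^4R_k:q\in\mathbb{R}^4,|q|=1\}$, $\mathcal{G}_2=\{e^{\theta L_i}:\theta\in\mathbb{R}\}$, $\vec{\mathcal{G}}=\mathcal{G}_0\mathcal{G}_2\simeq U(2)$, $\mathcal{G}=\vec{\mathcal{G}}\ltimes\mathbb{R}^4$ with $(G,T)(G',T')=(GG',GT'+T)$ (affine maps $x\mapsto Gx+T$; also $5\times5$ matrices), with Lie algebra $\mathfrak{g}$. Complexifications: allow $q\in\mathbb{C}^4$ with $\sum(q^m)^2=1$, $\theta\in\mathbb{C}$,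 $T\in\mathbb{C}^4$. $\tau(G,T)=(-L_jGL_j,-L_jT)$, which also acts linearly on $\mathfrak{g}^{\mathbb{C}}$. $\epsilon=\frac12(1,0,-i,0)^T$; $\mathcal{B}_0=\{B\in\mathcal{G}_0^{\mathbb{C}}:B\epsilon\in\mathbb{R}_+^*\epsilon\}$. Loop groups (loops in $\lambda\in S^1$): $\Lambda\mathcal{G}_\tau$, $\Lambda\mathcal{G}^{\mathbb{C}}_\tau$ are the groups of loops in $\mathcal{G}$, $\mathcal{G}^{\mathbb{C}}$ with $G_{i\lambda}=\tau(G_\lambda)$; $\Lambda\mathfrak{g}_\tau$ is the Lie algebra of loops $\xi:S^1\to\mathfrak{g}$ with $\xi_{i\lambda}=\tau(\xi_\lambda)$. $\Lambda^+_{\mathcal{B}_0}\mathcal{G}^{\mathbb{C}}_\tau$ is the subgroup of $\Lambda\mathcal{G}^{\mathbb{C}}_\tau$ of loops extending holomorphically to the unit disk with value at $\lambda=0$ in $(\mathcal{B}_0,0)$. Every element of $\Lambda\mathcal{G}^{\mathbb{C}}_\tau$ factors uniquely as $HB$ with $H\in\Lambda\mathcal{G}_\tau$, $B\in\Lambda^+_{\mathcal{B}_0}\mathcal{G}^{\mathbb{C}}_\tau$. For $d\in\mathbb{N}$, $\Lambda^d\mathfrak{g}_\tau=\{\xi\in\Lambda\mathfrak{g}_\tau:\xi_\lambda=\sum_{n=-d}^d\hat\xi_n\lambda^n\}$. Finite type: let $d\in4\mathbb{N}+2$, $\eta_\lambda\in\Lambda^d\mathfrak{g}_\tau$, $z_0\in\mathbb{C}$.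 Let $M_\lambda:\mathbb{C}\to\Lambda\mathcal{G}^{\mathbb{C}}_\tau$ solve $M_\lambda^{-1}dM_\lambda=\lambda^{d-2}\eta_\lambda\,dz$, $M_\lambda(z_0)=\mathbf 1$, and factor $M_\lambda=H_\lambda B_\lambda$ pointwise on $\mathbb{C}$, with $H_\lambda(z)\in\Lambda\mathcal{G}_\tau$ and $B_\lambda(z)\in\Lambda^+_{\mathcal{B}_0}\mathcal{G}^{\mathbb{C}}_\tau$ the unique such factors, $H_\lambda=(F_\lambda,X_\lambda)$. The map $X_1:\mathbb{C}\to\mathbb{R}^4$ (value at $\lambda=1$) is said to be obtained by integrating the constant polynomial potential $\lambda^{d-2}\eta_\lambda dz$. An immersion $X$ of $\mathbb{T}$ is of finite type if, up to composition with an element of $\mathcal{G}$ (normalizing the position and frame at $z_0$), its lift to the universal cover $\mathbb{C}$ is obtained in this way for some $d\in4\mathbb{N}+2$ and some $\eta_\lambda\in\Lambda^d\mathfrak{g}_\tau$. *)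

(* Defs.v *)
From mathcomp Require Import all_boot all_order all_algebra.
From mathcomp Require Import all_classical all_reals all_analysis.
From mathcomp Require Import complex.

Set Implicit Arguments.
Unset Strict Implicit.
Unset Printing Implicit Defensive.

Import Order.TTheory GRing.Theory Num.Theory.
Import numFieldNormedType.Exports.

Local Open Scope classical_set_scope.
Local Open Scope ring_scope.

(* Quaternions are columns (x^1, x^2, x^3, x^4) indexed by 'I_4 = {0,1,2,3},
   standing for x^1 + i x^2 + j x^3 + k x^4; over K = R[i] the coefficients are
   complexified, and the complex unit is unrelated to the quaternion i. *)
Section Quaternions.
Variable K : comNzRingType.
Implicit Types (p q : 'cV[K]_4).

Definition qmul p q : 'cV[K]_4 := \col_(l < 4)
  [:: p 0 0 * q 0 0 - p 1 0 * q 1 0 - p 2 0 * q 2 0 - p 3 0 * q 3 0;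
      p 0 0 * q 1 0 + p 1 0 * q 0 0 + p 2 0 * q 3 0 - p 3 0 * q 2 0;
      p 0 0 * q 2 0 - p 1 0 * q 3 0 + p 2 0 * q 0 0 + p 3 0 * q 1 0;
      p 0 0 * q 3 0 + p 1 0 * q 2 0 - p 2 0 * q 1 0 + p 3 0 * q 0 0]`_l.

Definition qi : 'cV[K]_4 := delta_mx 1 0.
Definition qj : 'cV[K]_4 := delta_mx 2 0.
Definition qk : 'cV[K]_4 := delta_mx 3 0.

Definition Lq p : 'M[K]_4 := \matrix_(l, m) qmul p (delta_mx m 0) l 0.
Definition Rq p : 'M[K]_4 := \matrix_(l, m) qmul (delta_mx m 0) p l 0.

Definition G0 : set 'M[K]_4 :=
  [set q 0 0 *: 1%:M - q 1 0 *: Rq qi - q 2 0 *: Rq qj - q 3 0 *: Rq qk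
     | q in [set q : 'cV[K]_4 | \sum_(l < 4) q l 0 ^+ 2 = 1]].

(* The affine map x |-> A x + T as a 5 x 5 matrix. *)
Definition aff (A : 'M[K]_4) (T : 'cV[K]_4) : 'M[K]_(4 + 1) :=
  block_mx A T 0 1%:M.

Definition aff_act (g : 'M[K]_(4 + 1)) (x : 'cV[K]_4) : 'cV[K]_4 :=
  ulsubmx g *m x + ursubmx g.

Definition semidirect (S : set 'M[K]_4) : set 'M[K]_(4 + 1) :=
  [set aff A T | A in S & T in [set: 'cV[K]_4]].

(* (A, T) |-> (- L_j A L_j, - L_j T), both on group elements (lower right
   entry 1) and on Lie algebra elements (lower right entry 0). *)
Definition tau (g : 'M[K]_(4 + 1)) : 'M[K]_(4 + 1) :=
  block_mx (- (Lq qj *m ulsubmx g *m Lq qj)) (- (Lq qj *m ursubmx g))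
           (dlsubmx g) (drsubmx g).

End Quaternions.

Arguments qi {K}.
Arguments qj {K}.
Arguments qk {K}.
Arguments G0 {K}.

Section Groups.
Variable R : realType.
Local Notation C := R[i].

Definition toC : R -> C := fun x => x%:C%C.

Definition cexp (z : C) : C :=
  (expR (complex.Re z) * cos (complex.Im z) +i*
   (expR (complex.Re z) * sin (complex.Im z)))%C.
Definition ccos (z : C) : C := (cexp ('i%C * z) + cexp (- ('i%C * z))) / 2.
Definition csin (z : C) : C :=
  (cexp ('i%C * z) - cexp (- ('i%C * z))) / (2 * 'i%C).

(* exp(theta L_i) = cos theta 1 + sin theta L_i because L_i^2 = - 1. *)
Definition G2 : set 'M[R]_4 :=
  [set cos theta *: 1%:M + sin theta *: Lq qi | theta in [set: R]].
Definition G2C : set 'M[C]_4 :=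
  [set ccos theta *: 1%:M + csin theta *: Lq qi | theta in [set: C]].

Definition Gvec : set 'M[R]_4 := [set A *m B | A in G0 & B in G2].
Definition GvecC : set 'M[C]_4 := [set A *m B | A in G0 & B in G2C].

Definition Gaff : set 'M[R]_(4 + 1) := semidirect Gvec.
Definition GaffC : set 'M[C]_(4 + 1) := semidirect GvecC.

(* The Lie algebra of a matrix group, as its tangent space at the identity. *)
Definition lie_algebra n (S : set 'M[R]_n) : set 'M[R]_n :=
  [set xi | exists gamma : R -> 'M[R]_n,
     [/\ forall t, S (gamma t), gamma 0 = 1%:M &
         forall l m, is_derive (0 : R) 1 (fun t : R => gamma t l m) (xi l m)]].

Definition gaff : set 'M[R]_(4 + 1) := lie_algebra Gaff.

Definition epsilon : 'cV[C]_4 :=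
  2^-1 *: (delta_mx 0 0 - 'i%C *: delta_mx 2 0).

Definition B0 : set 'M[C]_4 :=
  [set B | G0 B /\ exists r : R, 0 < r /\ B *m epsilon = toC r *: epsilon].

End Groups.

Arguments toC {R}.

(* A loop is a function of lambda : R[i] of which only the values on the unit
   circle matter; loops are C^infty in the angular parameter, a class of loops
   in which the factorization of twisted loops exists. *)
Section Loops.
Variable R : realType.
Local Notation C := R[i].

Definition smooth_path (u : R -> R) : Prop :=
  forall n (t : R), derivable (derive1n n u) t 1.

Definition smooth_pathC (u : R -> C) : Prop :=
  smooth_path (fun t => complex.Re (u t)) /\
  smooth_path (fun t => complex.Im (u t)).

Definition on_circle (t : R) : C := (cos t +i* sin t)%C.

Definition twisted_loop (K : comNzRingType) (smoothK : (R -> K) -> Prop)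
    (S : set 'M[K]_(4 + 1)) (g : C -> 'M[K]_(4 + 1)) : Prop :=
  [/\ forall lam : C, `|lam| = 1 -> S (g lam),
      forall lam : C, `|lam| = 1 -> g ('i%C * lam) = tau (g lam) &
      forall l m, smoothK (fun t => g (on_circle t) l m)].

Definition LambdaG : set (C -> 'M[R]_(4 + 1)) :=
  [set g | twisted_loop smooth_path (@Gaff R) g].
Definition LambdaGC : set (C -> 'M[C]_(4 + 1)) :=
  [set g | twisted_loop smooth_pathC (@GaffC R) g].
Definition Lambdag : set (C -> 'M[R]_(4 + 1)) :=
  [set xi | twisted_loop smooth_path (@gaff R) xi].

Definition holomorphic_at (f : C -> C) (z : C) : Prop :=
  derivable (f : C^o -> C^o) z 1.

(* Holomorphic in the open disk, continuous up to the boundary. *)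
Definition LambdaBplus : set (C -> 'M[C]_(4 + 1)) :=
  [set B | LambdaGC B /\ exists Bt : C -> 'M[C]_(4 + 1),
     [/\ forall lam : C, `|lam| = 1 -> Bt lam = B lam,
         forall lam : C, `|lam| <= 1 -> GaffC (Bt lam),
         forall l m, {within [set lam : C^o | `|lam| <= 1],
                        continuous ((fun lam => Bt lam l m) : C^o -> C^o)},
         forall lam : C, `|lam| < 1 ->
           forall l m, holomorphic_at (fun mu => Bt mu l m) lam &
         exists2 B_0, B0 B_0 & Bt 0 = aff B_0 0]].

Definition Lambdag_deg (d : nat) : set (C -> 'M[R]_(4 + 1)) :=
  [set xi | Lambdag xi /\ exists xihat : int -> 'M[C]_(4 + 1),
     forall lam : C, `|lam| = 1 ->
       map_mx toC (xi lam) =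
         \sum_(n < d.*2.+1) (lam ^ (n%:Z - d%:Z)) *: xihat (n%:Z - d%:Z)].

End Loops.

Section FiniteType.
Variable R : realType.
Local Notation C := R[i].

(* M^-1 dM = lam^(d-2) eta dz says that z |-> M z lam is holomorphic with
   complex derivative M (lam^(d-2) eta). *)
Definition constant_potential_solution (d : nat) (eta : C -> 'M[R]_(4 + 1))
    (z0 : C) (M : C -> C -> 'M[C]_(4 + 1)) : Prop :=
  [/\ forall z, LambdaGC (M z),
      forall lam : C, `|lam| = 1 -> forall (z : C) l m,
        is_derive (z : C^o) 1 ((fun w => M w lam l m) : C^o -> C^o)
          ((M z lam *m (lam ^+ (d - 2) *: map_mx toC (eta lam))) l m) &
      forall lam : C, `|lam| = 1 -> M z0 lam = 1%:M].

Definition obtained_by_integrating (d : nat) (eta : C -> 'M[R]_(4 + 1))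
    (z0 : C) (Y : C -> 'cV[R]_4) : Prop :=
  exists (M : C -> C -> 'M[C]_(4 + 1)) (H : C -> C -> 'M[R]_(4 + 1))
         (B : C -> C -> 'M[C]_(4 + 1)),
    [/\ constant_potential_solution d eta z0 M,
        forall z, LambdaG (H z),
        forall z, LambdaBplus (B z),
        forall z (lam : C), `|lam| = 1 ->
          M z lam = map_mx toC (H z lam) *m B z lam &
        forall z, Y z = ursubmx (H z 1)].

Definition is_lattice (Gamma : set C) : Prop :=
  exists w1 w2 : C,
    (forall a b : R, toC a * w1 + toC b * w2 = 0 -> a = 0 /\ b = 0) /\
    Gamma = [set w | exists m n : int, w = w1 *~ m + w2 *~ n].

(* C / Gamma as the set of cosets. *)
Definition lattice_coset (Gamma : set C) (z : C) : set C :=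
  [set z + g | g in Gamma].
Definition torus (Gamma : set C) : Type :=
  {A : set C | exists z, A = lattice_coset Gamma z}.
Definition torus_proj (Gamma : set C) (z : C) : torus Gamma :=
  exist _ (lattice_coset Gamma z) (ex_intro _ z erefl).
Definition universal_cover_map (Gamma : set C) (X : torus Gamma -> 'cV[R]_4) :
    C -> 'cV[R]_4 :=
  fun z => X (torus_proj Gamma z).

Definition finite_type (Gamma : set C) (z0 : C)
    (X : torus Gamma -> 'cV[R]_4) : Prop :=
  exists (d : nat) (eta : C -> 'M[R]_(4 + 1)) (Y : C -> 'cV[R]_4)
         (g : 'M[R]_(4 + 1)),
    [/\ exists m : nat, d = (4 * m + 2)%N,
        Lambdag_deg d eta,
        obtained_by_integrating d eta z0 Y,
        Gaff g &
        forall z, universal_cover_map X z = aff_act g (Y z)].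

End FiniteType.

Section Immersions.
Variable R : realType.
Local Notation C := R[i].

Definition line_x (u : C -> R) (z : C) : R -> R := fun t => u (z + toC t).
Definition line_y (u : C -> R) (z : C) : R -> R :=
  fun t => u (z + 'i%C * toC t).

Definition partial_x (u : C -> R) : C -> R := fun z => derive1 (line_x u z) 0.
Definition partial_y (u : C -> R) : C -> R := fun z => derive1 (line_y u z) 0.

(* C^infty on C = R^2: every iterated partial derivative (one per word s)
   is continuous and partially derivable. *)
Definition smooth_plane (u : C -> R) : Prop :=
  forall s : seq bool,
    let v := foldr (fun b w => if b then partial_x w else partial_y w) u s in
    continuous (v : C^o -> R) /\
    forall z, derivable (line_x v z) 0 1 /\ derivable (line_y v z) 0 1.

Definition laplacian (u : C -> R) : C -> R :=
  fun z => partial_x (partial_x u) z + partial_y (partial_y u) z.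

Definition vpartial_x (Y : C -> 'cV[R]_4) (z : C) : 'cV[R]_4 :=
  \col_l partial_x (fun w => Y w l 0) z.
Definition vpartial_y (Y : C -> 'cV[R]_4) (z : C) : 'cV[R]_4 :=
  \col_l partial_y (fun w => Y w l 0) z.

Definition dotv (u v : 'cV[R]_4) : R := \sum_(l < 4) u l 0 * v l 0.
Definition normv (u : 'cV[R]_4) : R := Num.sqrt (dotv u u).

Definition omega (u v : 'cV[R]_4) : R :=
  (u 0 0 * v 1 0 - u 1 0 * v 0 0) + (u 2 0 * v 3 0 - u 3 0 * v 2 0).

(* (dx^1 + i dx^2) /\ (dx^3 + i dx^4) *)
Definition Omega (u v : 'cV[R]_4) : C :=
  ((u 0 0 +i* u 1 0) * (v 2 0 +i* v 3 0) -
   (u 2 0 +i* u 3 0) * (v 0 0 +i* v 1 0))%C.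

Definition conformal_lagrangian_immersion (Y : C -> 'cV[R]_4) (f : C -> R) :
    Prop :=
  [/\ forall l, smooth_plane (fun z => Y z l 0),
      forall z, normv (vpartial_x Y z) = expR (f z) /\
                normv (vpartial_y Y z) = expR (f z),
      forall z, dotv (vpartial_x Y z) (vpartial_y Y z) = 0 &
      forall z, omega (vpartial_x Y z) (vpartial_y Y z) = 0].

(* beta is a real-valued lift of the angle to the universal cover; it need not
   be Gamma-periodic. *)
Definition lagrangian_angle (Y : C -> 'cV[R]_4) (f beta : C -> R) : Prop :=
  smooth_plane beta /\
  forall z, Omega (expR (- f z) *: vpartial_x Y z)
                  (expR (- f z) *: vpartial_y Y z)
            = (cos (beta z) +i* sin (beta z))%C.

Definition hamiltonian_stationary (Y : C -> 'cV[R]_4) (f : C -> R) : Prop :=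
  exists beta : C -> R,
    lagrangian_angle Y f beta /\ forall z, laplacian beta z = 0.

End Immersions.

(* Main.v *)
Require Import Defs.
From mathcomp Require Import all_boot all_order all_algebra.
From mathcomp Require Import all_classical all_reals all_analysis.
From mathcomp Require Import complex.
From mathcomp Require Import zify ring lra.

(** Why the theorem is true.

    The angle [beta] need not descend to the torus, but [cos beta] and
    [sin beta] do, hence so does its gradient; a harmonic function on a torus
    is constant, so [beta] is affine ([harmonic_angle_affine]).  Put
    [h = beta / 2].  Conformality and the Lagrangian condition amount to
    [X_y = e^{i beta} j X_x] ([frame_rotation]), so that with
    [Z = e^{- i h} X_x] one has [X_x = e^{i h} Z] and [X_y = e^{i h} j Z].
    Equality of the mixed derivatives of [X] is then a Dirac equation with
    constant coefficients, [Z_x + j Z_y = N Z] with [N = a i + b k] and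
    [(a, b)] the gradient of [h] ([dirac]); squared, it says that the Laplacian
    of [Z] is [- r^2 Z], where [r^2 = a^2 + b^2] ([spinor_laplace]).  Moreover
    [r > 0], since otherwise [X] would be harmonic on the torus, hence constant
    ([constant_angle_absurd]).

    [Z] is periodic for the doubled lattice, and only finitely many points of
    the dual lattice lie on the circle of radius [r]: a periodic eigenfunction
    of the Laplacian is a finite sum of plane waves ([fourier_finite]).  The
    Dirac equation determines how the cosine and sine coefficients of each wave
    are related, and yields
    [Z = sum_k (cos th_k + J_k sin th_k) P_k] with [J_k^2 = - 1]
    ([dirac_modes]).

    It remains to obtain each such finite sum of modes from a constant
    polynomial potential ([modes_finite_type]); everything can be written down.
    Let [p = (a + i b) / r], let [n_k] be the unit direction of the [k]-th
    wave, and put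
    [phi = (r / 2) (z p^-1 lambda^-2 + conj(z) p lambda^2)],
    [s_k = (E - E^-1) / (2 i)], [c_k = (E + E^-1) / 2],
    [E = lambda^2 p / n_k], and [K_k = s_k k - c_k i], whose square is [- 1].
    The extended frame [H] has rotation part [e^{i phi}] and translation part
    [sum_k (e^{i phi} (cos th_k + K_k sin th_k) - 1) (a_k P_k / s_k)] for
    suitable [a_k] depending on [lambda] only.  The potential [eta] has rotation part
    [c L_i] and translation part [sum_k (c / s_k) i a_k P_k], where [c] is a
    Laurent polynomial of degree [d = 4 N + 2], real on the circle and
    divisible by all the [s_k].  The solution of the potential equation is
    the exponential of [w eta], with [w = lambda^(d-2) z]: it has rotation part
    [e^{i w c}] and translation part [sum_k (e^{i w c} - 1) (a_k P_k / s_k)].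
    Consequently [B = H^-1 M] has rotation part [e^{i (w c - phi)}] and
    translation part
    [sum_k (e^{i (w c - phi)} - cos th_k - K_k sin th_k) (a_k P_k / s_k)]
    ([bQ_eq]).  As [s_k] vanishes on the unit circle only, [B] is holomorphic
    in the punctured disk; the leading coefficient of [c] is chosen such that
    [w c - phi] extends by 0 to [lambda = 0], and there [B = 1]
    ([LambdaBplus_Bm]).  The zeros of [s_k] on the circle give no poles
    either: [(1 + c_k) (phi - th_k) / (2 s_k)] and
    [(1 - c_k) (phi + th_k) / (2 s_k)] are Laurent polynomials ([fsY]), and
    they are multiplied by the entire functions [sin x / x] and
    [(1 - cos x) / x] of the phases. *)

Set Implicit Arguments.
Unset Strict Implicit.
Unset Printing Implicit Defensive.
Import Order.TTheory GRing.Theory Num.Theory.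
Import numFieldNormedType.Exports.
Local Open Scope classical_set_scope.
Local Open Scope ring_scope.

(** * Calculus of one real variable *)

Section RealCalculus.
Variable R : realType.
Implicit Types (f g u : R -> R) (x t s : R).

Lemma is_derive_of_ball f x l :
  (forall e, 0 < e -> exists2 d, 0 < d &
    forall h, `|h| < d -> `|f (x + h) - f x - h * l| <= e * `|h|) ->
  is_derive x 1 f l.
Proof.
move=> H.
have L : h^-1 *: (f (h *: (1 : R) + x) - f x) @[h --> (0:R)^'] --> l.
  apply/cvgrPdist_le => e e0.
  have [d d0 Hd] := H e e0.
  near=> h.
  have h0 : h != 0 by near: h; exact: nbhs_dnbhs_neq.
  have hm : `|h| < d by near: h; apply: dnbhs0_lt.
  have := Hd h hm.
  have -> : l - h^-1 *: (f (h *: (1 : R) + x) - f x) =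
    - (h^-1 * (f (x + h) - f x - h * l)).
    by rewrite /GRing.scale /= mulr1 [h + x]addrC; field.
  by rewrite normrN normrM normfV ler_pdivrMl ?normr_gt0// [X in _ <= X]mulrC.
apply: DeriveDef; first by apply/cvg_ex; exists l.
exact/cvg_lim.
Unshelve. all: by end_near.
Qed.

(** Second-order error bounds are stable under integration, which is how the
    derivatives of parameter integrals are obtained below. *)
Lemma is_derive_quad f x l C :
  (forall h, `|h| <= 1 -> `|f (x + h) - f x - h * l| <= C * h ^+ 2) ->
  is_derive x 1 f l.
Proof.
move=> H.
have C0 : 0 <= C.
  have := H 1; rewrite normr1 lexx expr1n mulr1 => /(_ isT) /(le_trans _); apply.
  exact: normr_ge0.
apply: is_derive_of_ball => e e0; exists (Num.min 1 (e / (C + 1))).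
  by rewrite lt_min ltr01 divr_gt0// ltr_wpDl.
move=> h; rewrite lt_min => /andP[h1 h2]; apply: le_trans (H h (ltW h1)) _.
rewrite -(real_normK (num_real h)) expr2 mulrA ler_wpM2r//.
have : `|h| * (C + 1) < e by rewrite -ltr_pdivlMr// ltr_wpDl.
have := normr_ge0 h.
lra.
Qed.

Lemma is_derive_ball f x l : is_derive x 1 f l ->
  forall e, 0 < e -> exists2 d, 0 < d &
    forall h, `|h| < d -> `|f (x + h) - f x - h * l| <= e * `|h|.
Proof.
move=> [fd fl] e e0.
have L : h^-1 *: (f (h *: (1 : R) + x) - f x) @[h --> (0:R)^'] --> l.
  by rewrite -fl; exact: fd.
move/cvgrPdist_le : L => /(_ e e0) /=.
move=> [d /= d0 Hd].
exists d => // h hd.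
have [->|h0] := eqVneq h 0; first by rewrite addr0 subrr mul0r subrr normr0 mulr0.
have := Hd h; rewrite /= sub0r normrN hd => /(_ isT h0).
rewrite /GRing.scale /= mulr1 [h + x]addrC => H.
have -> : f (x + h) - f x - h * l = - (h * (l - h^-1 * (f (x + h) - f x))).
  rewrite mulrBr mulrA mulfV// mul1r; ring.
by rewrite normrN normrM mulrC ler_wpM2r.
Qed.

Lemma mvt f (df : R -> R) a b : (forall x, is_derive x 1 f (df x)) ->
  exists2 c, `|c - a| <= `|b - a| & f b - f a = df c * (b - a).
Proof.
move=> fd.
have cf : continuous f.
  by move=> x; apply: differentiable_continuous; apply/derivable1_diffP; case: (fd x).
have [ab|ba] := leP a b.
  have [c cab E] := MVT_segment ab (fun x _ => fd x)
    (continuous_subspaceT cf).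
  exists c => //; move: cab; rewrite in_itv /= => /andP[ac cb].
  by rewrite !ger0_norm ?subr_ge0// lerD2r.
have [c cab E] := MVT_segment (ltW ba) (fun x _ => fd x)
  (continuous_subspaceT cf).
exists c; last by rewrite -opprB E -mulrN opprB.
move: cab; rewrite in_itv /= => /andP[ac cb].
rewrite ![`|_ - a|]distrC !ger0_norm ?subr_ge0// ?(ltW ba)//.
by rewrite lerD2l lerN2.
Qed.

Lemma taylor2 f (f1 f2 : R -> R) C x h :
  (forall t, is_derive t 1 f (f1 t)) -> (forall t, is_derive t 1 f1 (f2 t)) ->
  (forall t, `|t - x| <= `|h| -> `|f2 t| <= C) ->
  `|f (x + h) - f x - h * f1 x| <= C * h ^+ 2.
Proof.
move=> d1 d2 H.
have [c ch ->] := mvt x (x + h) d1.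
have [c' ch' E] := mvt x c d2.
rewrite addrAC subrr add0r in ch *.
have -> : f1 c * h - h * f1 x = (f2 c' * (c - x)) * h by rewrite -E; ring.
rewrite !normrM -mulrA.
have c'h := le_trans ch' ch.
apply: ler_pM => //; first exact: H.
by rewrite -(real_normK (num_real h)) expr2 ler_wpM2r.
Qed.

Definition I01 f : R := (\int[lebesgue_measure]_(s in `[0%R, 1%R]) f s)%R.

Lemma I01_integrable f : continuous f ->
  lebesgue_measure.-integrable `[0%R, 1%R] (EFin \o f).
Proof.
move=> cf; apply: continuous_compact_integrable; first exact: segment_compact.
exact: continuous_subspaceT.
Qed.

Lemma eq_I01 f g : (forall s, 0 <= s <= 1 -> f s = g s) -> I01 f = I01 g.
Proof.
move=> fg; apply: eq_Rintegral => s; rewrite inE /= in_itv /=; exact: fg.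
Qed.

Lemma I01D f g : continuous f -> continuous g ->
  I01 (fun s => f s + g s) = I01 f + I01 g.
Proof. by move=> cf cg; apply: RintegralD => //; exact: I01_integrable. Qed.

Lemma I01Z f c : continuous f -> I01 (fun s => c * f s) = c * I01 f.
Proof. by move=> cf; apply: RintegralZl => //; exact: I01_integrable. Qed.

Lemma I01_cst c : I01 (fun=> c) = c.
Proof.
rewrite /I01 Rintegral_cst//= lebesgue_measure_itv /= lte_fin ltr01 sube0 /=.
by rewrite mulr1.
Qed.

Lemma I01_le f g : continuous f -> continuous g ->
  (forall s, 0 <= s <= 1 -> f s <= g s) -> I01 f <= I01 g.
Proof.
by move=> cf cg fg; apply: le_Rintegral => //; exact: I01_integrable.
Qed.

Lemma I01_bound f C : continuous f ->
  (forall s, 0 <= s <= 1 -> `|f s| <= C) -> `|I01 f| <= C.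
Proof.
move=> cf H; rewrite ler_norml; apply/andP; split.
  rewrite -[X in X <= _]I01_cst; apply: I01_le => //.
    by move=> s; exact: cst_continuous.
  by move=> s /H; rewrite ler_norml => /andP[].
rewrite -[X in _ <= X]I01_cst; apply: I01_le => //.
  by move=> s; exact: cst_continuous.
by move=> s /H; rewrite ler_norml => /andP[].
Qed.

Lemma is_derive_continuous f (df : R -> R) :
  (forall x, is_derive x 1 f (df x)) -> continuous f.
Proof.
move=> fd x; apply: differentiable_continuous; apply/derivable1_diffP.
by case: (fd x).
Qed.

Lemma I01_FTC F f : (forall x, is_derive x 1 F (f x)) -> continuous f ->
  I01 f = F 1 - F 0.
Proof.
move=> Ff cf.
have cF := is_derive_continuous Ff.
rewrite /I01 /Rintegral (@continuous_FTC2 _ f F)//.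
- exact: continuous_subspaceT.
- split.
  + by move=> x _; case: (Ff x).
  + exact/cvg_at_right_filter/cF.
  + exact/cvg_at_left_filter/cF.
- by move=> x _; rewrite derive1E; case: (Ff x).
Qed.

Lemma I01_hat_gt0 f (a b : R) : 0 <= a -> a < b -> b <= 1 -> continuous f ->
  (forall s, 0 <= f s) -> (forall s, a <= s <= b -> 2^-1 <= f s) -> 0 < I01 f.
Proof.
move=> a0 ab b1 cf f0 fab.
have E : ((2^-1 * (b - a))%:E <= \int[lebesgue_measure]_(s in `[0%R, 1%R]) (f s)%:E)%E.
  have -> : ((2^-1 * (b - a))%:E = \int[@lebesgue_measure R]_(s in `[a, b]) (2^-1)%:E)%E.
    rewrite integral_cst//= lebesgue_measure_itv /= lte_fin ab EFinM.
    by rewrite EFinB.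
  have mf := measurable_int _ (I01_integrable cf).
  have sub : `[a, b] `<=` `[0%R, 1%R] by apply: subset_itv; rewrite bnd_simp.
  have mab := measurable_funS (measurable_itv _) sub mf.
  apply: (@le_trans _ _ (\int[lebesgue_measure]_(s in `[a, b]) (f s)%:E)%E).
    by apply: ge0_le_integral => // x _; rewrite lee_fin invr_ge0.
  apply: ge0_subset_integral => //.
  by move=> x /= _; rewrite lee_fin.
have E2 : (\int[lebesgue_measure]_(s in `[0%R, 1%R]) (f s)%:E)%E \is a fin_num.
  exact/integrable_fin_num/I01_integrable.
rewrite /I01 /Rintegral.
move: E; rewrite -(fineK E2) lee_fin => E.
by apply: lt_le_trans E; rewrite mulr_gt0// subr_gt0.
Qed.

End RealCalculus.

(** * Calculus of one complex variable *)

Section ComplexCalculus.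
Variable R : realType.
Local Notation C := R[i].
Local Notation Re := (@complex.Re R).
Local Notation Im := (@complex.Im R).
Local Notation normc := (@Normc.normc R).
Implicit Types (F G : C -> C) (u v : R -> C) (z w : C) (s t : R).

Lemma normrCE z : `|z| = (normc z)%:C%C.
Proof. by []. Qed.

Lemma normc_ge0 z : 0 <= normc z.
Proof. by case: z => a b; exact: sqrtr_ge0. Qed.

Lemma Re_le_normc z : `|Re z| <= normc z.
Proof. by rewrite -lecR -normrCE; exact: normc_ge_Re. Qed.

Lemma normcD z w : normc (z + w) <= normc z + normc w.
Proof. exact: le_normcD. Qed.

Lemma normc_toC s : normc (toC s) = `|s|.
Proof. by rewrite /= expr0n addr0 sqrtr_sqr. Qed.

Lemma normcI z : normc ('i%C * z) = normc z.
Proof. by rewrite Normc.normcM /= expr0n expr1n add0r sqrtr1 mul1r. Qed.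

Lemma Im_le_normc z : `|Im z| <= normc z.
Proof.
rewrite -normcI; apply: le_trans (Re_le_normc _).
by case: z => a b /=; rewrite mul0r mul1r sub0r normrN.
Qed.

Lemma normc_le z : normc z <= `|Re z| + `|Im z|.
Proof.
have -> : z = toC (Re z) + 'i%C * toC (Im z) by exact: complexE.
apply: le_trans (normcD _ _) _.
rewrite normcI !normc_toC.
by case: z => a b /=; rewrite !mul0r !mul1r ?subrr ?addr0 ?add0r ?subr0.
Qed.

Lemma Re_mul z w : Re (z * w) = Re z * Re w - Im z * Im w.
Proof. by case: z; case: w. Qed.

Lemma Im_mul z w : Im (z * w) = Re z * Im w + Im z * Re w.
Proof. by case: z; case: w. Qed.

Lemma ReD z w : Re (z + w) = Re z + Re w.
Proof. by case: z; case: w. Qed.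

Lemma ImD z w : Im (z + w) = Im z + Im w.
Proof. by case: z; case: w. Qed.

Lemma ReN z : Re (- z) = - Re z.
Proof. by case: z. Qed.

Lemma ImN z : Im (- z) = - Im z.
Proof. by case: z. Qed.

Lemma eq_ReIm z w : Re z = Re w -> Im z = Im w -> z = w.
Proof. by case: z => a b; case: w => c d /= -> ->. Qed.

Lemma toCD s t : toC (s + t) = toC s + toC t :> C.
Proof. by apply: eq_ReIm; rewrite /= ?addr0. Qed.

Lemma toCM s t : toC (s * t) = toC s * toC t :> C.
Proof. by apply: eq_ReIm; rewrite /= ?mulr0 ?mul0r ?subr0 ?addr0. Qed.

Lemma toCN s : toC (- s) = - toC s :> C.
Proof. by apply: eq_ReIm; rewrite /= ?oppr0. Qed.

Lemma is_cderive_of_ball F w l :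
  (forall e, 0 < e -> exists2 d, 0 < d &
    forall h, normc h < d -> normc (F (w + h) - F w - h * l) <= e * normc h) ->
  is_derive (w : C^o) 1 (F : C^o -> C^o) l.
Proof.
move=> H.
have L : (h^-1 *: ((F : C^o -> C^o) (h *: (1 : C^o) + w) - (F : C^o -> C^o) w) : C^o)
    @[h --> (0:C^o)^'] --> (l : C^o).
  apply/cvgrPdist_le => e e0.
  have [e0r eE] : 0 < Re e /\ e = (Re e)%:C%C.
    by move: e0; rewrite ltcE /= => /andP[/eqP ei er]; split=> //; apply: eq_ReIm.
  have [d d0 Hd] := H _ e0r.
  have d0c : 0 < d%:C%C :> C by rewrite ltcR.
  exists (d%:C%C) => //= h.
  rewrite /ball_ /= sub0r normrN => hm h0; move: hm; rewrite normrCE ltcR => hd.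
  have Hh := Hd h hd.
  have -> : (l : C^o) - (h^-1 *: ((F : C^o -> C^o) (h *: (1 : C^o) + w) - (F : C^o -> C^o) w) : C^o) =
    - (h^-1 * (F (w + h) - F w - h * l)) :> C.
    rewrite /GRing.scale /= mulr1 [h + w]addrC.
    by rewrite [in RHS]mulrBr mulKf//; ring.
  rewrite eE normrCE lecR normcN Normc.normcM Normc.normcV.
  have hp : 0 < normc h.
    rewrite lt_neqAle normc_ge0 andbT eq_sym; apply/eqP => /Normc.eq0_normc E.
    by rewrite E eqxx in h0.
  by rewrite ler_pdivrMl// [X in _ <= X]mulrC.
apply: DeriveDef; first by apply/cvg_ex; exists l.
exact/cvg_lim.
Qed.

Lemma is_cderive_quad F w l C0 :
  (forall h, normc h <= 1 -> normc (F (w + h) - F w - h * l) <= C0 * normc h ^+ 2) ->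
  is_derive (w : C^o) 1 (F : C^o -> C^o) l.
Proof.
move=> H; apply: is_cderive_of_ball => e e0.
have C00 : 0 <= C0.
  have := H 1; rewrite Normc.normc1 lexx expr1n mulr1 => /(_ isT) /(le_trans _); apply.
  exact: normc_ge0.
exists (Num.min 1 (e / (C0 + 1))).
  by rewrite lt_min ltr01 divr_gt0// ltr_wpDl.
move=> h; rewrite lt_min => /andP[h1 h2].
apply: (le_trans (H h (ltW h1))).
rewrite expr2 mulrA ler_wpM2r ?normc_ge0//.
have : normc h * (C0 + 1) < e by rewrite -ltr_pdivlMr// ltr_wpDl.
have := normc_ge0 h.
lra.
Qed.

Lemma is_cderive_ball F w l : is_derive (w : C^o) 1 (F : C^o -> C^o) l ->
  forall e, 0 < e -> exists2 d, 0 < d &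
    forall h, normc h < d -> normc (F (w + h) - F w - h * l) <= e * normc h.
Proof.
move=> [fd fl] e e0.
have L : (h^-1 *: ((F : C^o -> C^o) (h *: (1 : C^o) + w) - (F : C^o -> C^o) w) : C^o)
    @[h --> (0:C^o)^'] --> (l : C^o).
  by rewrite -fl; exact: fd.
have e0c : 0 < e%:C%C :> C by rewrite ltcR.
move/cvgrPdist_le : L => /(_ _ e0c) [d /= d0 Hd].
have [d0r dE] : 0 < Re d /\ d = (Re d)%:C%C.
  by move: d0; rewrite ltcE /= => /andP[/eqP ei er]; split=> //; apply: eq_ReIm.
exists (Re d) => // h hd.
have [->|h0] := eqVneq h 0.
  by rewrite addr0 subrr mul0r subrr Normc.normc0 mulr0.
have := Hd h; rewrite /ball_ /= sub0r normrN dE normrCE ltcR hd => /(_ isT h0).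
rewrite /GRing.scale /= mulr1 [h + w]addrC normrCE lecR => H.
have -> : F (w + h) - F w - h * l = h * - (l - h^-1 * (F (w + h) - F w)).
  by rewrite opprB mulrBr mulrA mulfV// mul1r.
rewrite Normc.normcM mulrC ler_wpM2r ?normc_ge0//.
by rewrite normcN.
Qed.

(** The chain rule for a complex variable and for a real path at the same time:
    the increments range over any type, with [nI] measuring their size. *)
Lemma comp_ball (I : Type) (nI : I -> R) F (v : I -> C) (m : I -> C) w f' g' (e : R) :
  (forall h, 0 <= nI h) -> 0 < e ->
  (forall e, 0 < e -> exists2 d, 0 < d &
    forall h, normc h < d -> normc (F (w + h) - F w - h * f') <= e * normc h) ->
  (forall h, normc (m h) = nI h) ->
  (forall e, 0 < e -> exists2 d, 0 < d &
    forall h, nI h < d -> normc (v h - w - m h * g') <= e * nI h) ->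
  exists2 d, 0 < d & forall h, nI h < d ->
    normc (F (v h) - F w - m h * (f' * g')) <= e * nI h.
Proof.
move=> nI0 e0 HF nm Hu.
pose K := normc g' + 1.
have K0 : 0 < K by rewrite ltr_wpDl ?normc_ge0.
pose N := normc f' + 1.
have N0 : 0 < N by rewrite ltr_wpDl ?normc_ge0.
have e1 : 0 < e / (2 * K) by rewrite divr_gt0// mulr_gt0.
have e2 : 0 < e / (2 * N) by rewrite divr_gt0// mulr_gt0.
have [d1 d10 H1] := HF _ e1.
have [d2 d20 H2] := Hu _ e2.
have [d3 d30 H3] := Hu _ ltr01.
exists (Num.min d2 (Num.min d3 (d1 / K))).
  by rewrite !lt_min d20 d30 divr_gt0.
move=> h; rewrite !lt_min => /and3P[/H2 h2 /H3 h3 h1].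
set k := v h - w.
have kb : normc k <= K * nI h.
  have -> : k = (k - m h * g') + m h * g' by ring.
  apply: le_trans (normcD _ _) _; rewrite Normc.normcM nm /K.
  move: h3; rewrite mul1r -/k; lra.
have kd : normc k < d1.
  by apply: le_lt_trans kb _; rewrite mulrC -ltr_pdivlMr.
have := H1 _ kd; rewrite {1}/k (_ : w + _ = v h); last by ring.
move=> h4.
have -> : F (v h) - F w - m h * (f' * g') =
  (F (v h) - F w - k * f') + f' * (k - m h * g') by ring.
apply: le_trans (normcD _ _) _; rewrite Normc.normcM.
have A1 : normc (F (v h) - F w - k * f') <= e / 2 * nI h.
  apply: le_trans h4 _.
  have -> : e / 2 * nI h = e / (2 * K) * (K * nI h) by field; rewrite lt0r_neq0.
  by rewrite ler_wpM2l// ltW.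
have A2 : normc f' * normc (k - m h * g') <= e / 2 * nI h.
  have -> : e / 2 * nI h = N * (e / (2 * N) * nI h) by field; rewrite lt0r_neq0.
  apply: ler_pM => //; try exact: normc_ge0.
  by rewrite /N lerDl.
lra.
Qed.

Lemma is_cderive_comp F G w f' g' :
  is_derive (G w : C^o) 1 (F : C^o -> C^o) f' ->
  is_derive (w : C^o) 1 (G : C^o -> C^o) g' ->
  is_derive (w : C^o) 1 ((fun z => F (G z)) : C^o -> C^o) (f' * g').
Proof.
move=> HF HG; apply: is_cderive_of_ball => e e0.
exact: (comp_ball normc_ge0 e0 (is_cderive_ball HF) (fun=> erefl) (is_cderive_ball HG)).
Qed.

(** The derivative is taken along the real line while the values are complex,
    hence the components. *)
Definition is_pder u t (l : C) : Prop :=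
  is_derive t 1 (fun s => Re (u s)) (Re l) /\
  is_derive t 1 (fun s => Im (u s)) (Im l).

Lemma is_pder_ball u t l : is_pder u t l ->
  forall e, 0 < e -> exists2 d, 0 < d &
    forall h : R, `|h| < d -> normc (u (t + h) - u t - toC h * l) <= e * `|h|.
Proof.
move=> [ur ui] e e0.
have e2 : 0 < e / 2 by rewrite divr_gt0.
have [d1 d10 H1] := is_derive_ball ur e2.
have [d2 d20 H2] := is_derive_ball ui e2.
exists (Num.min d1 d2); first by rewrite lt_min d10 d20.
move=> h; rewrite lt_min => /andP[/H1 h1 /H2 h2].
apply: le_trans (normc_le _) _.
rewrite !(ReD, ImD, ReN, ImN, Re_mul, Im_mul) /= !mul0r subr0 addr0.
have := normr_ge0 h; lra.
Qed.

Lemma pder_of_ball u t l :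
  (forall e, 0 < e -> exists2 d, 0 < d &
    forall h : R, `|h| < d -> normc (u (t + h) - u t - toC h * l) <= e * `|h|) ->
  is_pder u t l.
Proof.
move=> H; split; apply: is_derive_of_ball => e e0; have [d d0 Hd] := H e e0; exists d => // h hd.
- apply: le_trans (Hd h hd); apply: le_trans (Re_le_normc _).
  by rewrite !(ReD, ReN, Re_mul) /= mul0r subr0.
- apply: le_trans (Hd h hd); apply: le_trans (Im_le_normc _).
  by rewrite !(ImD, ImN, Im_mul) /= mul0r addr0.
Qed.

Lemma is_pder_comp F u t (f' l : C) :
  is_derive (u t : C^o) 1 (F : C^o -> C^o) f' -> is_pder u t l ->
  is_pder (fun s => F (u s)) t (f' * l).
Proof.
move=> HF Hu; apply: pder_of_ball => e e0.
exact: (comp_ball (@normr_ge0 _ _) e0 (is_cderive_ball HF) normc_toC (is_pder_ball Hu)).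
Qed.

Lemma is_pder_cst (c : C) t : is_pder (fun=> c) t 0.
Proof. by split; exact: is_derive_cst. Qed.

Lemma is_pder_toC t : is_pder (fun s => toC s) t 1.
Proof. by split; [exact: is_derive_id | exact: is_derive_cst]. Qed.

Lemma is_pder_eq u t l l' : is_pder u t l -> l = l' -> is_pder u t l'.
Proof. by move=> + <-. Qed.

Lemma is_pderD u v t l m : is_pder u t l -> is_pder v t m ->
  is_pder (fun s => u s + v s) t (l + m).
Proof.
move=> [a b] [c d]; split.
  have -> : (fun s => Re (u s + v s)) = (fun s => Re (u s)) + (fun s => Re (v s)).
    by apply/funext => s; rewrite ReD.
  by rewrite ReD; exact: is_deriveD.
have -> : (fun s => Im (u s + v s)) = (fun s => Im (u s)) + (fun s => Im (v s)).
  by apply/funext => s; rewrite ImD.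
by rewrite ImD; exact: is_deriveD.
Qed.

Lemma is_pderM u v t l m : is_pder u t l -> is_pder v t m ->
  is_pder (fun s => u s * v s) t (l * v t + u t * m).
Proof.
move=> [a b] [c d]; split.
  have -> : (fun s => Re (u s * v s)) =
     (fun s => Re (u s)) * (fun s => Re (v s)) - (fun s => Im (u s)) * (fun s => Im (v s)).
    by apply/funext => s; rewrite Re_mul.
  apply: (is_derive_eq (is_deriveB (is_deriveM a c) (is_deriveM b d))).
  by rewrite ReD !Re_mul /GRing.scale /=; ring.
have -> : (fun s => Im (u s * v s)) =
   (fun s => Re (u s)) * (fun s => Im (v s)) + (fun s => Im (u s)) * (fun s => Re (v s)).
  by apply/funext => s; rewrite Im_mul.
apply: (is_derive_eq (is_deriveD (is_deriveM a d) (is_deriveM b c))).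
by rewrite ImD !Im_mul /GRing.scale /=; ring.
Qed.

Lemma is_pderZ (c : C) u t l : is_pder u t l -> is_pder (fun s => c * u s) t (c * l).
Proof.
move=> H; apply: is_pder_eq (is_pderM (is_pder_cst c t) H) _.
by rewrite mul0r add0r.
Qed.

Lemma is_pderN u t l : is_pder u t l -> is_pder (fun s => - u s) t (- l).
Proof.
move=> /(is_pderZ (-1)); rewrite mulN1r.
by have -> : (fun s => - u s) = (fun s => -1 * u s) by apply/funext => s; rewrite mulN1r.
Qed.

Definition ccont u : Prop :=
  continuous (fun s => Re (u s)) /\ continuous (fun s => Im (u s)).

Lemma pder_ccont u (l : R -> C) : (forall t, is_pder u t (l t)) -> ccont u.
Proof.
move=> H; split.
  by apply: (@is_derive_continuous _ _ (fun t => Re (l t))) => t; case: (H t).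
by apply: (@is_derive_continuous _ _ (fun t => Im (l t))) => t; case: (H t).
Qed.

Lemma ccontD u v : ccont u -> ccont v -> ccont (fun s => u s + v s).
Proof.
move=> [a b] [c d]; split.
  have -> : (fun s => Re (u s + v s)) = (fun s => Re (u s) + Re (v s)).
    by apply/funext => s; rewrite ReD.
  by move=> s; apply: continuousD; [exact: a|exact: c].
have -> : (fun s => Im (u s + v s)) = (fun s => Im (u s) + Im (v s)).
  by apply/funext => s; rewrite ImD.
by move=> s; apply: continuousD; [exact: b|exact: d].
Qed.

Lemma ccontM u v : ccont u -> ccont v -> ccont (fun s => u s * v s).
Proof.
move=> [a b] [c d]; split.
  have -> : (fun s => Re (u s * v s)) =
      (fun s => Re (u s) * Re (v s) - Im (u s) * Im (v s)).
    by apply/funext => s; rewrite Re_mul.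
  move=> s; apply: cvgB; apply: cvgM;
    [exact: a|exact: c|exact: b|exact: d].
have -> : (fun s => Im (u s * v s)) =
      (fun s => Re (u s) * Im (v s) + Im (u s) * Re (v s)).
  by apply/funext => s; rewrite Im_mul.
move=> s; apply: cvgD; apply: cvgM;
    [exact: a|exact: d|exact: b|exact: c].
Qed.

Lemma ccont_cst (c : C) : ccont (fun=> c).
Proof. by split=> s; exact: cst_continuous. Qed.

Definition Cint u : C :=
  (I01 (fun s => Re (u s)) +i* I01 (fun s => Im (u s)))%C.

Lemma eq_Cint u v : (forall s, 0 <= s <= 1 -> u s = v s) -> Cint u = Cint v.
Proof.
by move=> H; rewrite /Cint; congr (_ +i* _)%C; apply: eq_I01 => s /H ->.
Qed.

Lemma CintD u v : ccont u -> ccont v ->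
  Cint (fun s => u s + v s) = Cint u + Cint v.
Proof.
move=> [a b] [c d]; apply: eq_ReIm; rewrite /= -I01D//.
  by apply: eq_I01 => s _; rewrite ReD.
by apply: eq_I01 => s _; rewrite ImD.
Qed.

Lemma CintZ (c : C) u : ccont u -> Cint (fun s => c * u s) = c * Cint u.
Proof.
move=> [a b]; apply: eq_ReIm.
  rewrite Re_mul /= -mulNr -!I01Z// -I01D.
  - by apply: eq_I01 => s _; rewrite Re_mul mulNr.
  - by move=> s; apply: cvgM; [exact: cst_continuous|exact: a].
  - by move=> s; apply: cvgM; [exact: cst_continuous|exact: b].
rewrite Im_mul /= -!I01Z// -I01D.
- by apply: eq_I01 => s _; rewrite Im_mul.
- by move=> s; apply: cvgM; [exact: cst_continuous|exact: b].
- by move=> s; apply: cvgM; [exact: cst_continuous|exact: a].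
Qed.

Lemma CintN u : ccont u -> Cint (fun s => - u s) = - Cint u.
Proof.
move=> cu; rewrite -mulN1r -CintZ//; apply: eq_Cint => s _; by rewrite mulN1r.
Qed.

Lemma CintB u v : ccont u -> ccont v ->
  Cint (fun s => u s - v s) = Cint u - Cint v.
Proof.
move=> cu cv; rewrite CintD// ?CintN//.
have -> : (fun s => - v s) = (fun s => -1 * v s) by apply/funext => s; rewrite mulN1r.
exact: ccontM (ccont_cst _) cv.
Qed.

Lemma Cint_cst (c : C) : Cint (fun=> c) = c.
Proof. by rewrite /Cint !I01_cst; case: c. Qed.

Lemma Cint_bound u B : ccont u -> (forall s, 0 <= s <= 1 -> normc (u s) <= B) ->
  normc (Cint u) <= 2 * B.
Proof.
move=> [a b] H; apply: le_trans (normc_le _) _.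
have A1 : `|I01 (fun s => Re (u s))| <= B.
  by apply: I01_bound => // s /H; apply: le_trans; exact: Re_le_normc.
have A2 : `|I01 (fun s => Im (u s))| <= B.
  by apply: I01_bound => // s /H; apply: le_trans; exact: Im_le_normc.
rewrite /=; lra.
Qed.

Lemma Cint_FTC u v : (forall t, is_pder u t (v t)) -> ccont v ->
  Cint v = u 1 - u 0.
Proof.
move=> H [cr ci]; apply: eq_ReIm.
  rewrite ReD ReN /=; apply: (@I01_FTC R (fun s => Re (u s))) => // t.
  by case: (H t).
rewrite ImD ImN /=; apply: (@I01_FTC R (fun s => Im (u s))) => // t.
by case: (H t).
Qed.

Lemma Cint_conj u : ccont u -> Cint (fun s => (u s)^*%C) = (Cint u)^*%C.
Proof.
move=> [a b]; apply: eq_ReIm => /=; first by apply: eq_I01 => s _; case: (u s).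
rewrite -mulN1r -I01Z//.
by apply: eq_I01 => s _; rewrite mulN1r; case: (u s).
Qed.

End ComplexCalculus.

(** * The exponential and its moments *)

Section Exponential.
Variable R : realType.
Local Notation C := R[i].
Local Notation Re := (@complex.Re R).
Local Notation Im := (@complex.Im R).
Local Notation normc := (@Normc.normc R).
Implicit Types (z w h : C) (s t : R).

Lemma cexp0 : cexp (0 : C) = 1.
Proof. by rewrite /cexp /= expR0 cos0 sin0 !mul1r. Qed.

Lemma cexpD z w : cexp (z + w) = cexp z * cexp w.
Proof.
apply: eq_ReIm; rewrite /cexp ?(Re_mul, Im_mul) /= ReD ImD expRD.
  by rewrite cosD; ring.
by rewrite sinD; ring.
Qed.

Lemma cexp_neq0 z : cexp z != 0.
Proof.
apply/eqP => E; have := cexpD z (- z); rewrite E mul0r subrr cexp0.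
by move/eqP; rewrite oner_eq0.
Qed.

Lemma cexpN z : cexp (- z) = (cexp z)^-1.
Proof.
by apply: (mulfI (cexp_neq0 z)); rewrite -cexpD subrr cexp0 mulfV// cexp_neq0.
Qed.

Lemma normc_cexp z : normc (cexp z) = expR (Re z).
Proof.
by rewrite /= !exprMn -mulrDr cos2Dsin2 mulr1 sqrtr_sqr ger0_norm// expR_ge0.
Qed.

Lemma cexp_conj z : (cexp z)^*%C = cexp (z^*%C).
Proof. by apply: eq_ReIm; case: z => a b /=; rewrite ?cosN ?sinN ?mulrN. Qed.

(** Taylor's estimates of [exp], [cos] and [sin] combined on the unit disk. *)
Lemma cexp_quad h : normc h <= 1 ->
  normc (cexp h - 1 - h) <= (3 * expR 1 + 1) * normc h ^+ 2.
Proof.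
move=> h1; set x := Re h; set y := Im h; set n := normc h; set E : R := expR 1.
have xn : `|x| <= n by exact: Re_le_normc.
have yn : `|y| <= n by exact: Im_le_normc.
have E1 : 1 <= E by rewrite -(@expR0 R) ler_expR.
have eE (t : R) : `|t| <= 1 -> expR t <= E.
  by move=> t1; rewrite ler_expR (le_trans (ler_norm t)).
have n0 : 0 <= n by exact: normc_ge0.
have x2 : x ^+ 2 <= n ^+ 2.
  by rewrite -(real_normK (num_real x)) lerXn2r// nnegrE.
have y2 : y ^+ 2 <= n ^+ 2.
  by rewrite -(real_normK (num_real y)) lerXn2r// nnegrE.
have B1 : `|expR x - 1 - x| <= E * x ^+ 2.
  have := @taylor2 R expR expR expR E 0 x (@is_derive_expR R) (@is_derive_expR R).
  rewrite add0r expR0 mulr1; apply=> t; rewrite subr0 => tx.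
  by rewrite ger0_norm ?expR_ge0// eE// (le_trans tx)// (le_trans xn).
have B2 : `|cos y - 1| <= y ^+ 2.
  have D (t : R) : is_derive t 1 (fun s => - sin s) (- cos t).
    by apply: is_derive_eq.
  have := @taylor2 R cos (fun s => - sin s) (fun s => - cos s) 1 0 y
    (@is_derive_cos R) D.
  rewrite add0r cos0 sin0 oppr0 mulr0 subr0 mul1r; apply=> t _.
  by rewrite normrN cos_max.
have B3 : `|sin y - y| <= y ^+ 2.
  have := @taylor2 R sin cos (fun s => - sin s) 1 0 y
    (@is_derive_sin R) (@is_derive_cos R).
  rewrite add0r cos0 sin0 mulr1 subr0 mul1r; apply=> t _.
  by rewrite normrN sin_max.
have B4 : `|expR x - 1| <= E * `|x|.
  have [c] := mvt 0 x (@is_derive_expR R).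
  rewrite expR0 !subr0 => cx ->; rewrite normrM ler_wpM2r//.
  by rewrite ger0_norm ?expR_ge0// eE// (le_trans cx)// (le_trans xn).
have xE : expR x <= E by rewrite eE// (le_trans xn).
apply: le_trans (normc_le _) _.
have -> : Re (cexp h - 1 - h) = (expR x - 1 - x) + expR x * (cos y - 1).
  rewrite !(ReD, ReN) /= -/x -/y; ring.
have -> : Im (cexp h - 1 - h) = (expR x - 1) * sin y + (sin y - y).
  rewrite !(ImD, ImN) /= -/x -/y; ring.
have T1 : `|expR x - 1 - x + expR x * (cos y - 1)| <= E * n ^+ 2 + E * n ^+ 2.
  apply: le_trans (ler_normD _ _) _; apply: lerD.
    by apply: (le_trans B1); rewrite ler_wpM2l// expR_ge0.
  rewrite normrM (ger0_norm (expR_ge0 x)); apply: ler_pM => //.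
  exact: le_trans B2 y2.
have S1 : `|sin y| <= `|y|.
  have [c] := mvt 0 y (@is_derive_sin R).
  rewrite sin0 !subr0 => _ ->; rewrite normrM -[X in _ <= X]mul1r.
  by rewrite ler_wpM2r// cos_max.
have T2 : `|(expR x - 1) * sin y + (sin y - y)| <= E * n ^+ 2 + n ^+ 2.
  apply: le_trans (ler_normD _ _) _; apply: lerD; last exact: le_trans B3 y2.
  rewrite normrM expr2 mulrA; apply: ler_pM => //.
    by apply: (le_trans B4); rewrite ler_wpM2l// expR_ge0.
  exact: le_trans S1 yn.
lra.
Qed.

Lemma is_pder_cexp_ray w t :
  is_pder (fun s => cexp (toC s * w)) t (w * cexp (toC t * w)).
Proof.
have Er s : Re (toC s * w) = s * Re w by rewrite Re_mul /= mul0r subr0.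
have Ei s : Im (toC s * w) = s * Im w by rewrite Im_mul /= mul0r addr0.
have Dl (a : R) : is_derive t 1 (fun s : R => s * a) a.
  have -> : (fun s : R => s * a) = (fun s : R => a *: id s).
    by apply/funext => s; rewrite /GRing.scale /= mulrC.
  by apply: is_derive_eq; rewrite /GRing.scale /= mulr1.
have De : is_derive t 1 (fun s => expR (s * Re w)) (expR (t * Re w) * Re w).
  exact: (is_derive1_comp (is_derive_expR _) (Dl (Re w))).
have Dc : is_derive t 1 (fun s => cos (s * Im w)) (- sin (t * Im w) * Im w).
  exact: (is_derive1_comp (is_derive_cos _) (Dl (Im w))).
have Ds : is_derive t 1 (fun s => sin (s * Im w)) (cos (t * Im w) * Im w).
  exact: (is_derive1_comp (is_derive_sin _) (Dl (Im w))).
split.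
  have -> : (fun s => Re (cexp (toC s * w))) =
    (fun s => expR (s * Re w)) * (fun s => cos (s * Im w)).
    by apply/funext => s; rewrite [LHS]/= Er Ei.
  apply: is_derive_eq.
  by rewrite Re_mul [in RHS]/cexp [in RHS]/= Er Ei /GRing.scale /=; ring.
have -> : (fun s => Im (cexp (toC s * w))) =
  (fun s => expR (s * Re w)) * (fun s => sin (s * Im w)).
  by apply/funext => s; rewrite [LHS]/= Er Ei.
apply: is_derive_eq.
by rewrite Im_mul [in RHS]/cexp [in RHS]/= Er Ei /GRing.scale /=; ring.
Qed.

Lemma ccont_cexp_ray w : ccont (fun s => cexp (toC s * w)).
Proof. exact: pder_ccont (is_pder_cexp_ray w). Qed.

Lemma ccont_toC : ccont (fun s => toC s : C).
Proof. exact: pder_ccont (@is_pder_toC R). Qed.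

Lemma ccont_toCX k : ccont (fun s => toC s ^+ k : C).
Proof.
elim: k => [|k IH].
  have -> : (fun s => toC s ^+ 0 : C) = (fun=> 1) by apply/funext => s; rewrite expr0.
  exact: ccont_cst.
have -> : (fun s => toC s ^+ k.+1 : C) = (fun s => toC s * toC s ^+ k).
  by apply/funext => s; rewrite exprS.
exact: ccontM ccont_toC IH.
Qed.

(** Moments of the exponential.  They are entire, closed under differentiation,
    and [phi 0 w] makes sense of [(e^w - 1) / w] at 0. *)
Definition phi k w : C := Cint (fun s => toC s ^+ k * cexp (toC s * w)).

Lemma ccont_phi k w : ccont (fun s => toC s ^+ k * cexp (toC s * w)).
Proof. exact: ccontM (ccont_toCX k) (ccont_cexp_ray w). Qed.

Lemma is_cderive_phi k w :
  is_derive (w : C^o) 1 (phi k : C^o -> C^o) (phi k.+1 w).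
Proof.
apply: (@is_cderive_quad _ _ _ _ (2 * (expR `|Re w| * (3 * expR 1 + 1)))) => h h1.
rewrite /phi -!CintB ?CintZ -?CintZ; try exact: ccont_phi.
have ch : ccont (fun s => h * (toC s ^+ k.+1 * cexp (toC s * w))).
  exact: ccontM (ccont_cst _) (ccont_phi _ _).
rewrite -CintB; try exact: ccont_phi.
- rewrite -!mulrA; apply: Cint_bound => [|s /andP[s0 s1]].
    have -> : (fun s => toC s ^+ k * cexp (toC s * (w + h))
        - toC s ^+ k * cexp (toC s * w) - h * (toC s ^+ k.+1 * cexp (toC s * w)))
      = (fun s => toC s ^+ k * cexp (toC s * (w + h)) +
        ((-1) * (toC s ^+ k * cexp (toC s * w))
         + (-1) * (h * (toC s ^+ k.+1 * cexp (toC s * w))))).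
      by apply/funext => s; ring.
    apply: ccontD; first exact: ccont_phi.
    by apply: ccontD; apply: ccontM; try exact: ccont_cst; first exact: ccont_phi.
  have -> : toC s ^+ k * cexp (toC s * (w + h)) - toC s ^+ k * cexp (toC s * w)
       - h * (toC s ^+ k.+1 * cexp (toC s * w)) =
     toC s ^+ k * (cexp (toC s * w) * (cexp (toC s * h) - 1 - toC s * h)).
    by rewrite mulrDr cexpD exprS; ring.
  have nk : normc (toC s ^+ k) <= 1.
    have -> : toC s ^+ k = toC (s ^+ k) :> C.
      by elim: (k) => [|m IH]; rewrite ?expr0// !exprS IH toCM.
    by rewrite normc_toC ger0_norm ?exprn_ge0// exprn_ile1.
  have ns : normc (toC s * h) <= normc h.
    rewrite Normc.normcM normc_toC ger0_norm// -[X in _ <= X]mul1r.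
    by rewrite ler_wpM2r// normc_ge0.
  rewrite !Normc.normcM -[X in _ <= X]mul1r.
  apply: ler_pM; rewrite ?mulr_ge0 ?normc_ge0//.
  apply: ler_pM; rewrite ?normc_ge0//.
    rewrite normc_cexp ler_expR Re_mul /= mul0r subr0.
    apply: le_trans (ler_norm _) _; rewrite normrM (ger0_norm s0).
    by rewrite -[X in _ <= X]mul1r ler_wpM2r.
  apply: le_trans (cexp_quad (le_trans ns h1)) _.
  rewrite ler_wpM2l//.
  by rewrite lerXn2r// nnegrE normc_ge0.
have -> : (fun s => toC s ^+ k * cexp (toC s * (w + h)) - toC s ^+ k * cexp (toC s * w))
   = (fun s => toC s ^+ k * cexp (toC s * (w + h)) +
        ((-1) * (toC s ^+ k * cexp (toC s * w)))).
  by apply/funext => s; ring.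
apply: ccontD; first exact: ccont_phi.
by apply: ccontM; [exact: ccont_cst|exact: ccont_phi].
exact: ch.
Qed.

Lemma phi0E w : w * phi 0 w = cexp w - 1.
Proof.
rewrite /phi -CintZ; last exact: ccont_phi.
rewrite (@Cint_FTC _ (fun s => cexp (toC s * w))).
- by rewrite mul1r mul0r cexp0.
- by move=> t; apply: is_pder_eq (is_pder_cexp_ray w t) _; rewrite expr0 mul1r.
- exact: ccontM (ccont_cst _) (ccont_phi _ _).
Qed.

Lemma phi1E w : phi 0 w + w * phi 1 w = cexp w.
Proof.
have cw : ccont (fun s => w * (toC s ^+ 1 * cexp (toC s * w))).
  exact: ccontM (ccont_cst _) (ccont_phi _ _).
rewrite /phi -CintZ -?CintD//; try exact: ccont_phi.
rewrite (@Cint_FTC _ (fun s => toC s * cexp (toC s * w))).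
- by rewrite !mul1r !mul0r subr0.
- move=> t; apply: is_pder_eq (is_pderM (is_pder_toC t) (is_pder_cexp_ray w t)) _.
  by rewrite expr0 expr1; ring.
- by apply: ccontD => //; exact: ccont_phi.
Qed.

Lemma conjcM z w : (z * w)^*%C = z^*%C * w^*%C.
Proof. exact: rmorphM. Qed.

Lemma conjcX z n : (z ^+ n)^*%C = z^*%C ^+ n.
Proof. exact: rmorphXn. Qed.

Lemma conjc_toC s : (toC s)^*%C = toC s :> C.
Proof. exact: conjc_real. Qed.

Lemma phi_conj k w : (phi k w)^*%C = phi k (w^*%C).
Proof.
rewrite /phi -Cint_conj; last exact: ccont_phi.
apply: eq_Cint => s _.
by rewrite conjcM conjcX cexp_conj conjcM !conjc_toC.
Qed.

End Exponential.

(** * Trigonometric functions and a class of loops closed under differentiation *)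

Section Entire.
Variable R : realType.
Local Notation C := R[i].
Local Notation Re := (@complex.Re R).
Local Notation Im := (@complex.Im R).
Local Notation ii := ('i%C : C).
Implicit Types (z w c : C) (f g : C -> C) (s t : R).

Lemma iiM : ii * ii = -1.
Proof. by rewrite -expr2 sqr_i. Qed.

Lemma ii_neq0 : ii != 0.
Proof. by apply/eqP => E; move: iiM; rewrite E mul0r => /eqP; rewrite eq_sym oppr_eq0 oner_eq0. Qed.

Lemma two_neq0 : 2 != 0 :> C.
Proof. by rewrite pnatr_eq0. Qed.

(** [sin w / w], entire by way of [phi 0]. *)
Definition sinc w : C := (phi 0 (ii * w) + phi 0 (- (ii * w))) / 2.
(** [(1 - cos w) / w], entire by way of [phi 0]. *)
Definition cosc w : C := (phi 0 (ii * w) - phi 0 (- (ii * w))) / (2 * ii).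

Lemma sincE w : w * sinc w = csin w.
Proof.
rewrite /csin -[cexp (ii * w)](subrK 1) -[cexp (- _)](subrK 1) -!phi0E /sinc.
by field; rewrite ii_neq0.
Qed.

Lemma coscE w : w * cosc w = 1 - ccos w.
Proof.
rewrite /ccos -[cexp (ii * w)](subrK 1) -[cexp (- _)](subrK 1) -!phi0E /cosc.
have -> : w * ((phi 0 (ii * w) - phi 0 (- (ii * w))) / (2 * ii)) =
  - (ii * ii) * w * ((phi 0 (ii * w) - phi 0 (- (ii * w))) / (2 * ii)).
  by rewrite iiM opprK mul1r.
by field; rewrite ii_neq0.
Qed.

Lemma sincN w : sinc (- w) = sinc w.
Proof. by rewrite /sinc mulrN opprK addrC. Qed.

Lemma coscN w : cosc (- w) = - cosc w.
Proof. by rewrite /cosc mulrN opprK -[RHS]mulNr opprB. Qed.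

Lemma conjc_ii : (ii)^*%C = - ii.
Proof. by apply: eq_ReIm; rewrite /= ?oppr0. Qed.

Lemma conjcD z w : (z + w)^*%C = z^*%C + w^*%C.
Proof. exact: rmorphD. Qed.

Lemma conjcN z : (- z)^*%C = - z^*%C.
Proof. exact: rmorphN. Qed.

Lemma conjcV z : (z^-1)^*%C = (z^*%C)^-1.
Proof. exact: fmorphV. Qed.

Lemma conjc_2 : (2 : C)^*%C = 2.
Proof. exact: rmorph_nat. Qed.

Lemma sinc_conj w : (sinc w)^*%C = sinc (w^*%C).
Proof.
rewrite /sinc conjcM conjcD conjcV conjc_2 !phi_conj conjcN !conjcM conjc_ii.
by rewrite mulNr opprK addrC.
Qed.

Lemma cosc_conj w : (cosc w)^*%C = cosc (w^*%C).
Proof.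
rewrite /cosc conjcM conjcV conjcM conjc_2 conjc_ii conjcD conjcN !phi_conj.
rewrite conjcN !conjcM conjc_ii !mulNr opprK.
by field; rewrite ?oppr_eq0 ii_neq0.
Qed.

Lemma ccos_conj w : (ccos w)^*%C = ccos (w^*%C).
Proof.
rewrite /ccos conjcM conjcV conjc_2 conjcD !cexp_conj conjcN conjcM conjc_ii.
by rewrite mulNr opprK addrC.
Qed.

Lemma csin_conj w : (csin w)^*%C = csin (w^*%C).
Proof.
rewrite /csin conjcM conjcV conjcM conjc_2 conjc_ii conjcD conjcN !cexp_conj.
rewrite conjcN conjcM conjc_ii !mulNr opprK.
by field; rewrite ?oppr_eq0 ii_neq0.
Qed.

Lemma ccosN w : ccos (- w) = ccos w.
Proof. by rewrite /ccos mulrN opprK addrC. Qed.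

Lemma csinN w : csin (- w) = - csin w.
Proof. by rewrite /csin mulrN opprK -[RHS]mulNr opprB. Qed.

Lemma ccosD z w : ccos (z + w) = ccos z * ccos w - csin z * csin w.
Proof.
rewrite /ccos /csin mulrDr opprD !cexpD.
have E : (2 * ii)^-1 ^+ 2 = - (2^-1 ^+ 2).
  have -> : (2 * ii)^-1 = - (ii * 2^-1).
    apply: (mulfI (mulf_neq0 two_neq0 ii_neq0)).
    rewrite mulfV ?mulf_neq0 ?two_neq0 ?ii_neq0// mulrN.
    have -> : 2 * ii * (ii * 2^-1) = (ii * ii) * (2 * 2^-1) by ring.
    by rewrite iiM mulfV ?two_neq0// mulN1r opprK.
  by rewrite sqrrN exprMn sqr_i mulN1r.
apply/eqP; rewrite -subr_eq0; apply/eqP.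
transitivity (((cexp (ii * z) - cexp (- (ii * z))) *
   (cexp (ii * w) - cexp (- (ii * w)))) * ((2^-1) ^+ 2 + (2 * ii)^-1 ^+ 2)).
  by field; rewrite ii_neq0.
by rewrite E subrr mulr0.
Qed.

Lemma csinD z w : csin (z + w) = csin z * ccos w + ccos z * csin w.
Proof.
by rewrite /ccos /csin mulrDr opprD !cexpD; field; rewrite ii_neq0.
Qed.

Lemma ccos0 : ccos (0 : C) = 1.
Proof. by rewrite /ccos mulr0 oppr0 cexp0; field. Qed.

Lemma csin0 : csin (0 : C) = 0.
Proof. by rewrite /csin mulr0 oppr0 subrr mul0r. Qed.

Lemma ccos2Dsin2 w : ccos w ^+ 2 + csin w ^+ 2 = 1.
Proof.
by have := ccosD w (- w); rewrite subrr ccos0 ccosN csinN => ->; ring.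
Qed.

Lemma ccos_toC t : ccos (toC t) = toC (cos t) :> C.
Proof.
rewrite /ccos /cexp; apply: (mulIf two_neq0); rewrite mulfVK ?two_neq0//.
apply: eq_ReIm; rewrite ?(ReD, ImD, Re_mul, Im_mul, ReN, ImN) /=.
all: by rewrite !(mul0r, mul1r, mulr0, subr0, addr0, add0r, oppr0, expR0) ?cosN ?sinN; ring.
Qed.

Lemma csin_toC t : csin (toC t) = toC (sin t) :> C.
Proof.
rewrite /csin /cexp; apply: (mulIf two_neq0); apply: (mulIf ii_neq0).
rewrite -[LHS]mulrA mulfVK ?mulf_neq0 ?two_neq0 ?ii_neq0//.
apply: eq_ReIm; rewrite ?(ReD, ImD, Re_mul, Im_mul, ReN, ImN) /=.
all: by rewrite !(mul0r, mul1r, mulr0, subr0, addr0, add0r, oppr0, expR0) ?cosN ?sinN; ring.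
Qed.

Lemma is_cderive_eq (f : C -> C) w l m :
  is_derive (w : C^o) 1 (f : C^o -> C^o) l -> l = m ->
  is_derive (w : C^o) 1 (f : C^o -> C^o) m.
Proof. by move=> + <-. Qed.

Lemma is_cderive_cst c w : is_derive (w : C^o) 1 ((fun=> c) : C^o -> C^o) 0.
Proof. exact: is_derive_cst. Qed.

Lemma is_cderive_id w : is_derive (w : C^o) 1 ((fun z => z) : C^o -> C^o) 1.
Proof. exact: is_derive_id. Qed.

Lemma is_cderiveD f g w l m :
  is_derive (w : C^o) 1 (f : C^o -> C^o) l -> is_derive (w : C^o) 1 (g : C^o -> C^o) m ->
  is_derive (w : C^o) 1 ((fun z => f z + g z) : C^o -> C^o) (l + m).
Proof. by move=> hf hg; exact: (@is_deriveD C C^o C^o f g). Qed.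

Lemma is_cderiveM f g w l m :
  is_derive (w : C^o) 1 (f : C^o -> C^o) l -> is_derive (w : C^o) 1 (g : C^o -> C^o) m ->
  is_derive (w : C^o) 1 ((fun z => f z * g z) : C^o -> C^o) (f w * m + g w * l).
Proof. by move=> hf hg; exact: (@is_deriveM C C^o f g). Qed.

Lemma is_cderiveZ c f w l :
  is_derive (w : C^o) 1 (f : C^o -> C^o) l ->
  is_derive (w : C^o) 1 ((fun z => c * f z) : C^o -> C^o) (c * l).
Proof.
move=> hf; apply: is_cderive_eq (is_cderiveM (is_cderive_cst c w) hf) _.
by rewrite mulr0 addr0.
Qed.

Lemma is_cderive_inv w : w != 0 ->
  is_derive (w : C^o) 1 ((fun z => z^-1) : C^o -> C^o) (- w ^- 2).
Proof.
move=> w0; apply: DeriveDef.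
  exact: (@derivableV C C^o id).
by rewrite (@deriveV C C^o id)// derive_id /GRing.scale /= mulr1.
Qed.

(** Expressions in a complex variable, regular away from 0 if [b] holds and
    entire otherwise.  As the derivative of [phi k] is [phi k.+1] the class is
    closed under differentiation, so it gives both holomorphy in the disk and
    smoothness on the circle. *)
Inductive ent (b : bool) : (C -> C) -> Prop :=
| ent_cst c : ent b (fun=> c)
| ent_id : ent b (fun z => z)
| ent_inv : b -> ent b (fun z => z^-1)
| ent_add f g : ent b f -> ent b g -> ent b (fun z => f z + g z)
| ent_mul f g : ent b f -> ent b g -> ent b (fun z => f z * g z)
| ent_phi k f : ent b f -> ent b (fun z => phi k (f z)).

Lemma ent_derive b f : ent b f -> exists2 f', ent b f' &
  forall w, (b -> w != 0) -> is_derive (w : C^o) 1 (f : C^o -> C^o) (f' w).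
Proof.
elim=> {f} [c||b1|f g ef [f' ef' Df] eg [g' eg' Dg]|f g ef [f' ef' Df] eg [g' eg' Dg]|k f ef [f' ef' Df]].
- by exists (fun=> 0); [exact: ent_cst|move=> w _; exact: is_cderive_cst].
- by exists (fun=> 1); [exact: ent_cst|move=> w _; exact: is_cderive_id].
- exists (fun z => (-1) * (z^-1 * z^-1)).
    by apply: ent_mul; [exact: ent_cst|apply: ent_mul; exact: ent_inv].
  move=> w /(_ b1) w0; apply: is_cderive_eq (is_cderive_inv w0) _.
  by rewrite -expr2 exprVn mulN1r.
- exists (fun z => f' z + g' z); first exact: ent_add.
  by move=> w w0; apply: is_cderiveD; [exact: Df|exact: Dg].
- exists (fun z => f z * g' z + g z * f' z).
    by apply: ent_add; exact: ent_mul.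
  by move=> w w0; apply: is_cderiveM; [exact: Df|exact: Dg].
- exists (fun z => phi k.+1 (f z) * f' z).
    by apply: ent_mul => //; exact: ent_phi.
  by move=> w w0; apply: is_cderive_comp; [exact: is_cderive_phi|exact: Df].
Qed.

Lemma ent_eq b f g : ent b f -> (forall z, f z = g z) -> ent b g.
Proof. by move=> ef H; have <- : f = g by apply/funext. Qed.

Lemma ent_opp b f : ent b f -> ent b (fun z => - f z).
Proof.
by move=> ef; apply: ent_eq (ent_mul (ent_cst b (-1)) ef) _ => z; rewrite mulN1r.
Qed.

Lemma ent_sub b f g : ent b f -> ent b g -> ent b (fun z => f z - g z).
Proof. by move=> ef eg; exact: ent_add ef (ent_opp eg). Qed.

Lemma ent_exp b f n : ent b f -> ent b (fun z => f z ^+ n).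
Proof.
move=> ef; elim: n => [|n IH]; first exact: ent_eq (ent_cst b 1) _.
by apply: ent_eq (ent_mul ef IH) _ => z; rewrite exprS.
Qed.

Lemma ent_sum b (I : Type) (r : seq I) (f : I -> C -> C) :
  (forall i, ent b (f i)) -> ent b (fun z => \sum_(i <- r) f i z).
Proof.
move=> ef; elim: r => [|i r IH].
  by apply: ent_eq (ent_cst b 0) _ => z; rewrite big_nil.
by apply: ent_eq (ent_add (ef i) IH) _ => z; rewrite big_cons.
Qed.

Lemma ent_prod b (I : Type) (r : seq I) (P : pred I) (f : I -> C -> C) :
  (forall i, ent b (f i)) -> ent b (fun z => \prod_(i <- r | P i) f i z).
Proof.
move=> ef; elim: r => [|i r IH].
  by apply: ent_eq (ent_cst b 1) _ => z; rewrite big_nil.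
have [Pi|nPi] := boolP (P i).
  by apply: ent_eq (ent_mul (ef i) IH) _ => z; rewrite big_cons Pi.
by apply: ent_eq IH _ => z; rewrite big_cons (negbTE nPi).
Qed.

Lemma ent_sinc b f : ent b f -> ent b (fun z => sinc (f z)).
Proof.
move=> ef; have e1 : ent b (fun z => ii * f z) by exact: ent_mul (ent_cst _ _) ef.
apply: ent_mul (ent_cst _ _); apply: ent_add; apply: ent_phi => //; exact: ent_opp.
Qed.

Lemma ent_cosc b f : ent b f -> ent b (fun z => cosc (f z)).
Proof.
move=> ef; have e1 : ent b (fun z => ii * f z) by exact: ent_mul (ent_cst _ _) ef.
apply: ent_mul (ent_cst _ _); apply: ent_sub; apply: ent_phi => //; exact: ent_opp.
Qed.

Lemma ent_ccos b f : ent b f -> ent b (fun z => ccos (f z)).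
Proof.
move=> ef; apply: ent_eq (ent_sub (ent_cst b 1) (ent_mul ef (ent_cosc ef))) _ => z.
by rewrite coscE; ring.
Qed.

Lemma ent_csin b f : ent b f -> ent b (fun z => csin (f z)).
Proof.
by move=> ef; apply: ent_eq (ent_mul ef (ent_sinc ef)) _ => z; rewrite sincE.
Qed.

Lemma smooth_path_coind (P : (R -> R) -> Prop) :
  (forall u, P u -> exists2 v, P v & forall t, is_derive t 1 u (v t)) ->
  forall u, P u -> smooth_path u.
Proof.
move=> H u Pu n.
have Pn : P (derive1n n u).
  elim: n => [//|n /H[v Pv Dv]]; rewrite derive1nS.
  have -> : (u^`(n)^`())%classic = v by apply/funext => t; rewrite derive1E; case: (Dv t).
  by [].
by move=> t; have [v _ /(_ t) []] := H _ Pn.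
Qed.

Lemma on_circleE t : on_circle t = cexp (ii * toC t) :> C.
Proof. by apply: eq_ReIm; rewrite /= !(mul0r, mul1r, mulr0, subr0, add0r, addr0, oppr0, expR0). Qed.

Lemma normr_on_circle t : `|on_circle t| = 1 :> C.
Proof.
rewrite on_circleE normrCE normc_cexp Re_mul /= mul0r mulr0 subrr expR0.
by [].
Qed.

Lemma on_circle_neq0 t : on_circle t != 0 :> C.
Proof. by rewrite -normr_gt0 normr_on_circle. Qed.

Lemma is_pder_on_circle t : is_pder (@on_circle R) t (ii * on_circle t).
Proof.
have -> : @on_circle R = (fun s => cexp (toC s * ii)).
  by apply/funext => s; rewrite on_circleE mulrC.
exact: is_pder_cexp_ray.
Qed.

Lemma ent_smooth b f : ent b f -> smooth_pathC (fun t => f (on_circle t)).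
Proof.
have H g : ent b g -> exists2 g', ent b g' &
    forall t, is_pder (fun t => g (on_circle t)) t (g' (on_circle t)).
  move=> eg; have [g' eg' Dg] := ent_derive eg.
  exists (fun z => g' z * (ii * z)).
    by apply: ent_mul => //; apply: ent_mul; [exact: ent_cst|exact: ent_id].
  move=> t; apply: is_pder_comp (is_pder_on_circle t).
  by apply: Dg => _; exact: on_circle_neq0.
move=> ef; split.
  apply: (smooth_path_coind
    (P := fun u => exists2 g, ent b g & u = (fun t => Re (g (on_circle t))))); last by exists f.
  move=> u [g /H[g' eg' Dg] ->].
  exists (fun t => Re (g' (on_circle t))); first by exists g'.
  by move=> t; case: (Dg t).
apply: (smooth_path_coind
    (P := fun u => exists2 g, ent b g & u = (fun t => Im (g (on_circle t))))); last by exists f.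
move=> u [g /H[g' eg' Dg] ->].
exists (fun t => Im (g' (on_circle t))); first by exists g'.
by move=> t; case: (Dg t).
Qed.

Lemma is_cderive_sinc w : is_derive (w : C^o) 1 (sinc : C^o -> C^o)
  ((ii * phi 1 (ii * w) - ii * phi 1 (- (ii * w))) / 2).
Proof.
have D1 : is_derive (w : C^o) 1 ((fun z => ii * z) : C^o -> C^o) ii.
  by apply: is_cderive_eq (is_cderiveZ ii (is_cderive_id w)) _; rewrite mulr1.
have D2 : is_derive (w : C^o) 1 ((fun z => - (ii * z)) : C^o -> C^o) (- ii).
  have -> : (fun z => - (ii * z)) = (fun z => (-ii) * z) by apply/funext => z; rewrite mulNr.
  by apply: is_cderive_eq (is_cderiveZ (- ii) (is_cderive_id w)) _; rewrite mulr1.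
have D3 := is_cderiveD (is_cderive_comp (is_cderive_phi 0 _) D1)
  (is_cderive_comp (is_cderive_phi 0 _) D2).
have := is_cderiveZ 2^-1 D3.
have -> : (fun z => 2^-1 * (phi 0 (ii * z) + phi 0 (- (ii * z)))) = sinc.
  by apply/funext => z; rewrite /sinc mulrC.
by move=> H; apply: is_cderive_eq H _; ring.
Qed.

Lemma is_cderive_cosc w : is_derive (w : C^o) 1 (cosc : C^o -> C^o)
  ((phi 1 (ii * w) + phi 1 (- (ii * w))) / 2).
Proof.
have D1 : is_derive (w : C^o) 1 ((fun z => ii * z) : C^o -> C^o) ii.
  by apply: is_cderive_eq (is_cderiveZ ii (is_cderive_id w)) _; rewrite mulr1.
have D2 : is_derive (w : C^o) 1 ((fun z => - (ii * z)) : C^o -> C^o) (- ii).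
  have -> : (fun z => - (ii * z)) = (fun z => (-ii) * z) by apply/funext => z; rewrite mulNr.
  by apply: is_cderive_eq (is_cderiveZ (- ii) (is_cderive_id w)) _; rewrite mulr1.
have D3 := is_cderiveD (is_cderive_comp (is_cderive_phi 0 _) D1)
  (is_cderiveZ (-1) (is_cderive_comp (is_cderive_phi 0 _) D2)).
have := is_cderiveZ (2 * ii)^-1 D3.
have -> : (fun z => (2 * ii)^-1 * (phi 0 (ii * z) + -1 * phi 0 (- (ii * z)))) = cosc.
  by apply/funext => z; rewrite /cosc mulrC mulN1r.
by move=> H; apply: is_cderive_eq H _; field; rewrite ii_neq0.
Qed.

(** The derivative of [w * sinc w = sin w] by the product rule; it eliminates
    [phi 1] from all the derivatives computed later. *)
Lemma sinc_lin w : sinc w +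
  w * ((ii * phi 1 (ii * w) - ii * phi 1 (- (ii * w))) / 2) = ccos w.
Proof. by rewrite /ccos -!phi1E /sinc; field. Qed.

Lemma cosc_lin w : cosc w + w * ((phi 1 (ii * w) + phi 1 (- (ii * w))) / 2) = csin w.
Proof.
by rewrite /csin -!phi1E /cosc; field; rewrite ii_neq0.
Qed.

End Entire.

(** * Quaternions and affine maps *)

Section QuaternionAlgebra.
Variable K : comNzRingType.
Implicit Types (p q u v : 'cV[K]_4) (A : 'M[K]_4) (T S : 'cV[K]_4).

Definition qv (a b c d : K) : 'cV[K]_4 := \col_l [:: a; b; c; d]`_l.

Lemma qv0 a b c d : qv a b c d 0 0 = a. Proof. by rewrite mxE. Qed.
Lemma qv1 a b c d : qv a b c d 1 0 = b. Proof. by rewrite mxE. Qed.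
Lemma qv2 a b c d : qv a b c d 2 0 = c. Proof. by rewrite mxE. Qed.
Lemma qv3 a b c d : qv a b c d 3 0 = d. Proof. by rewrite mxE. Qed.
Definition qvE := (qv0, qv1, qv2, qv3).

Lemma I4_ind (S : 'I_4 -> Prop) : S 0 -> S 1 -> S 2 -> S 3 -> forall i, S i.
Proof.
move=> h0 h1 h2 h3; case=> [[|[|[|[|//]]]] li].
- by have -> : Ordinal li = 0 by exact: val_inj.
- by have -> : Ordinal li = 1 by exact: val_inj.
- by have -> : Ordinal li = 2 by exact: val_inj.
- by have -> : Ordinal li = 3 by exact: val_inj.
Qed.

Lemma cV4_eq u v : u 0 0 = v 0 0 -> u 1 0 = v 1 0 -> u 2 0 = v 2 0 ->
  u 3 0 = v 3 0 -> u = v.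
Proof.
by move=> h0 h1 h2 h3; apply/matrixP => i j; rewrite ord1; move: i; apply: I4_ind.
Qed.

Lemma qv_eta u : u = qv (u 0 0) (u 1 0) (u 2 0) (u 3 0).
Proof. by apply: cV4_eq; rewrite qvE. Qed.

Lemma qmul0 p q : qmul p q 0 0 =
  p 0 0 * q 0 0 - p 1 0 * q 1 0 - p 2 0 * q 2 0 - p 3 0 * q 3 0.
Proof. by rewrite mxE. Qed.
Lemma qmul1 p q : qmul p q 1 0 =
  p 0 0 * q 1 0 + p 1 0 * q 0 0 + p 2 0 * q 3 0 - p 3 0 * q 2 0.
Proof. by rewrite mxE. Qed.
Lemma qmul2 p q : qmul p q 2 0 =
  p 0 0 * q 2 0 - p 1 0 * q 3 0 + p 2 0 * q 0 0 + p 3 0 * q 1 0.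
Proof. by rewrite mxE. Qed.
Lemma qmul3 p q : qmul p q 3 0 =
  p 0 0 * q 3 0 + p 1 0 * q 2 0 - p 2 0 * q 1 0 + p 3 0 * q 0 0.
Proof. by rewrite mxE. Qed.
Definition qmulE := (qmul0, qmul1, qmul2, qmul3).

Lemma sum4 (F : 'I_4 -> K) : \sum_l F l = F 0 + F 1 + F 2 + F 3.
Proof.
rewrite !big_ord_recl big_ord0 addr0 -!addrA.
by congr (F _ + (F _ + (F _ + F _))); exact: val_inj.
Qed.

Lemma addqE u v i : (u + v) i 0 = u i 0 + v i 0. Proof. by rewrite mxE. Qed.
Lemma oppqE u i : (- u) i 0 = - u i 0. Proof. by rewrite mxE. Qed.
Lemma scaleqE c u i : (c *: u) i 0 = c * u i 0. Proof. by rewrite mxE. Qed.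
Lemma zeroqE i : (0 : 'cV[K]_4) i 0 = 0. Proof. by rewrite mxE. Qed.
Lemma qiE : qi = qv 0 1 0 0 :> 'cV[K]_4.
Proof. by apply: cV4_eq; rewrite !mxE. Qed.
Lemma qjE : qj = qv 0 0 1 0 :> 'cV[K]_4.
Proof. by apply: cV4_eq; rewrite !mxE. Qed.
Definition qlinE := (addqE, oppqE, scaleqE, zeroqE).

Lemma qmulA p q u : qmul p (qmul q u) = qmul (qmul p q) u.
Proof. by apply: cV4_eq; rewrite !qmulE; ring. Qed.

Lemma qmulDr p u v : qmul p (u + v) = qmul p u + qmul p v.
Proof. by apply: cV4_eq; rewrite !(qmulE, qlinE); ring. Qed.

Lemma qmulDl u v p : qmul (u + v) p = qmul u p + qmul v p.
Proof. by apply: cV4_eq; rewrite !(qmulE, qlinE); ring. Qed.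

Lemma qmulNr p u : qmul p (- u) = - qmul p u.
Proof. by apply: cV4_eq; rewrite !(qmulE, qlinE); ring. Qed.

Lemma qmulNl p u : qmul (- p) u = - qmul p u.
Proof. by apply: cV4_eq; rewrite !(qmulE, qlinE); ring. Qed.

Lemma qmulZr p c u : qmul p (c *: u) = c *: qmul p u.
Proof. by apply: cV4_eq; rewrite !(qmulE, qlinE); ring. Qed.

Lemma qmulZl c p u : qmul (c *: p) u = c *: qmul p u.
Proof. by apply: cV4_eq; rewrite !(qmulE, qlinE); ring. Qed.

Lemma qmulr0 p : qmul p 0 = 0.
Proof. by apply: cV4_eq; rewrite !(qmulE, qlinE); ring. Qed.

Lemma qv_mul a b c d a' b' c' d' : qmul (qv a b c d) (qv a' b' c' d') =
  qv (a * a' - b * b' - c * c' - d * d') (a * b' + b * a' + c * d' - d * c')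
     (a * c' - b * d' + c * a' + d * b') (a * d' + b * c' - c * b' + d * a').
Proof. by apply: cV4_eq; rewrite !(qmulE, qvE). Qed.

Lemma qv_scale e a b c d : e *: qv a b c d = qv (e * a) (e * b) (e * c) (e * d).
Proof. by apply: cV4_eq; rewrite !(qlinE, qvE). Qed.

Lemma qv_add a b c d a' b' c' d' : qv a b c d + qv a' b' c' d' =
  qv (a + a') (b + b') (c + c') (d + d').
Proof. by apply: cV4_eq; rewrite !(qlinE, qvE). Qed.

Lemma qv_opp a b c d : - qv a b c d = qv (- a) (- b) (- c) (- d).
Proof. by apply: cV4_eq; rewrite !(qlinE, qvE). Qed.

Lemma qv_eq a b c d a' b' c' d' : a = a' -> b = b' -> c = c' -> d = d' ->
  qv a b c d = qv a' b' c' d'.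
Proof. by move=> -> -> -> ->. Qed.

Lemma qj_anti a b c d : qmul (qv (- a) b (- c) d) qj = - qmul qj (qv a b c d).
Proof. by rewrite qjE !qv_mul qv_opp; apply: qv_eq; ring. Qed.

Lemma qij_anti u v :
  qmul (qmul qi (qmul qj u)) v = - qmul qj (qmul (qmul qi u) v).
Proof.
have E : qmul qi qj = - qmul qj qi :> 'cV[K]_4.
  by rewrite qiE qjE !qv_mul qv_opp; apply: qv_eq; ring.
by rewrite [qmul qi (qmul qj u)]qmulA E qmulNl qmulNl -!qmulA.
Qed.

Lemma qj_mul a b c d : qmul qj (qv a b c d) = qv (- c) d a (- b).
Proof. by rewrite qjE !qv_mul; apply: qv_eq; ring. Qed.

Lemma qmul_sumr (I : finType) p (F : I -> 'cV[K]_4) :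
  qmul p (\sum_i F i) = \sum_i qmul p (F i).
Proof.
apply: (big_morph (qmul p)); [exact: qmulDr|exact: qmulr0].
Qed.

Lemma qmul0l u : qmul 0 u = 0.
Proof. by apply: cV4_eq; rewrite !(qmulE, qlinE); ring. Qed.

Lemma qmul1l u : qmul (qv 1 0 0 0) u = u.
Proof. by apply: cV4_eq; rewrite !(qmulE, qvE); ring. Qed.

Lemma LqE p u : Lq p *m u = qmul p u.
Proof.
by apply: cV4_eq; rewrite mxE sum4 !mxE /=; ring.
Qed.

Lemma cV4_mx_eq A (B : 'M[K]_4) : (forall u : 'cV[K]_4, A *m u = B *m u) -> A = B.
Proof.
move=> H; apply/matrixP => i j.
have := H (delta_mx j 0) => /matrixP /(_ i 0).
by rewrite -!colE !mxE.
Qed.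

Definition rotq (c s : K) : 'M[K]_4 := c *: 1%:M + s *: Lq qi.

Lemma rotqE c s u : rotq c s *m u = qmul (qv c s 0 0) u.
Proof.
rewrite mulmxDl -!scalemxAl mul1mx LqE qiE.
by apply: cV4_eq; rewrite !(qmulE, qlinE, qvE); ring.
Qed.

Lemma aff_mul A T (B : 'M[K]_4) S : aff A T *m aff B S = aff (A *m B) (A *m S + T).
Proof.
by rewrite /aff mulmx_block !mulmx0 !mul0mx !mul1mx mulmx1 !addr0 add0r.
Qed.

Lemma tau_aff A T : tau (aff A T) = aff (- (Lq qj *m A *m Lq qj)) (- (Lq qj *m T)).
Proof.
by rewrite /tau /aff block_mxKul block_mxKur block_mxKdl block_mxKdr.
Qed.

Lemma tau_rotq c s T : tau (aff (rotq c s) T) = aff (rotq c (- s)) (- qmul qj T).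
Proof.
rewrite tau_aff LqE; congr aff; apply: cV4_mx_eq => u.
rewrite mulNmx -!mulmxA !LqE !rotqE qjE.
by apply: cV4_eq; rewrite !(qmulE, qlinE, qvE); ring.
Qed.

Lemma G0_1 : G0 (1%:M : 'M[K]_4).
Proof.
exists (qv 1 0 0 0).
  by rewrite /= sum4 !qvE; ring.
by rewrite !qvE !scale0r !subr0 scale1r.
Qed.

Lemma aff1 : aff 1%:M 0 = 1%:M :> 'M[K]_(4 + 1).
Proof. by rewrite /aff -scalar_mx_block. Qed.

Lemma rotq10 : rotq 1 0 = 1%:M.
Proof. by rewrite /rotq scale1r scale0r addr0. Qed.

Lemma rotqM c s c' s' :
  rotq c s *m rotq c' s' = rotq (c * c' - s * s') (s * c' + c * s').
Proof.
apply: cV4_mx_eq => u; rewrite -mulmxA !rotqE.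
by apply: cV4_eq; rewrite !(qmulE, qvE); ring.
Qed.

Lemma rotq_entry c s l m : rotq c s l m = c * (1%:M : 'M[K]_4) l m + s * Lq qi l m.
Proof. by rewrite /rotq !mxE. Qed.

(** Tangent vectors to the affine maps with linear part [rotq x y]. *)
Definition bE (c : K) (x y : K) T : 'M[K]_(4 + 1) := block_mx (c *: rotq x y) T 0 0.

(** An entry of such a block matrix depends linearly on the rotation, or is a
    coordinate of the translation, or is constant; entrywise properties are proved
    in these three cases. *)
Lemma bE_entry (s t : 'I_(4 + 1)) :
  [\/ exists a b : K, (forall x y T, aff (rotq x y) T s t = x * a + y * b) /\
        (forall c x y T, bE c x y T s t = c * (x * a + y * b)),
      exists i, (forall x y T, aff (rotq x y) T s t = T i 0) /\
        (forall c x y T, bE c x y T s t = T i 0) |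
      exists e : K, (forall x y T, aff (rotq x y) T s t = e) /\
        (forall c x y T, bE c x y T s t = 0)].
Proof.
rewrite /aff /bE /block_mx.
case: (splitP s) => l' ll; case: (splitP t) => m' mm.
- have -> : s = lshift 1 l' by exact: val_inj.
  have -> : t = lshift 1 m' by exact: val_inj.
  constructor 1; exists ((1%:M : 'M[K]_4) l' m'), (Lq qi l' m'); split.
    by move=> x y T; rewrite col_mxEu row_mxEl rotq_entry.
  by move=> c x y T; rewrite col_mxEu row_mxEl mxE rotq_entry.
- have -> : s = lshift 1 l' by exact: val_inj.
  have -> : t = rshift 4 m' by exact: val_inj.
  constructor 2; exists l'; split.
    by move=> x y T; rewrite col_mxEu row_mxEr ord1.
  by move=> c x y T; rewrite col_mxEu row_mxEr ord1.
- have -> : s = rshift 4 l' by exact: val_inj.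
  have -> : t = lshift 1 m' by exact: val_inj.
  constructor 3; exists 0; split; first by move=> x y T; rewrite col_mxEd row_mxEl mxE.
  by move=> c x y T; rewrite col_mxEd row_mxEl mxE.
- have -> : s = rshift 4 l' by exact: val_inj.
  have -> : t = rshift 4 m' by exact: val_inj.
  constructor 3; exists ((1%:M : 'M[K]_1) l' m'); split.
    by move=> x y T; rewrite col_mxEd row_mxEr.
  by move=> c x y T; rewrite col_mxEd row_mxEr mxE.
Qed.

End QuaternionAlgebra.

Section AffineGroup.
Variable R : realType.
Local Notation C := R[i].
Implicit Types (x y : C) (T S : 'cV[C]_4).

Definition am x T : 'M[C]_(4 + 1) := aff (rotq (ccos x) (csin x)) T.
Definition ei x : 'cV[C]_4 := qv (ccos x) (csin x) 0 0.

Lemma am_mul x y T S : am x T *m am y S = am (x + y) (qmul (ei x) S + T).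
Proof. by rewrite /am aff_mul rotqM rotqE ccosD csinD. Qed.

Lemma tau_am x T : tau (am x T) = am (- x) (- qmul qj T).
Proof. by rewrite /am tau_rotq ccosN csinN. Qed.

Lemma GaffC_am x T : GaffC (am x T).
Proof.
exists (rotq (ccos x) (csin x)); last by exists T.
exists 1%:M; first exact: G0_1.
by exists (rotq (ccos x) (csin x)); rewrite ?mul1mx//; exists x.
Qed.

Lemma am0 : am 0 0 = 1%:M.
Proof. by rewrite /am ccos0 csin0 rotq10 aff1. Qed.

Lemma ei0 u : qmul (ei 0) u = u.
Proof. by rewrite /ei ccos0 csin0 qmul1l. Qed.

Lemma eiD x y u : qmul (ei (x + y)) u = qmul (ei x) (qmul (ei y) u).
Proof.
rewrite [RHS]qmulA /ei qv_mul ccosD csinD; congr qmul.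
by apply: qv_eq; ring.
Qed.

Definition amR (x : R) (T : 'cV[R]_4) : 'M[R]_(4 + 1) := aff (rotq (cos x) (sin x)) T.

Lemma Gaff_amR (t : R) (Z : 'cV[R]_4) : Gaff (amR t Z).
Proof.
exists (rotq (cos t) (sin t)); last by exists Z.
exists 1%:M; first exact: G0_1.
by exists (rotq (cos t) (sin t)); rewrite ?mul1mx//; exists t.
Qed.

Lemma tau_amR (t : R) (Z : 'cV[R]_4) : tau (amR t Z) = amR (- t) (- qmul qj Z).
Proof. by rewrite /amR tau_rotq cosN sinN. Qed.

Lemma Lqi_toC (l m : 'I_4) : toC (Lq qi l m) = Lq qi l m :> C.
Proof.
rewrite !mxE.
case: l => [[|[|[|[|//]]]] ?]; case: m => [[|[|[|[|//]]]] ?] /=;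
  rewrite ?mxE /= ?(mulr0, mul0r, mulr1, mul1r, subr0, addr0, add0r, sub0r, oppr0)
    ?toCN //.
Qed.

Lemma map_amR (t : R) (Z : 'cV[R]_4) :
  map_mx toC (amR t Z) = am (toC t) (map_mx toC Z).
Proof.
rewrite /amR /am /aff map_block_mx; congr block_mx.
- apply/matrixP => l m; rewrite mxE !rotq_entry ccos_toC csin_toC.
  by rewrite toCD !toCM Lqi_toC !mxE; case: (l == m).
- by apply/matrixP => l m; rewrite !mxE.
- by apply/matrixP => l m; rewrite !mxE; case: (l == m).
Qed.

End AffineGroup.

(** * One mode of the extended frame *)

Section Modes.
Variable R : realType.
Local Notation C := R[i].
Local Notation Re := (@complex.Re R).
Local Notation Im := (@complex.Im R).
Local Notation ii := ('i%C : C).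
Implicit Types (x y z l : C).

(** Loops in the real group are given by complex formulas in [lambda] that are real
    on the circle. *)
Definition creal x : Prop := x^*%C = x.

Lemma crealD x y : creal x -> creal y -> creal (x + y).
Proof. by rewrite /creal conjcD => -> ->. Qed.
Lemma crealM x y : creal x -> creal y -> creal (x * y).
Proof. by rewrite /creal conjcM => -> ->. Qed.
Lemma crealN x : creal x -> creal (- x).
Proof. by rewrite /creal conjcN => ->. Qed.
Lemma crealV x : creal x -> creal x^-1.
Proof. by rewrite /creal conjcV => ->. Qed.
Lemma creal_toC (t : R) : creal (toC t).
Proof. exact: conjc_toC. Qed.
Lemma creal0 : creal 0.
Proof. exact: (creal_toC 0). Qed.
Lemma creal1 : creal 1.
Proof. exact: (creal_toC 1). Qed.

Lemma creal_toCRe x : creal x -> toC (Re x) = x.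
Proof.
case: x => a b; rewrite /creal /= => -[] E; apply: eq_ReIm => //=.
by lra.
Qed.
Lemma creal_ccos x : creal x -> creal (ccos x).
Proof. by rewrite /creal ccos_conj => ->. Qed.
Lemma creal_csin x : creal x -> creal (csin x).
Proof. by rewrite /creal csin_conj => ->. Qed.
Lemma creal_sinc x : creal x -> creal (sinc x).
Proof. by rewrite /creal sinc_conj => ->. Qed.
Lemma creal_cosc x : creal x -> creal (cosc x).
Proof. by rewrite /creal cosc_conj => ->. Qed.
Lemma creal_prod (I : Type) (s : seq I) (Q : pred I) (F : I -> C) :
  (forall i, creal (F i)) -> creal (\prod_(i <- s | Q i) F i).
Proof. by move=> H; apply: big_ind => //; [exact: creal1|exact: crealM]. Qed.
Lemma creal_sum (I : Type) (s : seq I) (Q : pred I) (F : I -> C) :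
  (forall i, creal (F i)) -> creal (\sum_(i <- s | Q i) F i).
Proof. by move=> H; apply: big_ind => //; [exact: creal0|exact: crealD]. Qed.

Lemma unit_conj x : `|x| = 1 -> x^*%C = x^-1.
Proof.
move=> x1; have x0 : x != 0 by rewrite -normr_gt0 x1.
apply: (mulfI x0); rewrite mulfV//.
by rewrite -sqr_normc x1 expr1n.
Qed.

Lemma unit_neq0 x : `|x| = 1 -> x != 0.
Proof. by move=> x1; rewrite -normr_gt0 x1. Qed.

Variables (r : R) (p n : C).
Hypotheses (r0 : 0 < r) (p1 : `|p| = 1) (n1 : `|n| = 1).
Local Notation rc := (toC r).

Let rc0 : rc != 0. Proof. by apply/eqP => -[E]; move: r0; rewrite E ltxx. Qed.
Let p0 : p != 0. Proof. exact: unit_neq0. Qed.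
Let n0 : n != 0. Proof. exact: unit_neq0. Qed.
Let ii0 : ii != 0. Proof. exact: ii_neq0. Qed.

(** Half the Lagrangian angle, as a function of [lambda]: at [l = 1] it is
    [r] times the scalar product of [z] and [p]. *)
Definition fphi z l : C := rc / 2 * (z * p^-1 * l^-1 ^+ 2 + z^*%C * p * l ^+ 2).
(** The phase of the plane wave with frequency [r n]; it does not depend on
    [lambda]. *)
Definition fth z : C := rc / 2 * (z * n^-1 + z^*%C * n).
(** On the circle, [e^{i t}] where [t] is the angle from [n] to [l^2 p]; its sine and cosine
    are [fs] and [fc]. *)
Definition fE l : C := l ^+ 2 * p * n^-1.
Definition fEi l : C := l^-1 ^+ 2 * p^-1 * n.
Definition fs l : C := (fE l - fEi l) / (2 * ii).
Definition fc l : C := (fE l + fEi l) / 2.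
(** For [e = 1] and [e = -1] this is [(1 + e fc) (fphi - e fth) / (2 fs)], written
    as a Laurent polynomial in [l]; see [fsY]. *)
Definition fY (e : C) z l : C := rc / (4 * ii) *
  ((z * n^-1 - z^*%C * n) + e * (z * p^-1 * l^-1 ^+ 2 - z^*%C * p * l ^+ 2)).
Definition fcx l : C := (n * l^-1 + n^-1 * l) / 2.
Definition fsx l : C := (n * l^-1 - n^-1 * l) / (2 * ii).
(** On the circle this is a quaternion of length [1 / r] in the plane of [i] and
    [k].  The twisting [l -> i l] multiplies it by [j], as it must do with the
    translation part of a twisted loop. *)
Definition fa l : 'cV[C]_4 := qv 0 (fsx l / rc) 0 (- (fcx l / rc)).

(** [fs * hL = e^{i phi} (cos th + K sin th) - 1] with [K = fs k - fc i], so
    [hL fa P] is the translation part of the frame in the case of one mode.  The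
    division by [fs], which vanishes at points of the circle, is carried out by
    [fY], [sinc] and [cosc]. *)
Definition hL z l : 'cV[C]_4 :=
  let y1 := fY 1 z l in let y2 := fY (-1) z l in
  let x1 := fphi z l - fth z in let x2 := fphi z l + fth z in
  qv (- (y1 * cosc x1 + y2 * cosc x2)) (y1 * sinc x1 + y2 * sinc x2)
     (- (csin (fphi z l) * csin (fth z))) (ccos (fphi z l) * csin (fth z)).

(** [fs * mL = e^{i w c} - 1] if [c = fs * ch]. *)
Definition mL (w ch c : C) : 'cV[C]_4 :=
  qv (- (w * ch * cosc (w * c))) (w * ch * sinc (w * c)) 0 0.

Lemma iiV : ii^-1 = - ii.
Proof. by apply: (mulfI ii0); rewrite mulfV// mulrN iiM opprK. Qed.

Lemma fphi_twist z l : fphi z (ii * l) = - fphi z l.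
Proof. by rewrite /fphi [(ii * l)^-1]invfM iiV !exprMn sqrrN sqr_i; ring. Qed.

Lemma fs_twist l : fs (ii * l) = - fs l.
Proof. by rewrite /fs /fE /fEi [(ii * l)^-1]invfM iiV !exprMn sqrrN sqr_i; ring. Qed.

Lemma fY_twist e z l : fY e z (ii * l) = fY (- e) z l.
Proof. by rewrite /fY [(ii * l)^-1]invfM iiV !exprMn sqrrN sqr_i; ring. Qed.

Lemma fa_twist l : fa (ii * l) = qmul qj (fa l).
Proof.
rewrite /fa qj_mul /fcx /fsx [(ii * l)^-1]invfM iiV.
have E : (2 * ii)^-1 = - ii / 2 by rewrite invfM iiV mulrC.
have iM := iiM R.
apply: qv_eq; rewrite ?E.
- by ring.
- transitivity (- (ii * ii) * ((- n * l^-1 - n^-1 * l) / 2 / rc)); last by rewrite iM; ring.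
  by ring.
- by ring.
- by ring.
Qed.

Lemma hL_twist z l : qmul (hL z (ii * l)) qj = - qmul qj (hL z l).
Proof.
rewrite /hL /= -qj_anti fphi_twist !fY_twist opprK.
have -> : - fphi z l - fth z = - (fphi z l + fth z) by ring.
have -> : - fphi z l + fth z = - (fphi z l - fth z) by ring.
rewrite !coscN !sincN csinN ccosN; congr qmul.
by apply: qv_eq; ring.
Qed.

Lemma mL_twist w ch c : qmul (mL w ch (- c)) qj = - qmul qj (mL w ch c).
Proof.
rewrite /mL -qj_anti mulrN coscN sincN; congr qmul.
by apply: qv_eq; ring.
Qed.

Lemma hQ_twist z l : qmul (hL z (ii * l)) (fa (ii * l)) = - qmul qj (qmul (hL z l) (fa l)).
Proof. by rewrite fa_twist qmulA hL_twist qmulNl -qmulA. Qed.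

Lemma mQ_twist w ch c l : qmul (mL w ch (- c)) (fa (ii * l)) =
  - qmul qj (qmul (mL w ch c) (fa l)).
Proof. by rewrite fa_twist qmulA mL_twist qmulNl -qmulA. Qed.

Section Reality.
Variable l : C.
Hypothesis l1 : `|l| = 1.
Let lJ : l^*%C = l^-1. Proof. exact: unit_conj. Qed.
Let pJ : p^*%C = p^-1. Proof. exact: unit_conj. Qed.
Let nJ : n^*%C = n^-1. Proof. exact: unit_conj. Qed.
Let rJ : rc^*%C = rc. Proof. exact: conjc_toC. Qed.
Let zJ z : (z^*%C)^*%C = z. Proof. exact: conjcK. Qed.
Let conjc_4 : (4 : C)^*%C = 4. Proof. exact: rmorph_nat. Qed.
Let conjE := (conjc_2, conjc_4, conjcX, conjcV, conjc_ii, zJ, lJ, pJ, nJ, rJ,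
  conjcN, conjcM, conjcD).

Let iiN (k : C) : (k * - ii)^-1 = - (k * ii)^-1. Proof. by rewrite mulrN invrN. Qed.

Lemma creal_fphi z : creal (fphi z l).
Proof. by rewrite /creal /fphi !conjE !invrK; ring. Qed.
Lemma creal_fth z : creal (fth z).
Proof. by rewrite /creal /fth !conjE !invrK; ring. Qed.
Lemma creal_fs : creal (fs l).
Proof. by rewrite /creal /fs /fE /fEi !conjE !invrK iiN; ring. Qed.
Lemma creal_fY (e : C) z : creal e -> creal (fY e z l).
Proof.
move=> er; rewrite /creal /fY !conjE !invrK er.
by rewrite iiN; ring.
Qed.
Lemma creal_fcx : creal (fcx l).
Proof. by rewrite /creal /fcx !conjE !invrK; ring. Qed.
Lemma creal_fsx : creal (fsx l).
Proof. by rewrite /creal /fsx !conjE !invrK iiN; ring. Qed.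

Definition crealv (u : 'cV[C]_4) : Prop := forall i, creal (u i 0).

Lemma crealv_qv a b c d : creal a -> creal b -> creal c -> creal d -> crealv (qv a b c d).
Proof.
move=> ha hb hc hd i; rewrite mxE; case: i => [[|[|[|[|//]]]] ?] //=.
Qed.

Lemma crealv_qmul u v : crealv u -> crealv v -> crealv (qmul u v).
Proof.
move=> hu hv; rewrite [qmul u v]qv_eta; apply: crealv_qv; rewrite qmulE;
by repeat first [exact: hu | exact: hv | apply: crealM | apply: crealN | apply: crealD].
Qed.

Lemma crealv_fa : crealv (fa l).
Proof.
apply: crealv_qv; try exact: creal0.
  by apply: crealM; [exact: creal_fsx|apply/crealV/creal_toC].
by apply: crealN; apply: crealM; [exact: creal_fcx|apply/crealV/creal_toC].
Qed.

Lemma crealv_hL z : crealv (hL z l).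
Proof.
have h1 := creal_fY z creal1; have h2 := creal_fY z (crealN creal1).
have h3 := creal_fphi z; have h4 := creal_fth z.
have h5 : creal (fphi z l - fth z) by apply: crealD => //; exact: crealN.
have h6 : creal (fphi z l + fth z) by exact: crealD.
apply: crealv_qv.
- apply: crealN; apply: crealD; apply: crealM => //; exact: creal_cosc.
- apply: crealD; apply: crealM => //; exact: creal_sinc.
- apply: crealN; apply: crealM; exact: creal_csin.
- by apply: crealM; [exact: creal_ccos|exact: creal_csin].
Qed.

End Reality.

(** [2 i E fa]: since [1 / fs = 2 i E / (E^2 - 1)], this is the numerator of
    [fa / fs], and it is a polynomial in [l]. *)
Definition fA l : 'cV[C]_4 :=
  qv 0 (p / rc * (l - n^-1 ^+ 2 * l ^+ 3)) 0
     (- (ii * p / rc * (l + n^-1 ^+ 2 * l ^+ 3))).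
(** [i Re(n p) + k Im(n p)], an imaginary unit. *)
Definition fJ : 'cV[C]_4 :=
  qv 0 ((n * p + (n * p)^-1) / 2) 0 ((n * p - (n * p)^-1) / (2 * ii)).
(** [((e^{i h} - cos th) fa - sin th fa J) / fs], regular in the open unit disk
    because [E^2 = 1] only on the circle. *)
Definition bQ z (h : C) l : 'cV[C]_4 := (fE l ^+ 2 - 1)^-1 *:
  (qmul (qv (ccos h - ccos (fth z)) (csin h) 0 0) (fA l)
   - csin (fth z) *: qmul (fA l) fJ).

Lemma fEiE l : l != 0 -> fEi l = (fE l)^-1.
Proof. by move=> l0; rewrite /fEi /fE; field; rewrite n0 p0 l0. Qed.

Lemma fE_neq0 l : l != 0 -> fE l != 0.
Proof. by move=> l0; rewrite /fE !mulf_neq0 ?expf_neq0 ?invr_eq0. Qed.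

Lemma fsY (e : C) z l : l != 0 -> e ^+ 2 = 1 ->
  fs l * fY e z l = (1 + e * fc l) / 2 * (fphi z l - e * fth z).
Proof.
move=> l0 e2.
have E (X Y : C) : X / (2 * ii) * (Y / (4 * ii)) = - (X * Y / 8).
  have -> : X / (2 * ii) * (Y / (4 * ii)) = X * Y / (8 * (ii * ii)).
    by field; rewrite ii0.
  by rewrite iiM mulrN1 invrN mulrN.
rewrite /fs /fY [rc / _ * _]mulrAC E /fc /fphi /fth fEiE// /fE.
have e3 : e * e = 1 by rewrite -expr2.
apply/eqP; rewrite -subr_eq0; apply/eqP.
set X := (X in X = 0).
(* The two sides agree modulo e^2 = 1. *)
transitivity ((e * e - 1) * (rc / 8 * (l ^+ 2 * p * n^-1 + (l ^+ 2 * p * n^-1)^-1)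
   * (z * n^-1 + z^*%C * n))); last by rewrite e3 subrr mul0r.
rewrite /X; field; rewrite l0 p0 n0//.
Qed.

(** The translation part of [H^-1 M] for one mode.  The constants [- 1] in [fs * mL]
    and [fs * hL] cancel, which leaves [e^{i (w c - phi)} - cos th - K sin th], and
    [K fa = fa J]. *)
Lemma bQ_eq z w ch c l : l != 0 -> fE l ^+ 2 != 1 -> c = fs l * ch ->
  qmul (ei (- fphi z l)) (qmul (mL w ch c) (fa l) - qmul (hL z l) (fa l)) =
  bQ z (w * c - fphi z l) l.
Proof.
move=> l0 E1 cE.
have E0 := fE_neq0 l0.
have s0 : fs l != 0.
  rewrite /fs mulf_neq0 ?invr_eq0 ?mulf_neq0 ?two_neq0//.
  rewrite fEiE// subr_eq0; apply: contra E1 => /eqP E.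
  by rewrite expr2 {2}E mulfV.
have S1 : fs l *: mL w ch c = qv (ccos (w * c) - 1) (csin (w * c)) 0 0.
  have cc := coscE (w * c); have cs := sincE (w * c).
  rewrite /mL qv_scale !mulr0; apply: qv_eq => //.
    by rewrite -opprB -cc {2}cE; ring.
  by rewrite -cs {2}cE; ring.
have Y1 : fs l * fY 1 z l = (1 + fc l) / 2 * (fphi z l - fth z).
  by rewrite (fsY z l0 (expr1n _ 2)) !mul1r.
have Y2 : fs l * fY (-1) z l = (1 - fc l) / 2 * (fphi z l + fth z).
  by rewrite (fsY z l0 (e := -1)) ?sqrrN ?expr1n// !mulN1r opprK.
pose cw := fc l; pose f := fphi z l; pose t := fth z.
have S2 : fs l *: hL z l = qv
    ((1 + cw) / 2 * (ccos (f - t) - 1) + (1 - cw) / 2 * (ccos (f + t) - 1))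
    ((1 + cw) / 2 * csin (f - t) + (1 - cw) / 2 * csin (f + t))
    (- (fs l * csin f * csin t)) (fs l * ccos f * csin t).
  have c1 := coscE (f - t); have c2 := coscE (f + t).
  have s1 := sincE (f - t); have s2 := sincE (f + t).
  rewrite /hL /= qv_scale; apply: qv_eq; rewrite -/f -/t.
  - rewrite -(opprB 1 (ccos (f - t))) -(opprB 1 (ccos (f + t))) -c1 -c2 /cw.
    transitivity (- ((fs l * fY 1 z l) * cosc (f - t) + (fs l * fY (-1) z l) * cosc (f + t))).
      by ring.
    by rewrite Y1 Y2 -/f -/t; ring.
  - rewrite -s1 -s2 /cw.
    transitivity ((fs l * fY 1 z l) * sinc (f - t) + (fs l * fY (-1) z l) * sinc (f + t)).
      by ring.
    by rewrite Y1 Y2 -/f -/t; ring.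
  - by ring.
  - by ring.
have CS : csin f * csin f = 1 - ccos f * ccos f.
  by rewrite -(ccos2Dsin2 f) !expr2; ring.
have S3 : qmul (ei (- f)) (fs l *: mL w ch c - fs l *: hL z l) =
   qv (ccos (w * c - f) - ccos t) (csin (w * c - f) + cw * csin t) 0 (- (fs l * csin t)).
  rewrite S1 S2 /ei !ccosD !csinD !ccosN !csinN.
  rewrite qv_opp qv_add qv_mul; apply: qv_eq.
  - apply/eqP; rewrite -subr_eq0; apply/eqP.
    set X := (X in X = 0).
    transitivity ((csin f * csin f - (1 - ccos f * ccos f)) * - ccos t);
      last by rewrite CS subrr mul0r.
    by rewrite /X; field.
  - apply/eqP; rewrite -subr_eq0; apply/eqP.
    set X := (X in X = 0).
    transitivity ((csin f * csin f - (1 - ccos f * ccos f)) * (cw * csin t));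
      last by rewrite CS subrr mul0r.
    by rewrite /X; field.
  - by ring.
  - apply/eqP; rewrite -subr_eq0; apply/eqP.
    set X := (X in X = 0).
    transitivity ((csin f * csin f - (1 - ccos f * ccos f)) * - (fs l * csin t));
      last by rewrite CS subrr mul0r.
    by rewrite /X; field.
have S4 : qmul (ei (- f)) (qmul (mL w ch c) (fa l) - qmul (hL z l) (fa l)) =
   (fs l)^-1 *: qmul (qv (ccos (w * c - f) - ccos t) (csin (w * c - f) + cw * csin t)
     0 (- (fs l * csin t))) (fa l).
  rewrite -S3 -scalerBr qmulZr qmulZl scalerA mulVf// scale1r -qmulA.
  by rewrite qmulDl qmulNl.
rewrite S4 /bQ -/f -/t.
have -> : (fs l)^-1 = (fE l ^+ 2 - 1)^-1 * (2 * ii * fE l).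
  rewrite /fs fEiE//; field.
  by rewrite ii0 E0 subr_eq0 E1.
rewrite -scalerA; congr (_ *: _).
rewrite -qmulZr.
have FA : (2 * ii * fE l) *: fa l = fA l.
  rewrite /fa /fA /fsx /fcx /fE qv_scale !mulr0; apply: qv_eq => //.
    by field; rewrite ii0 rc0 l0 n0.
  by field; rewrite rc0 l0 n0.
rewrite FA.
have -> : qv (ccos (w * c - f) - ccos t) (csin (w * c - f) + cw * csin t)
     0 (- (fs l * csin t)) = qv (ccos (w * c - f) - ccos t) (csin (w * c - f)) 0 0
     - csin t *: qv 0 (- cw) 0 (fs l).
  by rewrite qv_scale qv_opp qv_add; apply: qv_eq; ring.
rewrite qmulDl qmulNl qmulZl; congr (_ - _ *: _).
rewrite /cw /fc /fs (fEiE l0) /fA /fJ /fE.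
have iV : (2 * ii)^-1 = - ii / 2 by rewrite invfM iiV mulrC.
have i2 : ii ^+ 2 = - 1 by rewrite expr2 iiM.
rewrite !qv_mul !(mul0r, mulr0, subr0, addr0, sub0r, add0r).
apply: qv_eq; rewrite ?oppr0//.
- by rewrite iV; field: i2; rewrite ?rc0 ?l0 ?n0 ?p0.
- by rewrite iV; field: i2; rewrite ?rc0 ?l0 ?n0 ?p0.
Qed.

End Modes.

(** * Frame, potential and factorization *)

Section Assembly.
Variable R : realType.
Local Notation C := R[i].
Local Notation Re := (@complex.Re R).
Local Notation Im := (@complex.Im R).
Local Notation normc := (@Normc.normc R).
Local Notation ii := ('i%C : C).
Implicit Types (x y z l : C).

Lemma toC_Re_map (T : 'cV[C]_4) : crealv T -> map_mx toC (map_mx Re T) = T.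
Proof. by move=> H; apply/matrixP => i j; rewrite !mxE ord1 creal_toCRe. Qed.

Lemma map_Re_jmul (T : 'cV[C]_4) :
  map_mx Re (- qmul qj T) = - qmul qj (map_mx Re T).
Proof.
rewrite !qjE; apply: cV4_eq; rewrite !(mxE, qmulE, qlinE, qvE) /=;
  by rewrite !(ReN, ReD, Re_mul, mul0r, mul1r, oppr0, ImN, ImD) /=; ring.
Qed.

Definition entv b (T : C -> 'cV[C]_4) : Prop := forall i, ent b (fun l => T l i 0).

Lemma entv_qv b (f0 f1 f2 f3 : C -> C) : ent b f0 -> ent b f1 -> ent b f2 -> ent b f3 ->
  entv b (fun l => qv (f0 l) (f1 l) (f2 l) (f3 l)).
Proof.
move=> h0 h1 h2 h3 i; case: i => [[|[|[|[|//]]]] hi];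
  [apply: ent_eq h0 _|apply: ent_eq h1 _|apply: ent_eq h2 _|apply: ent_eq h3 _] => z;
  by rewrite mxE.
Qed.

Lemma entv_cst b u : entv b (fun=> u).
Proof. by move=> i; exact: ent_cst. Qed.

Lemma entv_qmul b S T : entv b S -> entv b T -> entv b (fun l => qmul (S l) (T l)).
Proof.
move=> hS hT i.
have H : entv b (fun l => qv (qmul (S l) (T l) 0 0) (qmul (S l) (T l) 1 0)
   (qmul (S l) (T l) 2 0) (qmul (S l) (T l) 3 0)).
  apply: entv_qv.
  - by apply: ent_eq (ent_sub (ent_sub (ent_sub (ent_mul (hS 0) (hT 0))
      (ent_mul (hS 1) (hT 1))) (ent_mul (hS 2) (hT 2))) (ent_mul (hS 3) (hT 3))) _ => z;
      rewrite qmulE.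
  - by apply: ent_eq (ent_sub (ent_add (ent_add (ent_mul (hS 0) (hT 1))
      (ent_mul (hS 1) (hT 0))) (ent_mul (hS 2) (hT 3))) (ent_mul (hS 3) (hT 2))) _ => z;
      rewrite qmulE.
  - by apply: ent_eq (ent_add (ent_add (ent_sub (ent_mul (hS 0) (hT 2))
      (ent_mul (hS 1) (hT 3))) (ent_mul (hS 2) (hT 0))) (ent_mul (hS 3) (hT 1))) _ => z;
      rewrite qmulE.
  - by apply: ent_eq (ent_add (ent_sub (ent_add (ent_mul (hS 0) (hT 3))
      (ent_mul (hS 1) (hT 2))) (ent_mul (hS 2) (hT 1))) (ent_mul (hS 3) (hT 0))) _ => z;
      rewrite qmulE.
by apply: ent_eq (H i) _ => z; rewrite -qv_eta.
Qed.

Lemma entv_sum b (N : nat) (T : 'I_N -> C -> 'cV[C]_4) :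
  (forall k, entv b (T k)) -> entv b (fun l => \sum_k T k l).
Proof.
move=> h i; apply: ent_eq (ent_sum _ (fun k => h k i)) _ => z.
by rewrite summxE.
Qed.

Lemma entv_sub b S T : entv b S -> entv b T -> entv b (fun l => S l - T l).
Proof.
by move=> hS hT i; apply: ent_eq (ent_sub (hS i) (hT i)) _ => z; rewrite !mxE.
Qed.

Lemma ent_am b (f : C -> C) T : ent b f -> entv b T ->
  forall (l m : 'I_(4 + 1)), ent b (fun lam => am (f lam) (T lam) l m).
Proof.
move=> ef eT l m; rewrite /am.
case: (bE_entry C l m) => [[x [y [E _]]]|[i [E _]]|[e [E _]]].
- by apply: ent_eq (ent_add (ent_mul (ent_ccos ef) (ent_cst b x))
    (ent_mul (ent_csin ef) (ent_cst b y))) _ => z; rewrite E.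
- by apply: ent_eq (eT i) _ => z; rewrite E.
- by apply: ent_eq (ent_cst b e) _ => z; rewrite E.
Qed.

Variables (N : nat) (r : R) (p : C) (n : 'I_N -> C) (P : 'I_N -> 'cV[R]_4).
Hypotheses (r0 : 0 < r) (p1 : `|p| = 1) (n1 : forall k, `|n k| = 1).
Local Notation rc := (toC r).
Local Notation Pc k := (map_mx toC (P k)).

Let rc0 : rc != 0. Proof. by apply/eqP => -[E]; move: r0; rewrite E ltxx. Qed.
Let p0 : p != 0. Proof. exact: unit_neq0. Qed.
Let n0 k : n k != 0. Proof. exact: unit_neq0. Qed.
Let ii0 : ii != 0. Proof. exact: ii_neq0. Qed.

(** The product of the coefficients of [lambda^-4] in the squares of the [fs]. *)
Definition kap : C := \prod_k (- ((p^-1 * n k) ^+ 2 / 4)).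
(** With this leading coefficient [lambda^(4 N + 2) fct] takes the value
    [r / (2 p)] at 0, so that [w c - phi] loses its term in [lambda^-2]. *)
Definition fv : C := rc * p^-1 / kap.
Definition ft l : C := (fv * l^-1 ^+ 2 + fv^*%C * l ^+ 2) / 2.
(** The rotation part of the potential.  It is odd under [l -> i l], real on the
    circle and divisible by every [fs]; the squares make the product even, and
    [ft] restores the parity and carries the leading coefficient. *)
Definition fct l : C := (\prod_k fs p (n k) l ^+ 2) * ft l.
Definition fch k l : C :=
  fs p (n k) l * (\prod_(j | j != k) fs p (n j) l ^+ 2) * ft l.

Lemma fct_fch k l : fct l = fs p (n k) l * fch k l.
Proof. by rewrite /fct (bigD1 k)//= /fch; ring. Qed.

Definition HT z l : 'cV[C]_4 :=
  \sum_k qmul (qmul (hL r p (n k) z l) (fa r (n k) l)) (Pc k).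
Definition MT z l : 'cV[C]_4 :=
  \sum_k qmul (qmul (mL (z * l ^+ (4 * N)) (fch k l) (fct l)) (fa r (n k) l)) (Pc k).
(** The conjugate of [fct L_i] by the translation of [- fa P_k / fs] has translation
    part [fct / fs] times [i fa P_k]. *)
Definition etaT l : 'cV[C]_4 :=
  \sum_k fch k l *: qmul (qmul qi (fa r (n k) l)) (Pc k).

Definition Hm z l : 'M[R]_(4 + 1) := amR (Re (fphi r p z l)) (map_mx Re (HT z l)).
Definition Mm z l : 'M[C]_(4 + 1) := am (z * l ^+ (4 * N) * fct l) (MT z l).
(** [H^-1 M], and its limit at 0. *)
Definition Bm z l : 'M[C]_(4 + 1) :=
  if l == 0 then 1%:M else
  am (z * l ^+ (4 * N) * fct l - fphi r p z l)
     (qmul (ei (- fphi r p z l)) (MT z l - HT z l)).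
Definition etam l : 'M[R]_(4 + 1) :=
  block_mx (Re (fct l) *: Lq qi) (map_mx Re (etaT l)) 0 0.

Lemma ft_twist l : ft (ii * l) = - ft l.
Proof. by rewrite /ft [(ii * l)^-1]invfM iiV !exprMn sqrrN sqr_i; ring. Qed.

Lemma fct_twist l : fct (ii * l) = - fct l.
Proof.
rewrite /fct ft_twist mulrN; congr (- (_ * _)).
by apply: eq_bigr => k _; rewrite fs_twist sqrrN.
Qed.

Lemma fch_twist k l : fch k (ii * l) = fch k l.
Proof.
rewrite /fch ft_twist fs_twist mulrN mulNr mulNr opprK; congr (_ * _ * _).
by apply: eq_bigr => j _; rewrite fs_twist sqrrN.
Qed.

Lemma exp4N_twist l : (ii * l) ^+ (4 * N) = l ^+ (4 * N).
Proof.
rewrite exprMn exprM (_ : ii ^+ 4 = 1) ?expr1n ?mul1r//.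
by rewrite (exprM _ 2 2) sqr_i sqrrN expr1n.
Qed.

Lemma HT_twist z l : HT z (ii * l) = - qmul qj (HT z l).
Proof.
rewrite /HT qmul_sumr -sumrN; apply: eq_bigr => k _.
by rewrite hQ_twist qmulNl -qmulA.
Qed.

Lemma MT_twist z l : MT z (ii * l) = - qmul qj (MT z l).
Proof.
rewrite /MT qmul_sumr -sumrN; apply: eq_bigr => k _.
by rewrite fch_twist fct_twist exp4N_twist mQ_twist qmulNl -qmulA.
Qed.

Lemma etaT_twist l : etaT (ii * l) = - qmul qj (etaT l).
Proof.
rewrite /etaT qmul_sumr -sumrN; apply: eq_bigr => k _.
rewrite fch_twist fa_twist qmulZr -scalerN; congr (_ *: _).
exact: qij_anti.
Qed.

Lemma crealv_sum (F : 'I_N -> 'cV[C]_4) : (forall k, crealv (F k)) -> crealv (\sum_k F k).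
Proof. by move=> H i; rewrite summxE; apply: creal_sum => k; exact: H. Qed.

Lemma crealv_Pc k : crealv (Pc k).
Proof. by move=> i; rewrite mxE; exact: creal_toC. Qed.

Lemma crealv_HT z l : `|l| = 1 -> crealv (HT z l).
Proof.
move=> l1; apply: crealv_sum => k; apply: crealv_qmul; last exact: crealv_Pc.
by apply: crealv_qmul; [exact: crealv_hL|exact: crealv_fa].
Qed.

Lemma creal_ft l : `|l| = 1 -> creal (ft l).
Proof.
move=> l1; have lJ := unit_conj l1.
rewrite /creal /ft !(conjc_2, conjcX, conjcV, lJ, invrK, conjcK, conjcM, conjcD).
by rewrite addrC.
Qed.

Lemma creal_exp x k : creal x -> creal (x ^+ k).
Proof. by rewrite /creal conjcX => ->. Qed.

Lemma creal_fct l : `|l| = 1 -> creal (fct l).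
Proof.
move=> l1; apply: crealM; last exact: creal_ft.
by apply: creal_prod => k; apply: creal_exp; exact: creal_fs.
Qed.

Lemma creal_fch k l : `|l| = 1 -> creal (fch k l).
Proof.
move=> l1; apply: crealM; last exact: creal_ft.
apply: crealM; first exact: creal_fs.
by apply: creal_prod => j; apply: creal_exp; exact: creal_fs.
Qed.

Lemma crealv_etaT l : `|l| = 1 -> crealv (etaT l).
Proof.
move=> l1; apply: crealv_sum => k i; rewrite mxE; apply: crealM; first exact: creal_fch.
apply: crealv_qmul; last exact: crealv_Pc.
apply: crealv_qmul; last exact: crealv_fa.
by rewrite qiE; apply: crealv_qv; try exact: creal0; exact: creal1.
Qed.

Lemma ent_fphi z : ent true (fphi r p z).
Proof.
apply: ent_mul (ent_cst _ _) _; apply: ent_add.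
  by apply: ent_mul (ent_cst _ _) _; apply: ent_exp; exact: ent_inv.
by apply: ent_mul (ent_cst _ _) _; apply: ent_exp; exact: ent_id.
Qed.

Lemma ent_fs k : ent true (fs p (n k)).
Proof.
apply: ent_mul (ent_cst _ _); apply: ent_sub.
  apply: ent_mul (ent_cst _ _); apply: ent_mul (ent_cst _ _); apply: ent_exp.
  exact: ent_id.
apply: ent_mul (ent_cst _ _); apply: ent_mul (ent_cst _ _); apply: ent_exp.
exact: ent_inv.
Qed.

Lemma ent_ft : ent true ft.
Proof.
apply: ent_mul (ent_cst _ _); apply: ent_add.
  by apply: ent_mul (ent_cst _ _) _; apply: ent_exp; exact: ent_inv.
by apply: ent_mul (ent_cst _ _) _; apply: ent_exp; exact: ent_id.
Qed.

Lemma ent_fct : ent true fct.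
Proof.
apply: ent_mul ent_ft; apply: ent_prod => k; apply: ent_exp; exact: ent_fs.
Qed.

Lemma ent_fch k : ent true (fch k).
Proof.
apply: ent_mul ent_ft; apply: ent_mul; first exact: ent_fs.
by apply: ent_prod => j; apply: ent_exp; exact: ent_fs.
Qed.

Lemma ent_fY (e : C) z k : ent true (fY r p (n k) e z).
Proof.
apply: ent_mul (ent_cst _ _) _; apply: ent_add (ent_cst _ _) _.
apply: ent_mul (ent_cst _ _) _; apply: ent_sub.
  by apply: ent_mul (ent_cst _ _) _; apply: ent_exp; exact: ent_inv.
by apply: ent_mul (ent_cst _ _) _; apply: ent_exp; exact: ent_id.
Qed.

Lemma entv_fa k : entv true (fa r (n k)).
Proof.
have e1 : ent true (fun l => n k * l^-1) by apply: ent_mul; [exact: ent_cst|exact: ent_inv].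
have e2 : ent true (fun l => (n k)^-1 * l) by apply: ent_mul; [exact: ent_cst|exact: ent_id].
apply: entv_qv; try exact: ent_cst.
  apply: ent_mul (ent_cst _ _); apply: ent_mul (ent_cst _ _); exact: ent_sub.
apply: ent_opp; apply: ent_mul (ent_cst _ _); apply: ent_mul (ent_cst _ _).
exact: ent_add.
Qed.

Lemma entv_hL z k : entv true (hL r p (n k) z).
Proof.
have h1 := ent_fY 1 z k; have h2 := ent_fY (-1) z k; have h3 := ent_fphi z.
have h4 : ent true (fun=> fth r (n k) z) by exact: ent_cst.
have h5 := ent_sub h3 h4; have h6 := ent_add h3 h4.
apply: entv_qv.
- by apply: ent_opp; apply: ent_add; apply: ent_mul => //; exact: ent_cosc.
- by apply: ent_add; apply: ent_mul => //; exact: ent_sinc.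
- by apply: ent_opp; apply: ent_mul; exact: ent_csin.
- by apply: ent_mul; [exact: ent_ccos|exact: ent_csin].
Qed.

Lemma entv_HT z : entv true (HT z).
Proof.
apply: entv_sum => k; apply: entv_qmul; last exact: entv_cst.
by apply: entv_qmul; [exact: entv_hL|exact: entv_fa].
Qed.

Lemma ent_pow z : ent true (fun l => z * l ^+ (4 * N)).
Proof. by apply: ent_mul (ent_cst _ _) _; apply: ent_exp; exact: ent_id. Qed.

Lemma entv_MT z : entv true (MT z).
Proof.
apply: entv_sum => k; apply: entv_qmul; last exact: entv_cst.
apply: entv_qmul; last exact: entv_fa.
have h1 := ent_pow z; have h2 := ent_fch k; have h3 := ent_fct.
have h4 := ent_mul h1 h3; have h5 := ent_mul h1 h2.
apply: entv_qv; try exact: ent_cst.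
  by apply: ent_opp; apply: ent_mul => //; exact: ent_cosc.
by apply: ent_mul => //; exact: ent_sinc.
Qed.

Lemma entv_ei f : ent true f -> entv true (fun l => ei (f l)).
Proof.
by move=> ef; apply: entv_qv; try exact: ent_cst; [exact: ent_ccos|exact: ent_csin].
Qed.

Lemma entv_BT z : entv true (fun l => qmul (ei (- fphi r p z l)) (MT z l - HT z l)).
Proof.
apply: entv_qmul; first by apply: entv_ei; exact: ent_opp (ent_fphi z).
by apply: entv_sub; [exact: entv_MT|exact: entv_HT].
Qed.

Lemma Hm_toC z l : `|l| = 1 -> map_mx toC (Hm z l) = am (fphi r p z l) (HT z l).
Proof.
move=> l1; rewrite map_amR toC_Re_map ?creal_toCRe//; first exact: creal_fphi.
exact: crealv_HT.
Qed.

Lemma LambdaG_Hm z : LambdaG (Hm z).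
Proof.
split.
- by move=> l _; exact: Gaff_amR.
- by move=> l _; rewrite /Hm tau_amR fphi_twist ReN HT_twist map_Re_jmul.
- move=> l m.
  have [] := ent_smooth (ent_am (ent_fphi z) (entv_HT z) l m).
  suff -> : (fun t => Hm z (on_circle t) l m) =
    (fun t => Re (am (fphi r p z (on_circle t)) (HT z (on_circle t)) l m)) by [].
  by apply/funext => t; rewrite -Hm_toC ?normr_on_circle// [in RHS]mxE.
Qed.

Lemma LambdaGC_Mm z : LambdaGC (Mm z).
Proof.
split.
- by move=> l _; exact: GaffC_am.
- by move=> l _; rewrite /Mm tau_am MT_twist exp4N_twist fct_twist mulrN.
- move=> l m.
  exact: (ent_smooth (ent_am (ent_mul (ent_pow z) ent_fct) (entv_MT z) l m)).
Qed.

Lemma Bm_neq0 z l : l != 0 -> Bm z l =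
  am (z * l ^+ (4 * N) * fct l - fphi r p z l)
     (qmul (ei (- fphi r p z l)) (MT z l - HT z l)).
Proof. by rewrite /Bm => /negbTE ->. Qed.

Lemma MHB z l : `|l| = 1 -> Mm z l = map_mx toC (Hm z l) *m Bm z l.
Proof.
move=> l1; rewrite Hm_toC// Bm_neq0 ?unit_neq0// am_mul addrC subrK.
by rewrite -eiD subrr ei0 subrK.
Qed.

Lemma ei_j x u : qmul (ei (- x)) (qmul qj u) = qmul qj (qmul (ei x) u).
Proof.
have E : qmul (ei (- x)) qj = qmul qj (ei x).
  by rewrite /ei ccosN csinN qjE !qv_mul; apply: qv_eq; ring.
by rewrite [LHS]qmulA E -qmulA.
Qed.

Lemma LambdaGC_Bm z : LambdaGC (Bm z).
Proof.
split.
- by move=> l l1; rewrite Bm_neq0 ?unit_neq0//; exact: GaffC_am.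
- move=> l l1; have l0 := unit_neq0 l1.
  rewrite !Bm_neq0 ?mulf_neq0// tau_am MT_twist HT_twist exp4N_twist fct_twist.
  rewrite fphi_twist.
  rewrite mulrN -[- _ - - _]opprD.
  have E (u v : 'cV[C]_4) x : qmul (ei (- x)) (- qmul qj u - - qmul qj v) =
      - qmul qj (qmul (ei x) (u - v)).
    by rewrite -opprD qmulNr -[- qmul qj v]qmulNr -qmulDr ei_j.
  by rewrite E.
- move=> l m.
  have := ent_smooth (ent_am (ent_sub (ent_mul (ent_pow z) ent_fct) (ent_fphi z))
    (entv_BT z) l m).
  have -> // : (fun t => Bm z (on_circle t) l m) = (fun t =>
    am (z * on_circle t ^+ (4 * N) * fct (on_circle t) - fphi r p z (on_circle t))
      (qmul (ei (- fphi r p z (on_circle t))) (MT z (on_circle t) - HT z (on_circle t))) l m).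
  by apply/funext => t; rewrite Bm_neq0 ?on_circle_neq0.
Qed.

End Assembly.

(** * Holomorphy in the disk *)

Section Holomorphy.
Variable R : realType.
Local Notation C := R[i].
Local Notation Re := (@complex.Re R).
Local Notation normc := (@Normc.normc R).
Local Notation ii := ('i%C : C).
Implicit Types (x y z l w : C) (f g : C -> C).

Definition holo f w : Prop := exists m, is_derive (w : C^o) 1 (f : C^o -> C^o) m.

Lemma holo_cst (c : C) w : holo (fun=> c) w.
Proof. by exists 0; exact: is_cderive_cst. Qed.

Lemma holoD f g w : holo f w -> holo g w -> holo (fun z => f z + g z) w.
Proof. by move=> [a ha] [b hb]; exists (a + b); exact: is_cderiveD. Qed.

Lemma holoM f g w : holo f w -> holo g w -> holo (fun z => f z * g z) w.
Proof. by move=> [a ha] [b hb]; exists (f w * b + g w * a); exact: is_cderiveM. Qed.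

Lemma holoV f w : holo f w -> f w != 0 -> holo (fun z => (f z)^-1) w.
Proof.
move=> [a ha] fw; exists ((- f w ^- 2) * a).
by apply: is_cderive_comp ha; exact: is_cderive_inv.
Qed.

Lemma holo_eq f g w : holo f w -> (forall z, f z = g z) -> holo g w.
Proof. by move=> ef H; have <- : f = g by apply/funext. Qed.

Lemma holo_sum (I : Type) (s : seq I) (f : I -> C -> C) w :
  (forall i, holo (f i) w) -> holo (fun z => \sum_(i <- s) f i z) w.
Proof.
move=> ef; elim: s => [|i s IH].
  by apply: holo_eq (holo_cst 0 w) _ => z; rewrite big_nil.
by apply: holo_eq (holoD (ef i) IH) _ => z; rewrite big_cons.
Qed.

Lemma holo_ent b f w : ent b f -> (b -> w != 0) -> holo f w.
Proof. by move=> /ent_derive [f' _ H] /H D; exists (f' w). Qed.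

Lemma holo_near f g w (d : R) : 0 < d ->
  (forall h, normc h < d -> f (w + h) = g (w + h)) -> holo f w -> holo g w.
Proof.
move=> d0 fg [m hm]; exists m; apply: is_cderive_of_ball => e e0.
have [d' d'0 H] := is_cderive_ball hm e0.
exists (Num.min d d'); first by rewrite lt_min d0 d'0.
move=> h; rewrite lt_min => /andP[h1 h2].
have := H h h2; rewrite fg//.
have := fg 0; rewrite Normc.normc0 d0 addr0 => -> //.
Qed.

Lemma holo_derivable f w : holo f w -> derivable (f : C^o -> C^o) w 1.
Proof. by move=> [m []]. Qed.

(** Complex differentiability gives a local Lipschitz bound. *)
Lemma holo_continuous f : (forall w, holo f w) -> continuous (f : C^o -> C^o).
Proof.
move=> H w; have [m hm] := H w.
apply: (@cvgrPdist_le C C^o C^o (nbhs (w : C^o)) (nbhs_filter _) f (f w)).2 => e e0.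
have [e0r eE] : 0 < Re e /\ e = (Re e)%:C%C.
  by move: e0; rewrite ltcE /= => /andP[/eqP ei er]; split=> //; apply: eq_ReIm.
have [d d0 Hd] := is_cderive_ball hm ltr01.
pose K := normc m + 1.
have K0 : 0 < K by rewrite ltr_wpDl ?normc_ge0.
have d'0 : 0 < Num.min d (Re e / K) by rewrite lt_min d0 divr_gt0.
have d'0c : 0 < (Num.min d (Re e / K))%:C%C :> C by rewrite ltcR.
exists ((Num.min d (Re e / K))%:C%C) => //= t.
rewrite /ball_ /= distrC => ht; move: ht; rewrite normrCE ltcR lt_min => /andP[h1 h2].
rewrite eE distrC normrCE lecR.
have := Hd _ h1; rewrite [w + _]addrC subrK mul1r => Hh.
have -> : f t - f w = (f t - f w - (t - w) * m) + (t - w) * m by rewrite subrK.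
apply: le_trans (normcD _ _) _; rewrite Normc.normcM.
have : normc (t - w) * K <= Re e by rewrite -ler_pdivlMr// ltW.
rewrite /K; lra.
Qed.

Variables (N : nat) (r : R) (p : C) (n : 'I_N -> C) (P : 'I_N -> 'cV[R]_4).
Hypotheses (r0 : 0 < r) (p1 : `|p| = 1) (n1 : forall k, `|n k| = 1).
Local Notation rc := (toC r).
Local Notation Pc k := (map_mx toC (P k)).

Let rc0 : rc != 0. Proof. by apply/eqP => -[E]; move: r0; rewrite E ltxx. Qed.
Let p0 : p != 0. Proof. exact: unit_neq0. Qed.
Let n0 k : n k != 0. Proof. exact: unit_neq0. Qed.
Let ii0 : ii != 0. Proof. exact: ii_neq0. Qed.

Local Notation v := (fv r p n).

(** [lambda^(4 N + 2) fct] as a polynomial in [lambda^4]. *)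
Definition cpoly : {poly C} :=
  (\prod_k ((((p * (n k)^-1) *: 'X - (p^-1 * n k)%:P) * ((2 * ii)^-1)%:P) ^+ 2)) *
  ((v%:P + v^*%C *: 'X) * (2^-1)%:P).

Lemma fs_poly k l : l != 0 -> fs p (n k) l ^+ 2 =
  (l^-1) ^+ 4 * ((((p * (n k)^-1) *: 'X - (p^-1 * n k)%:P) * ((2 * ii)^-1)%:P) ^+ 2).[l ^+ 4].
Proof.
move=> l0; set S := (X in X.[_]).
have -> y : S.[y] = ((p * (n k)^-1 * y - p^-1 * n k) * (2 * ii)^-1) ^+ 2.
  by rewrite /S !hornerE.
rewrite /fs /fE /fEi.
by field; rewrite l0 ii0 p0 n0.
Qed.

Lemma fct_poly l : l != 0 -> fct r p n l = l^-1 ^+ (4 * N + 2) * cpoly.[l ^+ 4].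
Proof.
move=> l0; rewrite /fct /cpoly hornerM horner_prod exprD.
rewrite (eq_bigr _ (fun k _ => fs_poly k l0)) big_split /=.
rewrite prodr_const card_ord -exprM.
have -> : ft r p n l = l^-1 ^+ 2 * ((v%:P + v^*%C *: 'X) * (2^-1)%:P).[l ^+ 4].
  set S := (X in X.[_]).
  have -> y : S.[y] = (v + v^*%C * y) / 2 by rewrite /S !hornerE.
  by rewrite /ft; field; rewrite l0.
by ring.
Qed.

Lemma kap_neq0 : kap p n != 0.
Proof.
apply/prodf_neq0 => k _; rewrite oppr_eq0 mulf_neq0 ?invr_eq0 ?pnatr_eq0//.
by rewrite expf_neq0// mulf_neq0 ?invr_eq0.
Qed.

Lemma cpoly0 : cpoly.[0] = rc * p^-1 / 2.
Proof.
rewrite /cpoly hornerM horner_prod.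
have -> : \prod_k ((((p * (n k)^-1) *: 'X - (p^-1 * n k)%:P) * ((2 * ii)^-1)%:P) ^+ 2).[0]
   = kap p n.
  apply: eq_bigr => k _; set S := (X in X.[_]).
  have -> y : S.[y] = ((p * (n k)^-1 * y - p^-1 * n k) * (2 * ii)^-1) ^+ 2.
    by rewrite /S !hornerE.
  rewrite mulr0 sub0r mulNr sqrrN exprMn invfM iiV mulrN sqrrN [(2^-1 * ii) ^+ 2]exprMn.
  rewrite sqr_i mulrN1 mulrN; congr (- (_ * _)).
  by field.
set S := (X in X.[_]).
have -> y : S.[y] = (v + v^*%C * y) / 2 by rewrite /S !hornerE.
by rewrite mulr0 addr0 /fv; field; rewrite kap_neq0 p0.
Qed.

Lemma cpoly_split : exists Q : {poly C}, cpoly = Q * 'X + (rc * p^-1 / 2)%:P.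
Proof.
have : root (cpoly - (rc * p^-1 / 2)%:P) 0 by rewrite /root hornerD hornerN hornerC cpoly0 subrr.
move/factor_theorem => [Q E]; exists Q.
by rewrite -[X in Q * X]subr0 -polyC0 -E subrK.
Qed.

Section NearZero.
Variables (Q : {poly C}) (z : C).
Hypothesis cQ : cpoly = Q * 'X + (rc * p^-1 / 2)%:P.

(** [w c - phi], with the cancellation of the terms in [lambda^-2] performed. *)
Definition hh l : C := l ^+ 2 * (z * Q.[l ^+ 4] - rc / 2 * (z^*%C * p)).

Lemma hhE l : l != 0 -> z * l ^+ (4 * N) * fct r p n l - fphi r p z l = hh l.
Proof.
move=> l0; rewrite fct_poly//.
have -> y : cpoly.[y] = Q.[y] * y + rc * p^-1 / 2 by rewrite cQ !hornerE.
rewrite /hh /fphi exprD.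
have E : l ^+ (4 * N) * l^-1 ^+ (4 * N) = 1 by rewrite -exprMn mulfV// expr1n.
transitivity (z * (l ^+ (4 * N) * l^-1 ^+ (4 * N)) * l^-1 ^+ 2 *
  (Q.[l ^+ 4] * l ^+ 4 + rc / p / 2) -
   rc / 2 * (z / p * l^-1 ^+ 2 + z^*%C * p * l ^+ 2)); first by ring.
by rewrite E; field; rewrite l0 p0.
Qed.

Lemma ent_poly b (S : {poly C}) f : ent b f -> ent b (fun l => S.[f l]).
Proof.
move=> ef; elim/poly_ind: S => [|S c IH].
  by apply: ent_eq (ent_cst b 0) _ => l; rewrite horner0.
apply: ent_eq (ent_add (ent_mul IH ef) (ent_cst b c)) _ => l.
by rewrite !hornerE.
Qed.

Lemma ent_hh : ent false hh.
Proof.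
apply: ent_mul; first by apply: ent_exp; exact: ent_id.
apply: ent_sub (ent_cst _ _); apply: ent_mul (ent_cst _ _) _; apply: ent_poly.
by apply: ent_exp; exact: ent_id.
Qed.

Definition BK l : 'M[C]_(4 + 1) :=
  am (hh l) (\sum_k qmul (bQ r p (n k) z (hh l) l) (Pc k)).

Lemma fE_lt1 k l : normc l < 1 -> fE p (n k) l ^+ 2 != 1.
Proof.
move=> l1; apply/eqP => E.
have : `|fE p (n k) l ^+ 2| = 1 by rewrite E normr1.
rewrite normrX /fE 2!normrM [`|(n k)^-1|]normrV ?unitfE// p1 n1 invr1 !mulr1 normrX -exprM.
move=> E4; have : `|l| ^+ 4 < 1 by rewrite exprn_ilt1// normrCE ltcR.
by rewrite E4 ltxx.
Qed.

(** In the unit disk [B] is given by [bQ], whose denominators [E^2 - 1] have no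
    zero there, including at 0 where [fA] and [hh] vanish. *)
Lemma Bm_near l : normc l < 1 -> Bm r p n P z l = BK l.
Proof.
move=> l1; rewrite /Bm; have [->|l0] := eqVneq l 0.
  rewrite /BK.
  have -> : hh 0 = 0 by rewrite /hh expr0n mul0r.
  rewrite big1 ?am0// => k _.
  have A0 : fA r p (n k) 0 = 0.
    rewrite /fA !expr0n /= !mulr0 !addr0 subr0 !mulr0 oppr0.
    by apply: cV4_eq; rewrite !(qvE, qlinE).
  rewrite /bQ A0 qmulr0.
  have -> : qmul 0 (fJ p (n k)) = 0 :> 'cV[C]_4.
    by apply: cV4_eq; rewrite !(qmulE, qlinE) !mul0r !subr0 ?addr0.
  rewrite scaler0 subr0 scaler0.
  by apply: cV4_eq; rewrite !(qmulE, qlinE) !mul0r !subr0 ?addr0.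
rewrite hhE// /BK; congr am.
have D (e S T u : 'cV[C]_4) :
    qmul e (qmul S u - qmul T u) = qmul (qmul e (S - T)) u.
  by rewrite -qmulNl -qmulDl qmulA.
rewrite /MT /HT -sumrB qmul_sumr; apply: eq_bigr => k _.
rewrite D -hhE//.
by rewrite -(bQ_eq r0 p1 (n1 k) z _ l0 (fE_lt1 k l1) (fct_fch r p n k l)).
Qed.

Lemma holo_BK s t : holo (fun l => BK l s t) 0.
Proof.
have eh := ent_hh.
rewrite /BK /am; case: (bE_entry C s t) => [[a [b [E _]]]|[i [E _]]|[c [E _]]].
- apply: holo_eq (fun l => esym (E _ _ _)).
  by apply: (@holo_ent false) => //; apply: ent_add; apply: ent_mul (ent_cst _ _);
    [exact: ent_ccos|exact: ent_csin].
- apply: holo_eq (fun l => esym (E _ _ _)).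
  apply: (holo_eq (f := fun l => \sum_k qmul (bQ r p (n k) z (hh l) l) (Pc k) i 0));
    last by move=> l; rewrite summxE.
  apply: holo_sum => k.
  apply: (holo_eq (f := fun l => (fE p (n k) l ^+ 2 - 1)^-1 *
     qmul (qmul (qv (ccos (hh l) - ccos (fth r (n k) z)) (csin (hh l)) 0 0) (fA r p (n k) l)
   - csin (fth r (n k) z) *: qmul (fA r p (n k) l) (fJ p (n k))) (Pc k) i 0));
    last by move=> l; rewrite /bQ qmulZl scaleqE.
  have eid : ent false (fun l => l : C) by exact: ent_id.
  apply: holoM.
    apply: holoV.
      apply: (@holo_ent false) => //; apply: ent_sub (ent_cst _ _); apply: ent_exp.
      by apply: ent_mul (ent_cst _ _); apply: ent_mul (ent_cst _ _); exact: ent_exp.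
    by rewrite /fE !expr0n /= !mul0r expr0n sub0r oppr_eq0 oner_eq0.
  have eA : entv false (fA r p (n k)).
    apply: entv_qv; try exact: ent_cst.
      apply: ent_mul (ent_cst _ _) _; apply: ent_sub => //.
      by apply: ent_mul (ent_cst _ _) _; exact: ent_exp.
    apply: ent_opp; apply: ent_mul (ent_cst _ _) _; apply: ent_add => //.
    by apply: ent_mul (ent_cst _ _) _; exact: ent_exp.
  apply: (@holo_ent false) => //.
  suff H : entv false (fun l =>
    qmul (qmul (qv (ccos (hh l) - ccos (fth r (n k) z)) (csin (hh l)) 0 0) (fA r p (n k) l)
   - csin (fth r (n k) z) *: qmul (fA r p (n k) l) (fJ p (n k))) (Pc k)) by exact: H.
  apply: entv_qmul (entv_cst _ _); apply: entv_sub.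
    apply: entv_qmul => //; apply: entv_qv; try exact: ent_cst.
      by apply: ent_sub (ent_cst _ _); exact: ent_ccos.
    exact: ent_csin.
  move=> i'; apply: ent_eq (ent_mul (ent_cst _ (csin (fth r (n k) z)))
    (entv_qmul eA (entv_cst _ (fJ p (n k))) i')) _ => l; by rewrite scaleqE.
- by apply: holo_eq (holo_cst c 0) _ => l; rewrite E.
Qed.

End NearZero.

Lemma holo_Bm z l s t : holo (fun w => Bm r p n P z w s t) l.
Proof.
have [->|l0] := eqVneq l 0.
  have [Q cQ] := cpoly_split.
  apply: (holo_near (d := 1) _ _ (holo_BK Q z s t)) => //= h h1.
  by rewrite add0r (Bm_near z cQ h1).
have nl : 0 < normc l by rewrite -ltcR -normrCE normr_gt0.
have E : ent true (fun l => am (z * l ^+ (4 * N) * fct r p n l - fphi r p z l)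
     (qmul (ei (- fphi r p z l)) (MT r p n P z l - HT r p n P z l)) s t).
  exact: (ent_am (ent_sub (ent_mul (ent_pow N z) (ent_fct r p n)) (ent_fphi r p z))
    (entv_BT r p n P z) s t).
apply: (holo_near nl _ (holo_ent E (fun _ => l0))) => h hl.
rewrite Bm_neq0//; apply/eqP => E0.
have Eh : h = - l by apply/eqP; rewrite -addr_eq0 addrC E0.
by move: hl; rewrite Eh normcN ltxx.
Qed.

Lemma LambdaBplus_Bm z : LambdaBplus (Bm r p n P z).
Proof.
split; first exact: LambdaGC_Bm.
exists (Bm r p n P z); split => //.
- move=> l _; rewrite /Bm; case: ifP => _; last exact: GaffC_am.
  by rewrite -am0; exact: GaffC_am.
- move=> s t; apply: continuous_subspaceT.
  by apply: holo_continuous => w; exact: holo_Bm.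
- move=> l _ s t; apply: holo_derivable; exact: holo_Bm.
- exists 1%:M; last by rewrite /Bm eqxx aff1.
  split; first exact: G0_1.
  by exists 1; rewrite ltr01 mul1mx scale1r.
Qed.

End Holomorphy.

(** * Degree and tangency of the potential *)

Section Potential.
Variable R : realType.
Local Notation C := R[i].
Local Notation Re := (@complex.Re R).
Local Notation Im := (@complex.Im R).
Local Notation normc := (@Normc.normc R).
Local Notation ii := ('i%C : C).
Implicit Types (x y z l w : C) (f g : C -> C).

(** The exponents lie between [- d] and [d]. *)
Definition laurent (d : nat) f : Prop := exists2 S : {poly C}, (size S <= d.*2.+1)%N &
  forall l, l != 0 -> f l = l^-1 ^+ d * S.[l].

Lemma laurent_eq d f g : laurent d f -> (forall l, l != 0 -> f l = g l) -> laurent d g.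
Proof. by move=> [S hS E] H; exists S => // l l0; rewrite -H// E. Qed.

Lemma laurent_cst (c : C) : laurent 0 (fun=> c).
Proof.
exists c%:P; first exact: leq_trans (size_polyC_leq1 c) _.
by move=> l _; rewrite expr0 mul1r hornerC.
Qed.

Lemma laurent_id : laurent 1 (fun l => l).
Proof.
exists ('X ^+ 2); first by rewrite size_polyXn.
by move=> l l0; rewrite hornerXn expr1 expr2 mulKf.
Qed.

Lemma laurent_inv : laurent 1 (fun l => l^-1).
Proof.
exists 1; first by rewrite size_poly1.
by move=> l l0; rewrite hornerC mulr1 expr1.
Qed.

Lemma laurentM d e f g : laurent d f -> laurent e g -> laurent (d + e) (fun l => f l * g l).
Proof.
move=> [S hS ES] [T hT ET]; exists (S * T).
  apply: leq_trans (size_polyMleq _ _) _.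
  have := leq_add hS hT; rewrite addSn addnS doubleD.
  by case: (size S + size T)%N => //= k.
by move=> l l0; rewrite ES// ET// hornerM exprD; ring.
Qed.

Lemma laurentW d e f : (d <= e)%N -> laurent d f -> laurent e f.
Proof.
move=> de [S hS ES]; exists (S * 'X^(e - d)).
  have [->|S0] := eqVneq S 0; first by rewrite mul0r size_poly0.
  rewrite size_mulXn//.
  apply: leq_trans (leq_add (leqnn _) hS) _.
  rewrite addnS ltnS.
  have -> : e.*2 = ((e - d).*2 + d.*2)%N by rewrite -doubleD subnK.
  by rewrite leq_add2r -addnn leq_addr.
move=> l l0; rewrite ES// hornerM hornerXn.
have -> : l^-1 ^+ e = l^-1 ^+ (e - d) * l^-1 ^+ d by rewrite -exprD subnK.
rewrite [RHS](_ : _ = (l^-1 ^+ (e - d) * l ^+ (e - d)) * (l^-1 ^+ d * S.[l])); last by ring.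
by rewrite -exprMn mulVf// expr1n mul1r.
Qed.

Lemma laurentD d f g : laurent d f -> laurent d g -> laurent d (fun l => f l + g l).
Proof.
move=> [S hS ES] [T hT ET]; exists (S + T).
  by apply: leq_trans (size_polyD _ _) _; rewrite geq_max hS hT.
by move=> l l0; rewrite ES// ET// hornerD mulrDr.
Qed.

Lemma laurentZ d (c : C) f : laurent d f -> laurent d (fun l => c * f l).
Proof. exact: laurentM (laurent_cst c). Qed.

Lemma laurent_sum d (I : Type) (s : seq I) (f : I -> C -> C) :
  (forall i, laurent d (f i)) -> laurent d (fun l => \sum_(i <- s) f i l).
Proof.
move=> H; elim: s => [|i s IH].
  apply: laurent_eq (laurentW (leq0n d) (laurent_cst 0)) _ => l _; by rewrite big_nil.
by apply: laurent_eq (laurentD (H i) IH) _ => l _; rewrite big_cons.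
Qed.

Lemma laurent_prod e (I : Type) (s : seq I) (Q : pred I) (f : I -> C -> C) :
  (forall i, laurent e (f i)) ->
  laurent (e * count Q s) (fun l => \prod_(i <- s | Q i) f i l).
Proof.
move=> H; elim: s => [|i s IH] /=.
  by rewrite muln0; apply: laurent_eq (laurent_cst 1) _ => l _; rewrite big_nil.
rewrite mulnDr; case Qi : (Q i).
  by rewrite muln1; apply: laurent_eq (laurentM (H i) IH) _ => l _; rewrite big_cons Qi.
by rewrite muln0 add0n; apply: laurent_eq IH _ => l _; rewrite big_cons Qi.
Qed.

Lemma laurent_exp d k f : laurent d f -> laurent (d * k) (fun l => f l ^+ k).
Proof.
move=> H; elim: k => [|k IH].
  by rewrite muln0; apply: laurent_eq (laurent_cst 1) _ => l _; rewrite expr0.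
by rewrite mulnS; apply: laurent_eq (laurentM H IH) _ => l _; rewrite exprS.
Qed.

Lemma bE_mul x T c S : am x T *m bE c 0 1 S =
  bE c (- csin x) (ccos x) (qmul (ei x) S).
Proof.
rewrite /am /aff /bE mulmx_block !mulmx0 !mul0mx !addr0 rotqE.
by rewrite -scalemxAr rotqM !mulr0 !mulr1 sub0r add0r.
Qed.

Lemma bE_scale (e c : C) (S : 'cV[C]_4) : e *: bE c 0 1 S = bE (e * c) 0 1 (e *: S).
Proof. by rewrite /bE scale_block_mx !scaler0 scalerA. Qed.

Lemma is_cderive_ccos x : is_derive (x : C^o) 1 (@ccos R : C^o -> C^o) (- csin x).
Proof.
have H := is_cderiveD (is_cderive_cst 1 x)
  (is_cderiveZ (-1) (is_cderiveM (is_cderive_id x) (is_cderive_cosc x))).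
have E : (fun z => 1 + -1 * (z * cosc z)) = @ccos R.
  by apply/funext => z; rewrite coscE; ring.
rewrite -E; apply: is_cderive_eq H _.
by rewrite -cosc_lin; ring.
Qed.

Lemma is_cderive_csin x : is_derive (x : C^o) 1 (@csin R : C^o -> C^o) (ccos x).
Proof.
have H := is_cderiveM (is_cderive_id x) (is_cderive_sinc x).
have E : (fun z => z * sinc z) = @csin R.
  by apply/funext => z; rewrite sincE.
rewrite -E; apply: is_cderive_eq H _.
by rewrite -sinc_lin; ring.
Qed.

Section Linear.
Variables (z0 k c : C).

Lemma is_cderive_lin z : is_derive (z : C^o) 1 ((fun w => (w - z0) * k) : C^o -> C^o) k.
Proof.
have -> : (fun w => (w - z0) * k) = (fun w => k * w + - (z0 * k)).
  by apply/funext => w; ring.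
apply: is_cderive_eq (is_cderiveD (is_cderiveZ k (is_cderive_id z)) (is_cderive_cst _ z)) _.
by rewrite mulr1 addr0.
Qed.

Lemma is_cderive_lin_cosc z : is_derive (z : C^o) 1
  ((fun w => (w - z0) * k * cosc ((w - z0) * k * c)) : C^o -> C^o)
  (k * csin ((z - z0) * k * c)).
Proof.
have D1 := is_cderive_lin z.
have D2 : is_derive (z : C^o) 1 ((fun w => (w - z0) * k * c) : C^o -> C^o) (k * c).
  have -> : (fun w => (w - z0) * k * c) = (fun w => c * ((w - z0) * k)).
    by apply/funext => w; ring.
  by apply: is_cderive_eq (is_cderiveZ c D1) _; ring.
apply: is_cderive_eq (is_cderiveM D1 (is_cderive_comp (is_cderive_cosc _) D2)) _.
by rewrite -cosc_lin; ring.
Qed.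

Lemma is_cderive_lin_sinc z : is_derive (z : C^o) 1
  ((fun w => (w - z0) * k * sinc ((w - z0) * k * c)) : C^o -> C^o)
  (k * ccos ((z - z0) * k * c)).
Proof.
have D1 := is_cderive_lin z.
have D2 : is_derive (z : C^o) 1 ((fun w => (w - z0) * k * c) : C^o -> C^o) (k * c).
  have -> : (fun w => (w - z0) * k * c) = (fun w => c * ((w - z0) * k)).
    by apply/funext => w; ring.
  by apply: is_cderive_eq (is_cderiveZ c D1) _; ring.
apply: is_cderive_eq (is_cderiveM D1 (is_cderive_comp (is_cderive_sinc _) D2)) _.
by rewrite -sinc_lin; ring.
Qed.

End Linear.

Lemma is_cderive_sum (N : nat) (f : 'I_N -> C -> C) (m : 'I_N -> C) w :
  (forall k, is_derive (w : C^o) 1 (f k : C^o -> C^o) (m k)) ->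
  is_derive (w : C^o) 1 ((fun z => \sum_k f k z) : C^o -> C^o) (\sum_k m k).
Proof.
move=> H; elim: (index_enum 'I_N) => [|i s IH].
  have -> : (fun z => \sum_(k <- [::]) f k z) = (fun=> 0) by apply/funext => z; rewrite big_nil.
  by rewrite big_nil; exact: is_cderive_cst.
have -> : (fun z => \sum_(k <- i :: s) f k z) = (fun z => f i z + \sum_(k <- s) f k z).
  by apply/funext => z; rewrite big_cons.
by rewrite big_cons; exact: is_cderiveD.
Qed.

Variables (N : nat) (r : R) (p : C) (n : 'I_N -> C) (P : 'I_N -> 'cV[R]_4).
Hypotheses (r0 : 0 < r) (p1 : `|p| = 1) (n1 : forall k, `|n k| = 1).
Local Notation rc := (toC r).
Local Notation Pc k := (map_mx toC (P k)).
Local Notation ct := (fct r p n).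
Local Notation ch := (fch r p n).
Local Notation eT := (etaT r p n P).

Lemma laurent_fs k : laurent 2 (fs p (n k)).
Proof.
have h1 := laurent_exp 2 laurent_id; have h2 := laurent_exp 2 laurent_inv.
apply: laurent_eq (laurentZ (2 * ii)^-1 (laurentD (laurentZ (p / n k) h1) (laurentZ (- (p^-1 * n k)) h2))) _.
by move=> l l0; rewrite /fs /fE /fEi; ring.
Qed.

Lemma laurent_ft : laurent 2 (ft r p n).
Proof.
have h1 := laurent_exp 2 laurent_id; have h2 := laurent_exp 2 laurent_inv.
apply: laurent_eq (laurentZ 2^-1 (laurentD (laurentZ (fv r p n) h2) (laurentZ (fv r p n)^*%C h1))) _.
by move=> l l0; rewrite /ft; ring.
Qed.

Lemma laurent_fct : laurent (4 * N + 2) ct.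
Proof.
have := laurentM (laurent_prod (index_enum 'I_N) xpredT (fun k => laurent_exp 2 (laurent_fs k))) laurent_ft.
by rewrite -sum1_count sum1_card card_ord.
Qed.

(** Removing one factor [fs] from [fct] lowers the degree by 2. *)
Lemma laurent_fch k : laurent (4 * N) (ch k).
Proof.
have := laurentM (laurentM (laurent_fs k) (laurent_prod (index_enum 'I_N) (fun j => j != k)
  (fun j => laurent_exp 2 (laurent_fs j)))) laurent_ft.
apply: laurentW.
have -> : count (fun j => j != k) (index_enum 'I_N) = N.-1.
  by rewrite -sum1_count sum1_card cardC1 card_ord.
case: N k => [[]//|N' k].
by rewrite [(4 * N'.+1)%N]mulnS /= addnAC leqnn.
Qed.

Lemma laurent_fa k i : laurent 1 (fun l => fa r (n k) l i 0).
Proof.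
have h1 := laurentZ (n k) laurent_inv; have h2 := laurentZ (n k)^-1 laurent_id.
case: i => [[|[|[|[|//]]]] hi].
- apply: laurent_eq (laurentW (leq0n 1) (laurent_cst 0)) _ => l _; by rewrite mxE.
- apply: laurent_eq (laurentZ ((2 * ii)^-1 * rc^-1) (laurentD h1 (laurentZ (-1) h2))) _ => l _.
  by rewrite mxE /= /fsx; ring.
- apply: laurent_eq (laurentW (leq0n 1) (laurent_cst 0)) _ => l _; by rewrite mxE.
- apply: laurent_eq (laurentZ (- (2^-1 * rc^-1)) (laurentD h1 h2)) _ => l _.
  by rewrite mxE /= /fcx; ring.
Qed.

Lemma laurent_qmul_cst d (S : C -> 'cV[C]_4) u i : (forall j, laurent d (fun l => S l j 0)) ->
  laurent d (fun l => qmul (S l) u i 0).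
Proof.
move=> H.
have K (a b c e : C) : laurent d (fun l => S l 0 0 * a + S l 1 0 * b + S l 2 0 * c + S l 3 0 * e).
  have Z j (e' : C) : laurent d (fun l => S l j 0 * e').
    by apply: laurent_eq (laurentZ e' (H j)) _ => l _; rewrite mulrC.
  by do 3! apply: laurentD => //.
case: i => [[|[|[|[|//]]]] hi].
- apply: laurent_eq (K (u 0 0) (- u 1 0) (- u 2 0) (- u 3 0)) _ => l _; rewrite mxE /=; ring.
- apply: laurent_eq (K (u 1 0) (u 0 0) (u 3 0) (- u 2 0)) _ => l _; rewrite mxE /=; ring.
- apply: laurent_eq (K (u 2 0) (- u 3 0) (u 0 0) (u 1 0)) _ => l _; rewrite mxE /=; ring.
- apply: laurent_eq (K (u 3 0) (u 2 0) (- u 1 0) (u 0 0)) _ => l _; rewrite mxE /=; ring.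
Qed.

Lemma laurent_etaT i : laurent (4 * N + 2) (fun l => eT l i 0).
Proof.
apply: (laurentW (d := 4 * N + 1)); first by rewrite leq_add2l.
apply: (laurent_eq (f := fun l => \sum_k ch k l * qmul (qmul qi (fa r (n k) l)) (Pc k) i 0)).
  apply: laurent_sum => k; apply: laurentM; first exact: laurent_fch.
  apply: (laurent_qmul_cst (S := fun l => qmul qi (fa r (n k) l))) => j.
  have hf := laurent_fa k.
  have h0 : laurent 1 (fun=> 0) by apply: laurentW (leq0n 1) (laurent_cst 0).
  rewrite qiE; move: j; apply: I4_ind.
  - by apply: laurent_eq (laurentZ (-1) (hf 1)) _ => l _; rewrite qmul0 qvE qvE qvE qvE; ring.
  - by apply: laurent_eq (laurentZ 1 (hf 0)) _ => l _; rewrite qmul1 qvE qvE qvE qvE; ring.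
  - by apply: laurent_eq (laurentZ (-1) (hf 3)) _ => l _; rewrite qmul2 qvE qvE qvE qvE; ring.
  - by apply: laurent_eq (laurentZ 1 (hf 2)) _ => l _; rewrite qmul3 qvE qvE qvE qvE; ring.
by move=> l _; rewrite /etaT summxE; apply: eq_bigr => k _; rewrite [in RHS]scaleqE.
Qed.

Lemma etam_toC l : `|l| = 1 -> map_mx toC (etam r p n P l) = bE (ct l) 0 1 (eT l).
Proof.
move=> l1; rewrite /etam /bE map_block_mx; congr block_mx.
- apply/matrixP => s t; rewrite mxE.
  have -> : (Re (ct l) *: Lq qi) s t = Re (ct l) * Lq qi s t by rewrite mxE.
  have -> : (ct l *: rotq 0 1) s t = ct l * rotq 0 1 s t by rewrite mxE.
  rewrite toCM creal_toCRe; last exact: creal_fct.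
  by rewrite rotq_entry mul0r add0r mul1r Lqi_toC.
- by rewrite toC_Re_map//; exact: crealv_etaT.
- by apply/matrixP => s t; rewrite !mxE.
- by apply/matrixP => s t; rewrite !mxE.
Qed.

(** Rotating by [t * fct] and translating by [t * etaT] is not a one-parameter
    group, but the tangent vector at [t = 0] only sees the first order. *)
Lemma gaff_etam l : gaff (etam r p n P l).
Proof.
exists (fun t => amR (t * Re (ct l)) (t *: map_mx Re (eT l))); split.
- by move=> t; exact: Gaff_amR.
- by rewrite /amR mul0r scale0r cos0 sin0 rotq10 aff1.
move=> s t; rewrite /amR.
have -> : etam r p n P l = bE (Re (ct l)) 0 1 (map_mx Re (eT l)).
  by rewrite /etam /bE /rotq scale0r scale1r add0r.
have DZ (c : R) : is_derive (0 : R) 1 (fun u : R => u * c) c.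
  have -> : (fun u : R => u * c) = (fun u : R => c *: id u).
    by apply/funext => u; rewrite /GRing.scale /= mulrC.
  by apply: is_derive_eq; rewrite /GRing.scale /= mulr1.
case: (bE_entry R s t) => [[a [b [E1 E2]]]|[i [E1 E2]]|[e [E1 E2]]]; rewrite E2.
- set c := Re (ct l).
  have -> : (fun u => aff (rotq (cos (u * c)) (sin (u * c))) (u *: map_mx Re (eT l)) s t) =
     a *: (fun u => cos (u * c)) + b *: (fun u => sin (u * c)).
    by apply/funext => u; rewrite E1 [_ * a]mulrC [_ * b]mulrC.
  have Dc : is_derive (0 : R) 1 (fun u => cos (u * c)) (- sin (0 * c) * c).
    exact: (is_derive1_comp (is_derive_cos _) (DZ c)).
  have Ds : is_derive (0 : R) 1 (fun u => sin (u * c)) (cos (0 * c) * c).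
    exact: (is_derive1_comp (is_derive_sin _) (DZ c)).
  apply: (is_derive_eq (is_deriveD (is_deriveZ a Dc) (is_deriveZ b Ds))).
  by rewrite mul0r sin0 cos0 /GRing.scale /=; ring.
- have -> : (fun u => aff (rotq (cos (u * Re (ct l))) (sin (u * Re (ct l))))
       (u *: map_mx Re (eT l)) s t) = (fun u => u * (map_mx Re (eT l) i 0)).
    by apply/funext => u; rewrite E1 [LHS]mxE.
  exact: DZ.
- have -> : (fun u => aff (rotq (cos (u * Re (ct l))) (sin (u * Re (ct l))))
       (u *: map_mx Re (eT l)) s t) = (fun=> e) by apply/funext => u; rewrite E1.
  exact: is_derive_cst.
Qed.

End Potential.

(** * The potential equation *)

Section FiniteTypeModes.
Variable R : realType.
Local Notation C := R[i].
Local Notation Re := (@complex.Re R).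
Local Notation Im := (@complex.Im R).
Local Notation normc := (@Normc.normc R).
Local Notation ii := ('i%C : C).
Implicit Types (x y z l w : C) (f g : C -> C).

Variables (N : nat) (r : R) (p : C) (n : 'I_N -> C) (P : 'I_N -> 'cV[R]_4).
Hypotheses (r0 : 0 < r) (p1 : `|p| = 1) (n1 : forall k, `|n k| = 1).
Local Notation rc := (toC r).
Local Notation Pc k := (map_mx toC (P k)).
Local Notation ct := (fct r p n).
Local Notation ch := (fch r p n).
Local Notation eT := (etaT r p n P).
Let rc0 : rc != 0. Proof. by apply/eqP => -[E]; move: r0; rewrite E ltxx. Qed.
Let p0 : p != 0. Proof. exact: unit_neq0. Qed.
Let n0 k : n k != 0. Proof. exact: unit_neq0. Qed.
Let ii0 : ii != 0. Proof. exact: ii_neq0. Qed.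

Lemma entv_etaT : entv true eT.
Proof.
apply: entv_sum => k i.
apply: ent_eq (ent_mul (ent_fch r p n k)
  (entv_qmul (entv_qmul (entv_cst true qi) (entv_fa r n k)) (entv_cst true (Pc k)) i)) _ => l.
by rewrite [in RHS]scaleqE.
Qed.

Lemma ent_bE s t : ent true (fun l => bE (ct l) 0 1 (eT l) s t).
Proof.
case: (bE_entry C s t) => [[a [b [_ E]]]|[i [_ E]]|[e [_ E]]].
- apply: ent_eq (ent_mul (ent_fct r p n) (ent_cst true (0 * a + 1 * b))) _ => l.
  by rewrite E.
- by apply: ent_eq (entv_etaT i) _ => l; rewrite E.
- by apply: ent_eq (ent_cst true 0) _ => l; rewrite E.
Qed.

Lemma laurent_bE s t : laurent (4 * N + 2) (fun l => bE (ct l) 0 1 (eT l) s t).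
Proof.
case: (bE_entry C s t) => [[a [b [_ E]]]|[i [_ E]]|[e [_ E]]].
- apply: laurent_eq (laurentZ (0 * a + 1 * b) (laurent_fct r p n)) _ => l _.
  by rewrite E mulrC.
- by apply: laurent_eq (laurent_etaT r p n P i) _ => l _; rewrite E.
- by apply: laurent_eq (laurentW (leq0n _) (laurent_cst 0)) _ => l _; rewrite E.
Qed.

Lemma etam_twist l : `|l| = 1 ->
  etam r p n P (ii * l) = tau (etam r p n P l).
Proof.
move=> l1; rewrite /etam fct_twist etaT_twist map_Re_jmul ReN.
rewrite /tau block_mxKul block_mxKur block_mxKdl block_mxKdr LqE; congr block_mx.
apply: cV4_mx_eq => u.
rewrite mulNmx -!mulmxA !LqE -!scalemxAl !LqE scaleNr; congr (- _).
rewrite qmulZr; congr (_ *: _).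
rewrite !qmulA; congr qmul.
by rewrite qiE qjE !qv_mul; apply: qv_eq; ring.
Qed.

Lemma Lambdag_etam : Lambdag (etam r p n P).
Proof.
split.
- by move=> l _; exact: gaff_etam.
- by move=> l l1; exact: etam_twist.
- move=> s t; have [H _] := ent_smooth (ent_bE s t).
  suff -> : (fun u => etam r p n P (on_circle u) s t) =
    (fun u => Re (bE (ct (on_circle u)) 0 1 (eT (on_circle u)) s t)) by [].
  apply/funext => u.
  by rewrite -(etam_toC r P p1 n1) ?normr_on_circle// [in RHS]mxE.
Qed.

(** Shifting the polynomial [lambda^d eta] by [d] gives the Fourier coefficients of
    [eta]. *)
Lemma Lambdag_deg_etam : Lambdag_deg (4 * N + 2) (etam r p n P).
Proof.
split; first exact: Lambdag_etam.
have H (s t : 'I_(4 + 1)) : exists S : {poly C}, (size S <= (4 * N + 2).*2.+1)%N /\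
  forall l, l != 0 -> bE (ct l) 0 1 (eT l) s t = l^-1 ^+ (4 * N + 2) * S.[l].
  by have [S h1 h2] := laurent_bE s t; exists S.
have [S HS] : exists S : 'I_(4 + 1) -> 'I_(4 + 1) -> {poly C}, forall s t,
   (size (S s t) <= (4 * N + 2).*2.+1)%N /\
  forall l, l != 0 -> bE (ct l) 0 1 (eT l) s t = l^-1 ^+ (4 * N + 2) * (S s t).[l].
  exists (fun s t => projT1 (cid (H s t))) => s t.
  exact: projT2 (cid (H s t)).
move: (4 * N + 2)%N HS => d HS.
exists (fun m : int => \matrix_(s, t) (S s t)`_(absz (m + d%:Z))) => l l1.
have l0 := unit_neq0 l1.
rewrite (etam_toC r P p1 n1 l1); apply/matrixP => s t.
have [hS ES] := HS s t.
rewrite ES// (horner_coef_wide _ hS) mulr_sumr summxE; apply: eq_bigr => i _.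
rewrite !mxE subrK absz_nat mulrCA mulrC; congr (_ * _).
by rewrite expfzDr// -exprnN -exprnP exprVn mulrC.
Qed.

Lemma is_cderive_MT z0 l i z :
  is_derive (z : C^o) 1 ((fun w => MT r p n P (w - z0) l i 0) : C^o -> C^o)
   (qmul (ei ((z - z0) * l ^+ (4 * N) * ct l)) (l ^+ (4 * N) *: eT l) i 0).
Proof.
pose L := l ^+ (4 * N).
pose U k := qmul (fa r (n k) l) (Pc k).
have ME w : MT r p n P (w - z0) l i 0 = \sum_k
   ((- ch k l * U k i 0) * ((w - z0) * L * cosc ((w - z0) * L * ct l)) +
    (ch k l * qmul qi (U k) i 0) * ((w - z0) * L * sinc ((w - z0) * L * ct l))).
  rewrite /MT summxE; apply: eq_bigr => k _.
  rewrite -qmulA -/(U k) /mL -/L.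
  have E (a b : C) u : qmul (qv a b 0 0) u i 0 = a * u i 0 + b * qmul qi u i 0.
    have -> : qmul (qv a b 0 0) u = a *: u + b *: qmul qi u.
      rewrite qiE [u]qv_eta; rewrite !qv_mul !qv_scale qv_add.
      by apply: qv_eq; ring.
    by rewrite addqE !scaleqE.
  by rewrite E; ring.
have -> : (fun w => MT r p n P (w - z0) l i 0) = (fun w => \sum_k
   ((- ch k l * U k i 0) * ((w - z0) * L * cosc ((w - z0) * L * ct l)) +
    (ch k l * qmul qi (U k) i 0) * ((w - z0) * L * sinc ((w - z0) * L * ct l)))).
  by apply/funext.
have D k := is_cderiveD
  (is_cderiveZ (- ch k l * U k i 0) (is_cderive_lin_cosc z0 L (ct l) z))
  (is_cderiveZ (ch k l * qmul qi (U k) i 0) (is_cderive_lin_sinc z0 L (ct l) z)).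
apply: is_cderive_eq (is_cderive_sum D) _.
rewrite -/L /etaT scaler_sumr qmul_sumr summxE; apply: eq_bigr => k _.
rewrite !qmulZr -qmulA -/(U k) !scaleqE.
set x := (z - z0) * L * ct l.
have E u : qmul (ei x) (qmul qi u) i 0 = ccos x * qmul qi u i 0 - csin x * u i 0.
  have -> : qmul (ei x) (qmul qi u) = ccos x *: qmul qi u - csin x *: u.
    rewrite qiE [u]qv_eta /ei; rewrite !qv_mul !qv_scale qv_opp qv_add.
    by apply: qv_eq; ring.
  by rewrite addqE oppqE !scaleqE.
by rewrite E; ring.
Qed.

(** The potential does not depend on [z], so the solution is an exponential, for
    which [Mm] is the closed form. *)
Lemma Mm_solution z0 : constant_potential_solution (4 * N + 2) (etam r p n P) z0
  (fun z l => Mm r p n P (z - z0) l).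
Proof.
split.
- by move=> z; exact: LambdaGC_Mm.
- move=> l l1 z s t.
  rewrite addnK (etam_toC r P p1 n1 l1) bE_scale /Mm bE_mul /am.
  pose L := l ^+ (4 * N); pose x := (z - z0) * L * ct l.
  case: (bE_entry C s t) => [[a [b [E1 E2]]]|[i [E1 E2]]|[e [E1 E2]]].
  + rewrite E2.
    have -> : (fun w => aff (rotq (ccos ((w - z0) * l ^+ (4 * N) * ct l))
         (csin ((w - z0) * l ^+ (4 * N) * ct l))) (MT r p n P (w - z0) l) s t) =
      (fun w => a * ccos ((w - z0) * (L * ct l)) + b * csin ((w - z0) * (L * ct l))).
      by apply/funext => w; rewrite E1 -/L -mulrA; ring.
    have D := is_cderive_lin z0 (L * ct l) z.
    apply: is_cderive_eq (is_cderiveD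
      (is_cderiveZ a (is_cderive_comp (is_cderive_ccos _) D))
      (is_cderiveZ b (is_cderive_comp (is_cderive_csin _) D))) _.
    have -> : (z - z0) * l ^+ (4 * N) * ct l = (z - z0) * (L * ct l) by rewrite mulrA.
    by rewrite -/L; ring.
  + rewrite E2.
    have -> : (fun w => aff (rotq (ccos ((w - z0) * l ^+ (4 * N) * ct l))
         (csin ((w - z0) * l ^+ (4 * N) * ct l))) (MT r p n P (w - z0) l) s t) =
      (fun w => MT r p n P (w - z0) l i 0).
      by apply/funext => w; rewrite E1.
    exact: is_cderive_MT.
  + rewrite E2.
    have -> : (fun w => aff (rotq (ccos ((w - z0) * l ^+ (4 * N) * ct l))
         (csin ((w - z0) * l ^+ (4 * N) * ct l))) (MT r p n P (w - z0) l) s t) =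
      (fun=> e) by apply/funext => w; rewrite E1.
    exact: is_cderive_cst.
- move=> l l1; rewrite /Mm subrr !mul0r.
  have -> : MT r p n P 0 l = 0.
    rewrite /MT big1// => k _; rewrite /mL !mul0r oppr0.
    have Z (u : 'cV[C]_4) : qmul (qv 0 0 0 0) u = 0.
      rewrite [u]qv_eta qv_mul !mul0r !subr0 !addr0.
      by apply: cV4_eq; rewrite !(qvE, zeroqE).
    by rewrite -qmulA Z.
  exact: am0.
Qed.

Lemma modes_obtained z0 : obtained_by_integrating (4 * N + 2) (etam r p n P) z0
  (fun z => map_mx Re (HT r p n P (z - z0) 1)).
Proof.
exists (fun z l => Mm r p n P (z - z0) l), (fun z l => Hm r p n P (z - z0) l),
  (fun z l => Bm r p n P (z - z0) l); split.
- exact: Mm_solution.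
- by move=> z; exact: LambdaG_Hm.
- by move=> z; exact: LambdaBplus_Bm.
- by move=> z l l1; exact: MHB.
- by move=> z; rewrite /Hm /amR /aff block_mxKur.
Qed.

End FiniteTypeModes.

(** * Derivative of the frame at lambda = 1 *)

Section ModesDerivative.
Variable R : realType.
Local Notation C := R[i].
Local Notation Re := (@complex.Re R).
Local Notation Im := (@complex.Im R).
Local Notation ii := ('i%C : C).
Implicit Types (z e : C) (t : R).

Lemma is_pder_aff (A B : C) t : is_pder (fun s => A + toC s * B) t B.
Proof.
apply: is_pder_eq (is_pderD (is_pder_cst A t) (is_pderM (is_pder_toC t) (is_pder_cst B t))) _.
by rewrite mulr0 addr0 add0r mul1r.
Qed.

(** Two proportional affine functions: the derivative of the product is elementary
    because [x * cosc x = 1 - cos x]. *)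
Lemma is_pder_aff_cosc (A A' B B' : C) t : A * B' = B * A' ->
  is_pder (fun s => (A + toC s * A') * cosc (B + toC s * B')) t
    (A' * csin (B + toC t * B')).
Proof.
move=> E; have Da := is_pder_aff A A' t; have Db := is_pder_aff B B' t.
apply: is_pder_eq (is_pderM Da (is_pder_comp (is_cderive_cosc _) Db)) _.
rewrite -cosc_lin; set x := B + toC t * B'.
have E2 : (A + toC t * A') * B' = x * A' by rewrite /x !mulrDl E; ring.
set g := _ / 2; transitivity (A' * cosc x + ((A + toC t * A') * B') * g); first by ring.
by rewrite E2; ring.
Qed.

Lemma is_pder_aff_sinc (A A' B B' : C) t : A * B' = B * A' ->
  is_pder (fun s => (A + toC s * A') * sinc (B + toC s * B')) t
    (A' * ccos (B + toC t * B')).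
Proof.
move=> E; have Da := is_pder_aff A A' t; have Db := is_pder_aff B B' t.
apply: is_pder_eq (is_pderM Da (is_pder_comp (is_cderive_sinc _) Db)) _.
rewrite -sinc_lin; set x := B + toC t * B'.
have E2 : (A + toC t * A') * B' = x * A' by rewrite /x !mulrDl E; ring.
set g := _ / 2; transitivity (A' * sinc x + ((A + toC t * A') * B') * g); first by ring.
by rewrite E2; ring.
Qed.

Definition is_pderv (u : R -> 'cV[C]_4) t (v : 'cV[C]_4) : Prop :=
  forall i, is_pder (fun s => u s i 0) t (v i 0).

Lemma is_pderv_qv (f0 f1 f2 f3 : R -> C) t a b c d :
  is_pder f0 t a -> is_pder f1 t b -> is_pder f2 t c -> is_pder f3 t d ->
  is_pderv (fun s => qv (f0 s) (f1 s) (f2 s) (f3 s)) t (qv a b c d).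
Proof.
move=> h0 h1 h2 h3; apply: I4_ind; rewrite qvE.
- by have -> : (fun s => qv (f0 s) (f1 s) (f2 s) (f3 s) 0 0) = f0 by apply/funext => s; rewrite qvE.
- by have -> : (fun s => qv (f0 s) (f1 s) (f2 s) (f3 s) 1 0) = f1 by apply/funext => s; rewrite qvE.
- by have -> : (fun s => qv (f0 s) (f1 s) (f2 s) (f3 s) 2 0) = f2 by apply/funext => s; rewrite qvE.
- by have -> : (fun s => qv (f0 s) (f1 s) (f2 s) (f3 s) 3 0) = f3 by apply/funext => s; rewrite qvE.
Qed.

Lemma is_pderv_qmul u t v (c : 'cV[C]_4) : is_pderv u t v ->
  is_pderv (fun s => qmul (u s) c) t (qmul v c).
Proof.
move=> h.
have Z i (k : C) : is_pder (fun s => u s i 0 * k) t (v i 0 * k).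
  by apply: is_pder_eq (is_pderM (h i) (is_pder_cst k t)) _; rewrite mulr0 addr0.
have L (a b d e : C) : is_pder (fun s => u s 0 0 * a + u s 1 0 * b + u s 2 0 * d + u s 3 0 * e) t
   (v 0 0 * a + v 1 0 * b + v 2 0 * d + v 3 0 * e).
  by do 3! apply: is_pderD => //.
have W (f g : R -> C) a b : is_pder f t a -> f = g -> a = b -> is_pder g t b.
  by move=> + <- <-.
apply: I4_ind.
- apply: W (L (c 0 0) (- c 1 0) (- c 2 0) (- c 3 0)) _ _.
    by apply/funext => s; rewrite qmul0; ring.
  by rewrite qmul0; ring.
- apply: W (L (c 1 0) (c 0 0) (c 3 0) (- c 2 0)) _ _.
    by apply/funext => s; rewrite qmul1; ring.
  by rewrite qmul1; ring.
- apply: W (L (c 2 0) (- c 3 0) (c 0 0) (c 1 0)) _ _.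
    by apply/funext => s; rewrite qmul2; ring.
  by rewrite qmul2; ring.
- apply: W (L (c 3 0) (c 2 0) (- c 1 0) (c 0 0)) _ _.
    by apply/funext => s; rewrite qmul3; ring.
  by rewrite qmul3; ring.
Qed.

Lemma is_pder_sum (N : nat) (f : 'I_N -> R -> C) (m : 'I_N -> C) t :
  (forall k, is_pder (f k) t (m k)) ->
  is_pder (fun s => \sum_k f k s) t (\sum_k m k).
Proof.
move=> H; elim: (index_enum 'I_N) => [|i s IH].
  have -> : (fun u => \sum_(k <- [::]) f k u) = (fun=> 0) by apply/funext => u; rewrite big_nil.
  by rewrite big_nil; exact: is_pder_cst.
have -> : (fun u => \sum_(k <- i :: s) f k u) = (fun u => f i u + \sum_(k <- s) f k u).
  by apply/funext => u; rewrite big_cons.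
by rewrite big_cons; exact: is_pderD.
Qed.

Section OneMode.
Variables (r : R) (p n : C).
Hypotheses (r0 : 0 < r) (p1 : `|p| = 1) (n1 : `|n| = 1).
Local Notation rc := (toC r).
Let rc0 : rc != 0. Proof. by apply/eqP => -[E]; move: r0; rewrite E ltxx. Qed.
Let p0 : p != 0. Proof. exact: unit_neq0. Qed.
Let n0 : n != 0. Proof. exact: unit_neq0. Qed.
Let ii0 : ii != 0. Proof. exact: ii_neq0. Qed.

(** The direction [x + i y] of the plane, as the quaternion [x + y j]. *)
Definition dirq e : 'cV[C]_4 := qv ((e + e^*%C) / 2) 0 ((e - e^*%C) / (2 * ii)) 0.
(** [cos th + J sin th] with the [J] of [fJ]. *)
Definition mE z : 'cV[C]_4 :=
  qv (ccos (fth r n z)) ((n * p + (n * p)^-1) / 2 * csin (fth r n z)) 0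
     ((n * p - (n * p)^-1) / (2 * ii) * csin (fth r n z)).

Lemma fphi_aff z e s : fphi r p (z + toC s * e) 1 = fphi r p z 1 + toC s * fphi r p e 1.
Proof. by rewrite /fphi conjcD conjcM conjc_toC; ring. Qed.

Lemma fth_aff z e s : fth r n (z + toC s * e) = fth r n z + toC s * fth r n e.
Proof. by rewrite /fth conjcD conjcM conjc_toC; ring. Qed.

Lemma fY_aff (k : C) z e s :
  fY r p n k (z + toC s * e) 1 = fY r p n k z 1 + toC s * fY r p n k e 1.
Proof. by rewrite /fY conjcD conjcM conjc_toC; ring. Qed.

(** At [l = 1] the functions [fY] are proportional to the arguments of [cosc] and
    [sinc] that they multiply in [hL]. *)
Lemma fY_prop (k : C) z e : k ^+ 2 = 1 ->
  fY r p n k z 1 * (fphi r p e 1 - k * fth r n e) =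
  (fphi r p z 1 - k * fth r n z) * fY r p n k e 1.
Proof.
move=> k2; rewrite /fY /fphi /fth invr1 !expr1n !mulr1.
apply/eqP; rewrite -subr_eq0; apply/eqP; set X := (X in X = 0).
have H : (k ^+ 2 - 1) = 0 by rewrite k2 subrr.
transitivity (- (k ^+ 2 - 1) * (rc / (4 * ii) * (rc / 2)) *
  ((z * e^*%C - z^*%C * e) * (p / n + n / p))).
  by rewrite /X; field; rewrite ii0 n0 p0.
by rewrite H oppr0 !mul0r.
Qed.

(** The derivative of [hL] at [l = 1] in the direction [e]. *)
Definition dhL z e : 'cV[C]_4 :=
  let f := fphi r p z 1 in let t := fth r n z in
  let f' := fphi r p e 1 in let t' := fth r n e in
  let y1 := fY r p n 1 e 1 in let y2 := fY r p n (-1) e 1 in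
  qv (- (y1 * csin (f - t) + y2 * csin (f + t)))
     (y1 * ccos (f - t) + y2 * ccos (f + t))
     (- (f' * ccos f * csin t + t' * csin f * ccos t))
     (- (f' * csin f * csin t) + t' * ccos f * ccos t).

Lemma is_pderv_hL z e t :
  is_pderv (fun s => hL r p n (z + toC s * e) 1) t (dhL (z + toC t * e) e).
Proof.
pose f := fphi r p z 1; pose th := fth r n z.
pose f' := fphi r p e 1; pose th' := fth r n e.
pose y1 := fY r p n 1 z 1; pose y2 := fY r p n (-1) z 1.
pose y1' := fY r p n 1 e 1; pose y2' := fY r p n (-1) e 1.
have HE : (fun s => hL r p n (z + toC s * e) 1) = (fun s =>
  qv (-1 * ((y1 + toC s * y1') * cosc ((f - th) + toC s * (f' - th')) +
        (y2 + toC s * y2') * cosc ((f + th) + toC s * (f' + th'))))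
     ((y1 + toC s * y1') * sinc ((f - th) + toC s * (f' - th')) +
        (y2 + toC s * y2') * sinc ((f + th) + toC s * (f' + th')))
     (-1 * (csin (f + toC s * f') * csin (th + toC s * th')))
     (ccos (f + toC s * f') * csin (th + toC s * th'))).
  apply/funext => s; rewrite /hL fphi_aff fth_aff !fY_aff /=.
  have -> : f - th + toC s * (f' - th') = f + toC s * f' - (th + toC s * th') by ring.
  have -> : f + th + toC s * (f' + th') = f + toC s * f' + (th + toC s * th') by ring.
  by rewrite !mulN1r.
rewrite HE /dhL fphi_aff fth_aff /= -/f -/th -/f' -/th' -/y1' -/y2'.
have E1 : y1 * (f' - th') = (f - th) * y1'.
  by have := fY_prop z e (expr1n _ 2); rewrite !mul1r.
have E2 : y2 * (f' + th') = (f + th) * y2'.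
  have := @fY_prop (-1) z e; rewrite sqrrN expr1n => /(_ erefl).
  by rewrite !mulN1r !opprK.
have X1 : f + toC t * f' - (th + toC t * th') = f - th + toC t * (f' - th') by ring.
have X2 : f + toC t * f' + (th + toC t * th') = f + th + toC t * (f' + th') by ring.
rewrite X1 X2.
have Df := is_pder_aff f f' t; have Dt := is_pder_aff th th' t.
have Dsf := is_pder_comp (is_cderive_csin _) Df.
have Dcf := is_pder_comp (is_cderive_ccos _) Df.
have Dst := is_pder_comp (is_cderive_csin _) Dt.
apply: is_pderv_qv.
- apply: is_pder_eq (is_pderZ (-1) (is_pderD (is_pder_aff_cosc t E1) (is_pder_aff_cosc t E2))) _.
  by rewrite mulN1r.
- exact: is_pderD (is_pder_aff_sinc t E1) (is_pder_aff_sinc t E2).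
- apply: is_pder_eq (is_pderZ (-1) (is_pderM Dsf Dst)) _.
  by ring.
- apply: is_pder_eq (is_pderM Dcf Dst) _.
  by ring.
Qed.

(** At [l = 1] the frame integrates [e^{i phi} (dx + j dy) (cos th + J sin th) P]. *)
Lemma dhL_fa z e : qmul (dhL z e) (fa r n 1) =
  qmul (ei (fphi r p z 1)) (qmul (dirq e) (mE z)).
Proof.
rewrite /dhL /mE /dirq /ei /fa /=.
set f := fphi r p z 1; set t := fth r n z.
rewrite !ccosD !csinD !ccosN !csinN.
rewrite /fphi /fth /fY /fsx /fcx invr1 !expr1n !mulr1.
have iV : (2 * ii)^-1 = - ii / 2 by rewrite invfM iiV mulrC.
have iV4 : (4 * ii)^-1 = - ii / 4 by rewrite invfM iiV mulrC.
have i2 : ii ^+ 2 = - 1 by rewrite expr2 iiM.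
move: (ccos f) (csin f) (ccos t) (csin t) => cf sf cth sth.
rewrite iV iV4 !qv_mul.
apply: qv_eq; field: i2; by rewrite ?rc0 ?n0 ?p0.
Qed.

End OneMode.
End ModesDerivative.

(** * Finite sums of modes are of finite type *)

Section PlaneLines.
Variable R : realType.
Local Notation C := R[i].
Local Notation Re := (@complex.Re R).
Local Notation Im := (@complex.Im R).
Local Notation ii := ('i%C : C).
Implicit Types (u : C -> R) (z : C).

Lemma is_derive_shift1 (f : R -> R) (t d : R) :
  is_derive (0 : R) 1 (fun s => f (t + s)) d -> is_derive t 1 f d.
Proof.
move=> H.
have -> : f = (fun s => f (t + s)) \o (fun s => s - t).
  by apply/funext => s /=; rewrite addrC subrK.
rewrite -[d]mulr1; apply: is_derive1_comp; first by rewrite subrr.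
exact: is_derive_shift.
Qed.

Lemma line_xD u z (s t : R) : line_x u (z + toC s) t = line_x u z (s + t).
Proof. by rewrite /line_x toCD addrA. Qed.

Lemma line_yD u z (s t : R) : line_y u (z + ii * toC s) t = line_y u z (s + t).
Proof. by rewrite /line_y toCD mulrDr addrA. Qed.

Lemma is_derive_line_x u z t d :
  is_derive (0 : R) 1 (line_x u (z + toC t)) d -> is_derive t 1 (line_x u z) d.
Proof.
move=> H; apply: is_derive_shift1.
suff -> : (fun s => line_x u z (t + s)) = line_x u (z + toC t) by [].
by apply/funext => s; rewrite line_xD.
Qed.

Lemma is_derive_line_y u z t d :
  is_derive (0 : R) 1 (line_y u (z + ii * toC t)) d -> is_derive t 1 (line_y u z) d.
Proof.
move=> H; apply: is_derive_shift1.
suff -> : (fun s => line_y u z (t + s)) = line_y u (z + ii * toC t) by [].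
by apply/funext => s; rewrite line_yD.
Qed.

Lemma plane_cst u : (forall z, is_derive (0 : R) 1 (line_x u z) 0) ->
  (forall z, is_derive (0 : R) 1 (line_y u z) 0) -> forall z w, u z = u w.
Proof.
move=> hx hy.
have X z (s : R) : u (z + toC s) = u z.
  have /(_ s 0) := @is_derive_0_is_cst R (line_x u z) _ _
    (fun t => is_derive_line_x (hx (z + toC t))).
  by rewrite /line_x /= => ->; congr u; apply: eq_ReIm; rewrite ?ReD ?ImD /= addr0.
have Y z (s : R) : u (z + ii * toC s) = u z.
  have /(_ s 0) := @is_derive_0_is_cst R (line_y u z) _ _
    (fun t => is_derive_line_y (hy (z + ii * toC t))).
  rewrite /line_y /= => ->; congr u; apply: eq_ReIm;
    by rewrite ?ReD ?ImD ?Re_mul ?Im_mul /= !(mul0r, mul1r, mulr0) ?subr0 !addr0.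
move=> z w.
rewrite -[u w](X w (Re (z - w))) -[u (w + _)](Y _ (Im (z - w))); congr u.
apply: eq_ReIm; rewrite !(ReD, ImD, Re_mul, Im_mul, ReN, ImN) /=.
  by rewrite !(mul0r, mul1r, mulr0) subr0 addr0; ring.
by rewrite !(mul0r, mul1r, mulr0); ring.
Qed.

Lemma smooth_plane_derive_x u z : smooth_plane u ->
  is_derive (0 : R) 1 (line_x u z) (partial_x u z).
Proof.
move=> /(_ [::]) /= [_ /(_ z) [H _]]; rewrite /partial_x derive1E.
exact: derivableP.
Qed.

Lemma smooth_plane_derive_y u z : smooth_plane u ->
  is_derive (0 : R) 1 (line_y u z) (partial_y u z).
Proof.
move=> /(_ [::]) /= [_ /(_ z) [_ H]]; rewrite /partial_y derive1E.
exact: derivableP.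
Qed.

End PlaneLines.

Section TheoremB.
Variable R : realType.
Local Notation C := R[i].
Local Notation Re := (@complex.Re R).
Local Notation Im := (@complex.Im R).
Local Notation ii := ('i%C : C).

Variables (N : nat) (r : R) (p : C) (n : 'I_N -> C) (P : 'I_N -> 'cV[R]_4).
Hypotheses (r0 : 0 < r) (p1 : `|p| = 1) (n1 : forall k, `|n k| = 1).
Local Notation Pc k := (map_mx toC (P k)).

Definition modeW z : 'cV[C]_4 := \sum_k qmul (mE r p (n k) z) (Pc k).

Lemma is_pderv_HT z e t :
  is_pderv (fun s => HT r p n P (z + toC s * e) 1) t
    (qmul (ei (fphi r p (z + toC t * e) 1)) (qmul (dirq e) (modeW (z + toC t * e)))).
Proof.
move=> i.
have -> : (fun s => HT r p n P (z + toC s * e) 1 i 0) =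
  (fun s => \sum_k qmul (qmul (hL r p (n k) (z + toC s * e) 1) (fa r (n k) 1)) (Pc k) i 0).
  by apply/funext => s; rewrite /HT summxE.
have H k := is_pderv_qmul (Pc k) (is_pderv_qmul (fa r (n k) 1)
   (is_pderv_hL r p1 (n1 k) z e t)) i.
apply: is_pder_eq (is_pder_sum H) _.
rewrite /modeW !qmul_sumr summxE; apply: eq_bigr => k _.
by rewrite dhL_fa// -!qmulA.
Qed.

Variables (Gamma : set C) (X : torus Gamma -> 'cV[R]_4) (z0 : C) (b : R).
Local Notation U := (universal_cover_map X).
Hypothesis (sU : forall i, smooth_plane (fun z => U z i 0)).
Hypothesis (Ux : forall z, map_mx toC (rotq (cos b) (- sin b) *m vpartial_x U z) =
   qmul (ei (fphi r p (z - z0) 1)) (modeW (z - z0))).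
Hypothesis (Uy : forall z, map_mx toC (rotq (cos b) (- sin b) *m vpartial_y U z) =
   qmul (ei (fphi r p (z - z0) 1)) (qmul qj (modeW (z - z0)))).

Let A := rotq (cos b) (sin b).
Let Y z : 'cV[R]_4 := map_mx Re (HT r p n P (z - z0) 1).

Lemma rotq_cancel (v : 'cV[R]_4) : A *m (rotq (cos b) (- sin b) *m v) = v.
Proof.
rewrite mulmxA rotqM mulrN opprK -!expr2 cos2Dsin2.
have -> : sin b * cos b + cos b * - sin b = 0 by ring.
by rewrite rotq10 mul1mx.
Qed.

Lemma AY_derive (l : R -> C) z (e : C) (v : 'cV[R]_4) i :
  (forall s, l s = z + toC s * e) ->
  map_mx toC (rotq (cos b) (- sin b) *m v) =
    qmul (ei (fphi r p (z - z0) 1)) (qmul (dirq e) (modeW (z - z0))) ->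
  is_derive (0 : R) 1 (fun s => (A *m Y (l s)) i 0) (v i 0).
Proof.
move=> lE vE.
have D j : is_derive (0 : R) 1 (fun s => Y (l s) j 0) ((rotq (cos b) (- sin b) *m v) j 0).
  have [+ _] := is_pderv_HT (z - z0) e 0 j.
  rewrite mul0r addr0 -vE [X in Re X]mxE.
  suff -> : (fun s => Y (l s) j 0) =
    (fun s => Re (HT r p n P (z - z0 + toC s * e) 1 j 0)) by [].
  by apply/funext => s; rewrite /Y mxE lE addrAC.
rewrite -(rotq_cancel v) [X in is_derive _ _ _ X]mxE sum4.
have -> : (fun s => (A *m Y (l s)) i 0) = A i 0 *: (fun s => Y (l s) 0 0) +
  A i 1 *: (fun s => Y (l s) 1 0) + A i 2 *: (fun s => Y (l s) 2 0) +
  A i 3 *: (fun s => Y (l s) 3 0).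
  by apply/funext => s; rewrite mxE sum4.
exact: (is_deriveD (is_deriveD (is_deriveD (is_deriveZ (A i 0) (D 0))
  (is_deriveZ (A i 1) (D 1))) (is_deriveZ (A i 2) (D 2))) (is_deriveZ (A i 3) (D 3))).
Qed.

(** Both sides of the required equality have the same partial derivatives: those of
    [X] by assumption, those of the translation part of the frame at [lambda = 1]
    by [dhL_fa].  The rotation by [b] and the constant of integration make up the
    element of the group. *)
Lemma modes_finite_type : finite_type z0 X.
Proof.
pose T := U z0 - A *m Y z0.
exists (4 * N + 2)%N, (etam r p n P), Y, (amR b T); split.
- by exists N.
- exact: Lambdag_deg_etam.
- exact: modes_obtained.
- exact: Gaff_amR.
move=> z; apply/matrixP => i j; rewrite ord1 {j}.
rewrite /aff_act /amR /aff block_mxKul block_mxKur -/A.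
pose D w := U w i 0 - (A *m Y w) i 0.
suff E : D z = D z0.
  rewrite addqE /T addqE oppqE; move: E; rewrite /D => /eqP.
  by rewrite subr_eq => /eqP ->; rewrite addrC.
apply: plane_cst => {}z.
- have -> : line_x D z = line_x (fun w => U w i 0) z - (fun s => (A *m Y (z + toC s)) i 0).
    by apply/funext.
  have Hd := @AY_derive (fun s => z + toC s) z 1 (vpartial_x U z) i.
  have H1 : map_mx toC (rotq (cos b) (- sin b) *m vpartial_x U z) =
    qmul (ei (fphi r p (z - z0) 1)) (qmul (dirq 1) (modeW (z - z0))).
    rewrite Ux; congr qmul.
    have -> : dirq (1 : C) = qv 1 0 0 0.
      rewrite /dirq conjc1 subrr mul0r; congr (qv _ 0 0 0).
      by rewrite -[1 + 1]/(2 : C) mulfV ?two_neq0.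
    by rewrite qmul1l.
  have {}Hd := Hd (fun s => esym (congr1 _ (mulr1 (toC s)))) H1.
  have Hu := smooth_plane_derive_x z (sU i).
  apply: (is_derive_eq (is_deriveB Hu Hd)).
  by rewrite mxE subrr.
- have -> : line_y D z = line_y (fun w => U w i 0) z - (fun s => (A *m Y (z + ii * toC s)) i 0).
    by apply/funext.
  have Hd := @AY_derive (fun s => z + ii * toC s) z ii (vpartial_y U z) i.
  have H1 : map_mx toC (rotq (cos b) (- sin b) *m vpartial_y U z) =
    qmul (ei (fphi r p (z - z0) 1)) (qmul (dirq ii) (modeW (z - z0))).
    rewrite Uy; congr qmul; congr qmul.
    have -> : dirq ii = qv 0 0 1 0.
      rewrite /dirq conjc_ii subrr mul0r opprK; congr (qv 0 0 _ 0).
      by rewrite -mulr2n -[ii *+ 2]mulr_natl mulfV ?mulf_neq0 ?two_neq0 ?ii_neq0.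
    by rewrite qjE.
  have {}Hd := Hd (fun s => congr1 _ (mulrC ii (toC s))) H1.
  have Hu := smooth_plane_derive_y z (sU i).
  apply: (is_derive_eq (is_deriveB Hu Hd)).
  by rewrite mxE subrr.
Qed.

End TheoremB.

(** * Fourier coefficients of doubly periodic functions *)

Section Towers.
Variable R : realType.
Local Notation C := R[i].
Local Notation Re := (@complex.Re R).
Local Notation Im := (@complex.Im R).
Local Notation normc := (@Normc.normc R).
Local Notation ii := ('i%C : C).
Implicit Types (z w : C) (s : seq bool) (t h : R).

Lemma is_pder_shift (u : R -> C) t (d : C) :
  is_pder (fun h => u (t + h)) 0 d -> is_pder u t d.
Proof.
by move=> [a b]; split; [exact: (is_derive_shift1 (f := fun h => Re (u h)))|
  exact: (is_derive_shift1 (f := fun h => Im (u h)))].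
Qed.

Lemma is_pder_quad (u : R -> C) t (l : C) (K : R) :
  (forall h, `|h| <= 1 -> normc (u (t + h) - u t - toC h * l) <= K * h ^+ 2) ->
  is_pder u t l.
Proof.
move=> H; split; apply: (@is_derive_quad _ _ _ _ K) => h /H;
  apply: le_trans; [apply: le_trans (Re_le_normc _)|apply: le_trans (Im_le_normc _)].
- by rewrite !(ReD, ReN, Re_mul) /= mul0r subr0.
- by rewrite !(ImD, ImN, Im_mul) /= mul0r addr0.
Qed.

Lemma ctaylor2 (u u1 u2 : R -> C) (K : R) t h :
  (forall x, is_pder u x (u1 x)) -> (forall x, is_pder u1 x (u2 x)) ->
  (forall x, normc (u2 x) <= K) ->
  normc (u (t + h) - u t - toC h * u1 t) <= 2 * K * h ^+ 2.
Proof.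
move=> D1 D2 H; apply: le_trans (normc_le _) _.
have -> : 2 * K * h ^+ 2 = K * h ^+ 2 + K * h ^+ 2 by ring.
apply: lerD.
  rewrite !(ReD, ReN, Re_mul) /= mul0r subr0.
  apply: (taylor2 (f := fun x => Re (u x)) (f1 := fun x => Re (u1 x))
    (f2 := fun x => Re (u2 x))).
  - by move=> x; case: (D1 x).
  - by move=> x; case: (D2 x).
  - by move=> x _; apply: le_trans (H x); exact: Re_le_normc.
rewrite !(ImD, ImN, Im_mul) /= mul0r addr0.
apply: (taylor2 (f := fun x => Im (u x)) (f1 := fun x => Im (u1 x))
  (f2 := fun x => Im (u2 x))).
- by move=> x; case: (D1 x).
- by move=> x; case: (D2 x).
- by move=> x _; apply: le_trans (H x); exact: Im_le_normc.
Qed.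

Lemma cmvt (u u1 : R -> C) (K : R) t h :
  (forall x, is_pder u x (u1 x)) -> (forall x, normc (u1 x) <= K) ->
  normc (u (t + h) - u t) <= 2 * K * `|h|.
Proof.
move=> D1 H; apply: le_trans (normc_le _) _.
have -> : 2 * K * `|h| = K * `|h| + K * `|h| by ring.
apply: lerD.
  rewrite !(ReD, ReN) /=.
  have [c _] := mvt t (t + h) (f := fun x => Re (u x)) (df := fun x => Re (u1 x))
    (fun x => (D1 x).1).
  rewrite addrAC subrr add0r => ->; rewrite normrM ler_wpM2r//.
  by apply: le_trans (H c); exact: Re_le_normc.
rewrite !(ImD, ImN) /=.
have [c _] := mvt t (t + h) (f := fun x => Im (u x)) (df := fun x => Im (u1 x))
  (fun x => (D1 x).2).
rewrite addrAC subrr add0r => ->; rewrite normrM ler_wpM2r//.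
by apply: le_trans (H c); exact: Im_le_normc.
Qed.

Lemma is_pder0_cst (u : R -> C) : (forall t, is_pder u t 0) -> forall t h, u t = u h.
Proof.
move=> H t h; apply: eq_ReIm.
  by apply: (is_derive_0_is_cst (f := fun x => Re (u x))) => x; case: (H x).
by apply: (is_derive_0_is_cst (f := fun x => Im (u x))) => x; case: (H x).
Qed.

Variables (w1 w2 : C).

(** A doubly periodic function with all its iterated derivatives, one for each
    word, and bounds for them.  Bundling the derivatives makes the class closed
    under Fourier coefficients, the bounds on second derivatives controlling the
    errors under the integral sign. *)
Definition tower (U : seq bool -> C -> C) : Prop :=
  [/\ forall s z, is_pder (fun t => U s (z + toC t)) 0 (U (true :: s) z),
      forall s z, is_pder (fun t => U s (z + ii * toC t)) 0 (U (false :: s) z),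
      forall s, exists K, forall z, normc (U s z) <= K &
      forall s z, U s (z + w1) = U s z /\ U s (z + w2) = U s z].

Section OneTower.
Variable U : seq bool -> C -> C.
Hypothesis TU : tower U.

Lemma tower_x s z t : is_pder (fun t => U s (z + toC t)) t (U (true :: s) (z + toC t)).
Proof.
apply: is_pder_shift; have [H _ _ _] := TU.
suff -> : (fun h => U s (z + toC (t + h))) = (fun h => U s (z + toC t + toC h)) by [].
by apply/funext => h; rewrite toCD addrA.
Qed.

Lemma tower_y s z t :
  is_pder (fun t => U s (z + ii * toC t)) t (U (false :: s) (z + ii * toC t)).
Proof.
apply: is_pder_shift; have [_ H _ _] := TU.
suff -> : (fun h => U s (z + ii * toC (t + h))) =
  (fun h => U s (z + ii * toC t + ii * toC h)) by [].
by apply/funext => h; rewrite toCD mulrDr addrA.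
Qed.

Lemma tower_bound s : exists2 K, 0 <= K & forall z, normc (U s z) <= K.
Proof.
have [_ _ H _] := TU; have [K HK] := H s.
by exists K => //; apply: le_trans (HK 0); exact: normc_ge0.
Qed.

Definition Ddir (w : C) s z : C := toC (Re w) * U (true :: s) z + toC (Im w) * U (false :: s) z.

(** Taylor's formula along one axis and then along the other; the mixed second
    derivative accounts for the change of base point. *)
Lemma tower_dir w s z t :
  is_pder (fun t => U s (z + toC t * w)) t (Ddir w s (z + toC t * w)).
Proof.
apply: is_pder_shift.
have -> : (fun h => U s (z + toC (t + h) * w)) =
  (fun h => U s (z + toC t * w + toC h * w)).
  by apply/funext => h; rewrite toCD mulrDl addrA.
move: (z + toC t * w) => {}z.
have [K1 K10 B1] := tower_bound (true :: true :: s).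
have [K2 K20 B2] := tower_bound (true :: false :: s).
have [K3 K30 B3] := tower_bound (false :: false :: s).
set a := Re w; set b := Im w.
apply: (@is_pder_quad _ _ _ (2 * K1 * a ^+ 2 + 2 * K2 * `|a| * `|b| + 2 * K3 * b ^+ 2)) => h _.
rewrite add0r (_ : toC 0 * w = 0) ?mul0r// addr0 /Ddir -/a -/b.
pose z' := z + toC (h * a).
have -> : z + toC h * w = z' + ii * toC (h * b).
  rewrite /z' !toCM {1}[w]complexE -/a -/b mulrDr addrA; congr (_ + _).
  by rewrite mulrCA.
have X1 := @ctaylor2 _ _ _ K1 0 (h * a) (tower_x s z) (tower_x (true :: s) z)
  (fun x => B1 _).
have X2 := @cmvt _ _ K2 0 (h * a) (tower_x (false :: s) z) (fun x => B2 _).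
have X3 := @ctaylor2 _ _ _ K3 0 (h * b) (tower_y s z') (tower_y (false :: s) z')
  (fun x => B3 _).
rewrite add0r (_ : z + toC 0 = z) ?addr0// -/z' in X1 X2.
rewrite add0r (_ : z' + ii * toC 0 = z') ?mulr0 ?addr0// in X3.
have -> : U s (z' + ii * toC (h * b)) - U s z -
   toC h * (toC a * U (true :: s) z + toC b * U (false :: s) z) =
   (U s (z' + ii * toC (h * b)) - U s z' - toC (h * b) * U (false :: s) z') +
   (toC (h * b) * (U (false :: s) z' - U (false :: s) z) +
   (U s z' - U s z - toC (h * a) * U (true :: s) z)).
  by rewrite !toCM; ring.
apply: le_trans (normcD _ _) _.
apply: le_trans (lerD X3 (normcD _ _)) _.
rewrite Normc.normcM normc_toC.
have X2' : `|h * b| * normc (U (false :: s) z' - U (false :: s) z) <=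
   `|h * b| * (2 * K2 * `|h * a|) by apply: ler_wpM2l.
apply: le_trans (lerD (lexx _) (lerD X2' X1)) _.
rewrite !normrM -(real_normK (num_real h)).
set n := `|h|; rewrite !exprMn -(real_normK (num_real h)) -/n.
rewrite le_eqVlt; apply/orP; left; apply/eqP; ring.
Qed.

Lemma ccont_dir w s z : ccont (fun t => U s (z + toC t * w)).
Proof. exact: pder_ccont (tower_dir w s z). Qed.

End OneTower.

(** [e^{- 2 pi i m t}]. *)
Definition echar (m : int) t : C := cexp (toC t * (ii * toC (- (m%:~R * (pi *+ 2))))).

Lemma echar0 m : echar m 0 = 1.
Proof. by rewrite /echar mul0r cexp0. Qed.

Lemma cos2pin (k : nat) : cos (k%:R * (pi *+ 2) : R) = 1 /\ sin (k%:R * (pi *+ 2) : R) = 0.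
Proof.
have := @periodicn R _ _ _ (@cosD2pi R) k 0; have := @periodicn R _ _ _ (@sinD2pi R) k 0.
by rewrite !add0r cos0 sin0 mulr_natl => -> ->.
Qed.

Lemma echar1 m : echar m 1 = 1.
Proof.
rewrite /echar mul1r /cexp !(Re_mul, Im_mul) /= !(mul0r, mul1r, mulr0, subr0, add0r, addr0).
rewrite ?oppr0 expR0 ?mul1r cosN sinN.
have [E1 E2] : cos (m%:~R * (pi *+ 2) : R) = 1 /\ sin (m%:~R * (pi *+ 2) : R) = 0.
  case: m => k; first exact: cos2pin.
  by rewrite NegzE mulrNz mulNr cosN sinN; have [-> ->] := cos2pin k.+1; rewrite oppr0.
by rewrite E1 E2 oppr0; apply: eq_ReIm.
Qed.

Lemma is_pder_echar m t :
  is_pder (echar m) t ((ii * toC (- (m%:~R * (pi *+ 2)))) * echar m t).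
Proof. exact: is_pder_cexp_ray. Qed.

Lemma ccont_echar m : ccont (echar m).
Proof. exact: pder_ccont (is_pder_echar m). Qed.

Lemma normc_echar m t : normc (echar m t) = 1.
Proof.
rewrite normc_cexp !(Re_mul, Im_mul) /=.
by rewrite !(mul0r, mul1r, mulr0, subr0, add0r, addr0, oppr0) expR0.
Qed.

(** The Fourier coefficient of index [m] along the segment from [z] to [z + w], as a
    function of [z]. *)
Definition fcoef (w : C) (m : int) (u : C -> C) z : C :=
  Cint (fun t => u (z + toC t * w) * echar m t).

Section FcTower.
Variables (w : C) (m : int).

Lemma fcoef_ccont U s z : tower U -> ccont (fun t => U s (z + toC t * w) * echar m t).
Proof. by move=> TU; apply: ccontM (ccont_dir TU w s z) (ccont_echar m). Qed.

Lemma fcoef_line U s s' e z (E : C) (K : R) : tower U -> normc e = 1 ->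
  (forall z h, normc (U s (z + toC h * e) - U s z - toC h * U s' z) <= K * h ^+ 2) ->
  is_pder (fun t => fcoef w m (U s) (z + toC t * e)) 0 (fcoef w m (U s') z).
Proof.
move=> TU e1 HK; apply: (@is_pder_quad _ _ _ (2 * K)) => h _.
rewrite add0r (_ : toC 0 * e = 0) ?mul0r// addr0 /fcoef.
have c1 := fcoef_ccont s (z + toC h * e) TU; have c2 := fcoef_ccont s z TU.
have c3 := fcoef_ccont s' z TU.
have c12 : ccont (fun t => U s (z + toC h * e + toC t * w) * echar m t -
    U s (z + toC t * w) * echar m t).
  have -> : (fun t => U s (z + toC h * e + toC t * w) * echar m t -
      U s (z + toC t * w) * echar m t) = (fun t => U s (z + toC h * e + toC t * w) * echar m t +
     (-1) * (U s (z + toC t * w) * echar m t)) by apply/funext => t; rewrite mulN1r.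
  by apply: ccontD => //; apply: ccontM => //; exact: ccont_cst.
have c4 : ccont (fun t => toC h * (U s' (z + toC t * w) * echar m t)).
  by apply: ccontM => //; exact: ccont_cst.
rewrite -CintZ// -CintB// -CintB// -mulrA.
apply: Cint_bound => [|t _].
  have -> : (fun t => U s (z + toC h * e + toC t * w) * echar m t -
    U s (z + toC t * w) * echar m t - toC h * (U s' (z + toC t * w) * echar m t)) =
    (fun t => (U s (z + toC h * e + toC t * w) * echar m t -
    U s (z + toC t * w) * echar m t) + (-1) * (toC h * (U s' (z + toC t * w) * echar m t))).
    by apply/funext => t; rewrite mulN1r.
  by apply: ccontD => //; apply: ccontM => //; exact: ccont_cst.
have -> : U s (z + toC h * e + toC t * w) * echar m t - U s (z + toC t * w) * echar m t -
   toC h * (U s' (z + toC t * w) * echar m t) =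
   (U s (z + toC t * w + toC h * e) - U s (z + toC t * w) - toC h * U s' (z + toC t * w))
    * echar m t by rewrite [z + toC h * e + _]addrAC; ring.
by rewrite Normc.normcM normc_echar mulr1.
Qed.

Lemma tower_fcoef U : tower U -> tower (fun s => fcoef w m (U s)).
Proof.
move=> TU; split.
- move=> s z; have [K1 K10 B1] := tower_bound TU (true :: true :: s).
  have := @fcoef_line U s (true :: s) 1 z 0 (2 * K1) TU (Normc.normc1 R).
  have -> : (fun t => fcoef w m (U s) (z + toC t * 1)) = (fun t => fcoef w m (U s) (z + toC t)).
    by apply/funext => t; rewrite mulr1.
  apply=> z' h; have X1 := @ctaylor2 _ _ _ K1 0 h (tower_x TU s z') (tower_x TU (true :: s) z')
    (fun x => B1 _).
  by move: X1; rewrite add0r (_ : z' + toC 0 = z') ?addr0// mulr1.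
- move=> s z; have [K1 K10 B1] := tower_bound TU (false :: false :: s).
  have i1 : normc ii = 1 by rewrite -[ii]mulr1 normcI Normc.normc1.
  have := @fcoef_line U s (false :: s) ii z 0 (2 * K1) TU i1.
  have -> : (fun t => fcoef w m (U s) (z + toC t * ii)) = (fun t => fcoef w m (U s) (z + ii * toC t)).
    by apply/funext => t; rewrite mulrC.
  apply=> z' h; have X1 := @ctaylor2 _ _ _ K1 0 h (tower_y TU s z') (tower_y TU (false :: s) z')
    (fun x => B1 _).
  by move: X1; rewrite add0r (_ : z' + ii * toC 0 = z') ?mulr0 ?addr0// [ii * toC h]mulrC.
- move=> s; have [K K0 B] := tower_bound TU s; exists (2 * K) => z.
  apply: Cint_bound => [|t _]; first exact: fcoef_ccont.
  by rewrite Normc.normcM normc_echar mulr1.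
- move=> s z; have [_ _ _ H] := TU; split; apply: eq_Cint => t _;
    by have [Ha Hb] := H s (z + toC t * w); rewrite addrAC ?Ha ?Hb.
Qed.

(** Integration by parts; the boundary terms cancel by periodicity. *)
Lemma fcoef_dir U s z : tower U -> (forall s z, U s (z + w) = U s z) ->
  Ddir (fun s => fcoef w m (U s)) w s z =
  ii * toC (m%:~R * (pi *+ 2)) * fcoef w m (U s) z.
Proof.
move=> TU per; pose k : C := ii * toC (- (m%:~R * (pi *+ 2))).
have -> : Ddir (fun s => fcoef w m (U s)) w s z =
    Cint (fun t => Ddir U w s (z + toC t * w) * echar m t).
  have c1 := fcoef_ccont (true :: s) z TU; have c2 := fcoef_ccont (false :: s) z TU.
  rewrite /Ddir /fcoef -!CintZ// -CintD; last 2 first.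
  - by apply: ccontM => //; exact: ccont_cst.
  - by apply: ccontM => //; exact: ccont_cst.
  by apply: eq_Cint => t _; ring.
have c1 := fcoef_ccont s z TU.
have c2 : ccont (fun t => k * (U s (z + toC t * w) * echar m t)).
  by apply: ccontM => //; exact: ccont_cst.
have c3 : ccont (fun t => Ddir U w s (z + toC t * w) * echar m t).
  apply: ccontM; last exact: ccont_echar.
  by apply: ccontD; apply: ccontM; try exact: ccont_cst; exact: ccont_dir.
have H : Cint (fun t => Ddir U w s (z + toC t * w) * echar m t +
    k * (U s (z + toC t * w) * echar m t)) = 0.
  rewrite (@Cint_FTC _ (fun t => U s (z + toC t * w) * echar m t)).
  - rewrite echar1 echar0 !mulr1 (_ : toC 1 * w = w) ?mul1r// per.
    by rewrite (_ : toC 0 * w = 0) ?mul0r// addr0 subrr.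
  - move=> t; apply: is_pder_eq (is_pderM (tower_dir TU w s z t) (is_pder_echar m t)) _.
    by rewrite -/k; ring.
  - exact: ccontD.
rewrite CintD// CintZ// in H.
have -> : ii * toC (m%:~R * (pi *+ 2)) = - k by rewrite /k toCN mulrN opprK.
by apply/eqP; rewrite mulNr -addr_eq0; apply/eqP.
Qed.

End FcTower.

End Towers.

(** * Completeness of the Fourier coefficients *)

Section Completeness.
Variable R : realType.
Local Notation C := R[i].
Local Notation Re := (@complex.Re R).
Local Notation Im := (@complex.Im R).
Local Notation normc := (@Normc.normc R).
Local Notation ii := ('i%C : C).
Implicit Types (t : R) (m : int).

Lemma bernoulli_ineq (e : R) (k : nat) : 0 <= e -> 1 + k%:R * e <= (1 + e) ^+ k.
Proof.
move=> e0; elim: k => [|k IH]; first by rewrite mul0r addr0 expr0.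
rewrite exprS; apply: (@le_trans _ _ ((1 + e) * (1 + k%:R * e))).
  rewrite -natr1; have : 0 <= k%:R * e by rewrite mulr_ge0.
  by nra.
by rewrite ler_wpM2l// addr_ge0.
Qed.

(** For small [r], a trigonometric polynomial that exceeds 1 on [[0, 1]] exactly
    at distance less than [r] from [1 / 2]. *)
Definition peak (r : R) t : R := 1 - cos (r * (pi *+ 2)) - cos (t * (pi *+ 2)).

Lemma cos_centered t : - cos (t * (pi *+ 2)) = cos (`|t - 2^-1| * (pi *+ 2)).
Proof.
have -> : `|t - 2^-1| * (pi *+ 2) = `|(t - 2^-1) * (pi *+ 2)|.
  by rewrite normrM [`|pi *+ 2|]ger0_norm// mulrn_wge0// pi_ge0.
rewrite cos_norm mulrBl.
have -> : 2^-1 * (pi *+ 2) = pi :> R by rewrite -[pi *+ 2]mulr_natl mulKf.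
by rewrite cosB cospi sinpi; ring.
Qed.

Lemma cos_le_mono (x y : R) : 0 <= x -> x <= y -> y <= 2^-1 ->
  cos (y * (pi *+ 2)) <= cos (x * (pi *+ 2)).
Proof.
move=> x0 xy y1.
have p2 : 0 < pi *+ 2 :> R by rewrite pmulrn_lgt0// pi_gt0.
have E : 2^-1 * (pi *+ 2) = pi :> R by rewrite -[pi *+ 2]mulr_natl mulKf.
have y0 : 0 <= y by exact: le_trans xy.
set P := pi *+ 2 in p2 E *.
have hx : x * (pi *+ 2) \in `[0, pi].
  rewrite in_itv /=; apply/andP; split; first by apply: mulr_ge0; lra.
  by rewrite -[X in _ <= X]E ler_wpM2r ?(ltW p2)// (le_trans xy).
have hy : y * (pi *+ 2) \in `[0, pi].
  rewrite in_itv /=; apply/andP; split; first by apply: mulr_ge0; lra.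
  by rewrite -[X in _ <= X]E ler_wpM2r ?(ltW p2).
move: xy; rewrite le_eqVlt => /orP[/eqP -> //|xy].
by apply: ltW; rewrite ltr_cos// ltr_pM2r.
Qed.

(** Otherwise the powers of [peak] would concentrate near [1 / 2]: the integral
    grows geometrically there, where [f] is positive, and stays bounded elsewhere,
    so it cannot vanish for all [k]. *)
Lemma peak_positivity (f : R -> R) : continuous f ->
  (forall r k, 0 < r -> r <= 4^-1 -> I01 (fun t => f t * peak r t ^+ k) = 0) ->
  f 2^-1 <= 0.
Proof.
move=> cf H; rewrite leNgt; apply/negP => f0.
pose d := f 2^-1 / 2.
have d0 : 0 < d by rewrite divr_gt0.
have [rho rho0 Hrho] : exists2 rho, 0 < rho & forall t, `|t - 2^-1| < rho -> d <= f t.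
  have /cvgrPdist_lt /(_ d d0) [rho /= rho0 Hr] := cf 2^-1.
  exists rho => // t ht; have := Hr t; rewrite /ball_ /= distrC => /(_ ht).
  rewrite ltr_norml => /andP[_]; have : f 2^-1 = d + d by rewrite /d -splitr.
  by move=> ->; lra.
(* r <= 1/4 keeps cos (2 pi r) nonnegative, so that |peak| <= 1 far from 1/2. *)
pose r := Num.min (rho / 2) 4^-1.
have r0 : 0 < r by rewrite lt_min divr_gt0//= invr_gt0.
have r4 : r <= 4^-1 by rewrite /r ge_min lexx orbT.
have rrho : r < rho by rewrite /r gt_min; apply/orP; left; lra.
have [K K0 HK] : exists2 K, 0 <= K & forall t, 0 <= t <= 1 -> `|f t| <= K.
  have cn : {within `[0, 1], continuous (fun t => `|f t|)}.
    apply: continuous_subspaceT => t; apply: (continuous_comp (cf t)).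
    exact: norm_continuous.
  have [c _ Hc] := EVT_max ler01 cn.
  by exists `|f c| => // t ht; apply: Hc; rewrite in_itv.
pose eta := cos (r / 2 * (pi *+ 2)) - cos (r * (pi *+ 2)).
have p2 : 0 < pi *+ 2 :> R by rewrite pmulrn_lgt0// pi_gt0.
have E2 : 2^-1 * (pi *+ 2) = pi :> R by rewrite -[pi *+ 2]mulr_natl mulKf.
have eta0 : 0 < eta.
  rewrite /eta; set P := pi *+ 2 in p2 E2 *.
  rewrite subr_gt0 ltr_cos ?in_itv /=.
  - by rewrite ltr_pM2r//; lra.
  - apply/andP; split; first by apply: mulr_ge0; lra.
    by rewrite -[X in _ <= X]E2 ler_wpM2r ?(ltW p2)//; lra.
  - apply/andP; split; first by apply: mulr_ge0; lra.
    by rewrite -[X in _ <= X]E2 ler_wpM2r ?(ltW p2)//; lra.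
have cr0 : 0 <= cos (r * (pi *+ 2)).
  have h42 : 4^-1 <= 2^-1 :> R by lra.
  have := @cos_le_mono r 4^-1 (ltW r0) r4 h42.
  have -> : 4^-1 * (pi *+ 2) = pi / 2 :> R by rewrite -mulr_natl; field.
  by rewrite cos_pihalf.
pose hat t : R := Num.max 0 (1 - `|t - 2^-1| * (2 / r)).
have chat : continuous hat.
  move=> t; apply: (@continuous_max _ _ (fun=> 0) (fun t => 1 - `|t - 2^-1| * (2 / r)));
    first exact: cst_continuous.
  apply: cvgB; first exact: cst_continuous.
  apply: cvgM; last exact: cst_continuous.
  apply: (continuous_comp (f := fun t => t - 2^-1)); last exact: norm_continuous.
  by apply: cvgB; [exact: cvg_id|exact: cst_continuous].
have hat0 t : 0 <= hat t by rewrite /hat le_max lexx.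
have hat1 t : hat t <= 1.
  rewrite /hat ge_max ler01 /= lerBlDr lerDl mulr_ge0// divr_ge0// ltW//.
have Ihat : 0 < I01 hat.
  apply: (@I01_hat_gt0 _ _ (2^-1 - r / 4) (2^-1 + r / 4)) => //; try lra.
  move=> t ht; rewrite /hat le_max; apply/orP; right.
  have ht' : `|t - 2^-1| <= r / 4 by rewrite ler_norml; lra.
  have : `|t - 2^-1| * (2 / r) <= r / 4 * (2 / r).
    by rewrite ler_wpM2r// divr_ge0// ltW.
  have -> : r / 4 * (2 / r) = 2^-1 by field; rewrite lt0r_neq0.
  lra.
have low k t : 0 <= t <= 1 ->
    d * (1 + eta) ^+ k * hat t - K <= f t * peak r t ^+ k.
  move=> ht; have ht2 : `|t - 2^-1| <= 2^-1 by rewrite ler_norml; lra.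
  have n0 := normr_ge0 (t - 2^-1).
  have pE : peak r t = 1 - cos (r * (pi *+ 2)) + cos (`|t - 2^-1| * (pi *+ 2)).
    by rewrite -cos_centered.
  have [h1|h1] := leP `|t - 2^-1| (r / 2).
    have ftd : d <= f t by apply: Hrho; lra.
    have q1 : 1 + eta <= peak r t.
      rewrite pE /eta; have := @cos_le_mono `|t - 2^-1| (r / 2) n0 h1; lra.
    have Q : (1 + eta) ^+ k <= peak r t ^+ k.
      by rewrite lerXn2r// nnegrE; lra.
    have Q0 : 0 <= (1 + eta) ^+ k by rewrite exprn_ge0//; lra.
    have A1 : d * (1 + eta) ^+ k * hat t <= d * (1 + eta) ^+ k.
      by rewrite ler_piMr// mulr_ge0// ltW.
    have A2 : d * (1 + eta) ^+ k <= f t * peak r t ^+ k.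
      by apply: ler_pM => //; exact: ltW.
    lra.
  have hz : hat t = 0.
    apply/eqP; rewrite /hat; apply/eqP/max_idPl.
    have : r / 2 * (2 / r) <= `|t - 2^-1| * (2 / r).
      by rewrite ler_wpM2r ?ltW// divr_gt0.
    have -> : r / 2 * (2 / r) = 1 by field; rewrite lt0r_neq0.
    lra.
  rewrite hz mulr0 sub0r.
  have [h2|h2] := leP `|t - 2^-1| r.
    have ftd : d <= f t by apply: Hrho; lra.
    have q1 : 1 <= peak r t.
      rewrite pE; have := @cos_le_mono `|t - 2^-1| r n0 h2; lra.
    have : 0 <= f t * peak r t ^+ k.
      by rewrite mulr_ge0//; [lra|rewrite exprn_ge0//; lra].
    lra.
  have q1 : `|peak r t| <= 1.
    rewrite pE ler_norml.
    have := @cos_le_mono r `|t - 2^-1| (ltW r0) (ltW h2) ht2.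
    have := cos_geN1 (`|t - 2^-1| * (pi *+ 2)); have := cos_le1 (r * (pi *+ 2)).
    lra.
  have : `|f t * peak r t ^+ k| <= K.
    rewrite normrM normrX -[K]mulr1; apply: ler_pM => //; first exact: HK.
    by rewrite exprn_ile1.
  by rewrite ler_norml => /andP[].
have cpk k : continuous (fun t => f t * peak r t ^+ k).
  have cp : continuous (peak r).
    move=> s; apply: cvgB; first exact: cst_continuous.
    apply: (continuous_comp (f := fun t => t * (pi *+ 2))); last exact: continuous_cos.
    by apply: cvgM; [exact: cvg_id|exact: cst_continuous].
  have cpX : continuous (fun t => peak r t ^+ k).
    elim: k => [|k IH].
      have -> : (fun x => peak r x ^+ 0) = (fun=> 1) by apply/funext => x; rewrite expr0.
      by move=> t; exact: cst_continuous.
    have -> : (fun x => peak r x ^+ k.+1) = (fun x => peak r x * peak r x ^+ k).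
      by apply/funext => x; rewrite exprS.
    by move=> t; apply: cvgM; [exact: cp|exact: IH].
  by move=> t; apply: cvgM; [exact: cf|exact: cpX].
have main k : d * (1 + eta) ^+ k * I01 hat <= K.
  have c1 : continuous (fun t => d * (1 + eta) ^+ k * hat t).
    by move=> t; apply: cvgM; [exact: cst_continuous|exact: chat].
  have : I01 (fun t => d * (1 + eta) ^+ k * hat t + - K) <=
         I01 (fun t => f t * peak r t ^+ k).
    apply: I01_le => //; last by move=> t ht; exact: low.
    by move=> t; apply: cvgD; [exact: c1|exact: cst_continuous].
  rewrite H// I01D//; last by move=> t; exact: cst_continuous.
  rewrite I01_cst I01Z//; lra.
have a0 : 0 < d * eta * I01 hat by rewrite !mulr_gt0.
pose k := Num.bound (K / (d * eta * I01 hat)).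
have := main k; apply/negP; rewrite -ltNge.
have hk : K < k%:R * (d * eta * I01 hat).
  by rewrite -ltr_pdivrMr//; apply: archi_boundP; rewrite divr_ge0// ltW.
apply: lt_le_trans hk _.
have B := bernoulli_ineq k (ltW eta0).
have -> : k%:R * (d * eta * I01 hat) = d * (k%:R * eta) * I01 hat by ring.
apply: (ler_wpM2r (ltW Ihat)); apply: (ler_wpM2l (ltW d0)).
by apply: le_trans B; rewrite lerDr ler01.
Qed.

Lemma echarD m m' t : @echar R m t * echar m' t = echar (m + m') t.
Proof.
by rewrite /echar -cexpD -mulrDr -mulrDr -toCD -opprD -mulrDl -intrD.
Qed.

Lemma peak_echar r t : toC (peak r t) =
  toC (1 - cos (r * (pi *+ 2))) + (- 2^-1) * (echar 1 t + echar (-1) t) :> C.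
Proof.
have -> : echar 1 t + echar (-1) t = 2 * ccos (toC (t * (pi *+ 2))).
  rewrite /ccos /echar [RHS]mulrC divfK ?two_neq0// addrC mulrN1z.
  rewrite mulN1r opprK mulr1z mul1r.
  by congr (cexp _ + cexp _); rewrite !toCM ?toCN mulrC; ring.
by rewrite ccos_toC mulrA mulNr mulVf ?two_neq0// mulN1r /peak toCD toCN.
Qed.

Lemma ccont_toC_cont (g : R -> R) : continuous g -> ccont (fun t => toC (g t) : C).
Proof. by move=> cg; split => //= t; exact: cst_continuous. Qed.

(** [f] is orthogonal to all trigonometric polynomials, in particular to the powers
    of [peak], and so are its multiples by [1], [-1], [i] and [- i]; their real parts
    at [1 / 2] cannot all be nonpositive unless the value is 0. *)
Lemma completeness (f : R -> C) : ccont f ->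
  (forall m, Cint (fun t => f t * echar m t) = 0) -> f 2^-1 = 0.
Proof.
have cp r : continuous (peak r).
  move=> s; apply: cvgB; first exact: cst_continuous.
  apply: (continuous_comp (f := fun t => t * (pi *+ 2))); last exact: continuous_cos.
  by apply: cvgM; [exact: cvg_id|exact: cst_continuous].
have P g : ccont g -> (forall m, Cint (fun t => g t * echar m t) = 0) -> Re (g 2^-1) <= 0.
  move=> cg Hg; apply: (@peak_positivity (fun t => Re (g t))); first by case: cg.
  move=> r k r0 r4.
  have cgk j : ccont (fun t => g t * toC (peak r t) ^+ j).
    apply: ccontM => //; elim: j => [|j IH].
      have -> : (fun t => toC (peak r t) ^+ 0 : C) = (fun=> 1) by apply/funext.
      exact: ccont_cst.
    have -> : (fun t => toC (peak r t) ^+ j.+1 : C) =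
      (fun t => toC (peak r t) * toC (peak r t) ^+ j) by apply/funext => t; rewrite exprS.
    by apply: ccontM => //; exact: ccont_toC_cont.
  have Hk j : forall m, Cint (fun t => (g t * toC (peak r t) ^+ j) * echar m t) = 0.
    elim: j => [|j IH] m.
      by rewrite -(Hg m); apply: eq_Cint => t _; rewrite expr0 mulr1.
    pose a : C := toC (1 - cos (r * (pi *+ 2))); pose b : C := - 2^-1.
    pose G m t := (g t * toC (peak r t) ^+ j) * echar m t.
    have cG m' : ccont (G m') by apply: ccontM => //; exact: ccont_echar.
    have cZ (e : C) m' : ccont (fun t => e * G m' t).
      by apply: ccontM => //; exact: ccont_cst.
    transitivity (Cint (fun t => a * G m t + (b * G (m + 1) t + b * G (m - 1) t))).
      apply: eq_Cint => t _; rewrite exprSr /G; set Q := toC (peak r t) ^+ j.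
      by rewrite peak_echar -/a -/b -!echarD; ring.
    rewrite CintD//; last exact: ccontD.
    by rewrite CintD// !CintZ// /G !IH !mulr0 !addr0.
  have := congr1 Re (Hk k 0); rewrite /= => <-.
  apply: eq_I01 => t _.
  have -> : toC (peak r t) ^+ k = toC (peak r t ^+ k) :> C.
    by elim: (k) => [|j IH]; rewrite ?expr0// !exprS IH toCM.
  have -> : echar 0 t = 1 :> C by rewrite /echar mulr0z mul0r oppr0 mulr0 mulr0 cexp0.
  by rewrite mulr1 Re_mul /= mulr0 subr0.
move=> cf Hf.
have Z (e : C) : Re (e * f 2^-1) <= 0.
  apply: (P (fun t => e * f t)); first by apply: ccontM => //; exact: ccont_cst.
  move=> m; have ce : ccont (fun t => f t * echar m t) by apply: ccontM => //; exact: ccont_echar.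
  rewrite -(mulr0 e) -(Hf m) -CintZ//; apply: eq_Cint => t _; by rewrite mulrA.
apply: eq_ReIm => /=.
  by have := Z 1; have := Z (-1); rewrite !Re_mul /= oppr0 !mul0r !subr0; lra.
by have := Z ii; have := Z (- ii); rewrite !Re_mul /= oppr0 !mul0r !sub0r; lra.
Qed.

End Completeness.

(** * Doubly periodic eigenfunctions of the Laplacian *)

Section Spectral.
Variable R : realType.
Local Notation C := R[i].
Local Notation Re := (@complex.Re R).
Local Notation Im := (@complex.Im R).
Local Notation normc := (@Normc.normc R).
Local Notation ii := ('i%C : C).
Implicit Types (z w : C) (s : seq bool) (t h : R) (m : int).
Variables (w1 w2 : C).
Local Notation det := (Re w1 * Im w2 - Im w1 * Re w2).
Hypothesis det0 : det != 0.

Local Notation twopi := (pi *+ 2).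
Local Notation freq m := (ii * toC (m%:~R * twopi)).

Lemma pder_ode (u : R -> C) (k : C) : (forall t, is_pder u t (k * u t)) ->
  forall t, u t = cexp (toC t * k) * u 0.
Proof.
move=> H t.
have D h : is_pder (fun h => u h * cexp (toC h * - k)) h 0.
  apply: is_pder_eq (is_pderM (H h) (is_pder_cexp_ray (- k) h)) _.
  by ring.
have := is_pder0_cst D t 0.
rewrite (_ : toC 0 * - k = 0) ?mul0r// cexp0 mulr1 mulrN cexpN => <-.
by rewrite mulrCA mulfV ?mulr1// cexp_neq0.
Qed.

Lemma tower_sub U V : tower w1 w2 U -> tower w1 w2 V ->
  tower w1 w2 (fun s z => U s z - V s z).
Proof.
move=> [U1 U2 U3 U4] [V1 V2 V3 V4]; split.
- by move=> s z; apply: is_pderD => //; apply: is_pderN.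
- by move=> s z; apply: is_pderD => //; apply: is_pderN.
- move=> s; have [K HK] := U3 s; have [L HL] := V3 s; exists (K + L) => z.
  apply: le_trans (normcD _ _) _; rewrite normcN; exact: lerD.
- move=> s z; have [-> ->] := U4 s z; by have [-> ->] := V4 s z.
Qed.

Lemma tower_sum (I : Type) (r : seq I) (V : I -> seq bool -> C -> C) :
  (forall i, tower w1 w2 (V i)) -> tower w1 w2 (fun s z => \sum_(i <- r) V i s z).
Proof.
move=> H; elim: r => [|i r IH].
  have -> : (fun s z => \sum_(i <- [::]) V i s z) = (fun _ _ => 0).
    by apply/funext => s; apply/funext => z; rewrite big_nil.
  split; try by move=> s z; exact: is_pder_cst.
    by move=> s; exists 0 => z; rewrite Normc.normc0.
  by [].
have -> : (fun s z => \sum_(i <- i :: r) V i s z) =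
   (fun s z => V i s z + \sum_(i <- r) V i s z).
  by apply/funext => s; apply/funext => z; rewrite big_cons.
have [U1 U2 U3 U4] := H i; have [V1 V2 V3 V4] := IH; split.
- by move=> s z; apply: is_pderD.
- by move=> s z; apply: is_pderD.
- move=> s; have [K HK] := U3 s; have [L HL] := V3 s; exists (K + L) => z.
  by apply: le_trans (normcD _ _) _; exact: lerD.
- move=> s z; have [-> ->] := U4 s z; by have [-> ->] := V4 s z.
Qed.

(** The frequency with coordinates [alp] and [bet] has scalar products [2 pi m] and
    [2 pi n] with the two periods; Cramer's rule. *)
Definition alp (m n : int) : R :=
  (m%:~R * twopi * Im w2 - n%:~R * twopi * Im w1) / det.
Definition bet (m n : int) : R :=
  (Re w1 * (n%:~R * twopi) - Re w2 * (m%:~R * twopi)) / det.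

Section Eigen.
Variables (U : seq bool -> C -> C) (m n : int).
Hypothesis TU : tower w1 w2 U.
Hypothesis D1 : forall s z, Ddir U w1 s z = freq m * U s z.
Hypothesis D2 : forall s z, Ddir U w2 s z = freq n * U s z.

Let det0C : toC det != 0 :> C.
Proof. by apply/eqP => -[E]; move: det0; rewrite E eqxx. Qed.

Lemma eigen_x s z : U (true :: s) z = ii * toC (alp m n) * U s z.
Proof.
apply: (mulfI det0C).
have H1 := D1 s z; have H2 := D2 s z; rewrite /Ddir in H1 H2.
transitivity (toC (Im w2) * (toC (Re w1) * U (true :: s) z + toC (Im w1) * U (false :: s) z)
  - toC (Im w1) * (toC (Re w2) * U (true :: s) z + toC (Im w2) * U (false :: s) z)).
  by rewrite toCD toCN !toCM; ring.
rewrite H1 H2.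
have -> : toC det * (ii * toC (alp m n) * U s z) = ii * toC (det * alp m n) * U s z.
  by rewrite toCM; ring.
have -> : det * alp m n = m%:~R * twopi * Im w2 - n%:~R * twopi * Im w1.
  by rewrite /alp [LHS]mulrC divfK.
by rewrite toCD toCN !toCM; ring.
Qed.

Lemma eigen_y s z : U (false :: s) z = ii * toC (bet m n) * U s z.
Proof.
apply: (mulfI det0C).
have H1 := D1 s z; have H2 := D2 s z; rewrite /Ddir in H1 H2.
transitivity (toC (Re w1) * (toC (Re w2) * U (true :: s) z + toC (Im w2) * U (false :: s) z)
  - toC (Re w2) * (toC (Re w1) * U (true :: s) z + toC (Im w1) * U (false :: s) z)).
  by rewrite toCD toCN !toCM; ring.
rewrite H1 H2.
have -> : toC det * (ii * toC (bet m n) * U s z) = ii * toC (det * bet m n) * U s z.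
  by rewrite toCM; ring.
have -> : det * bet m n = Re w1 * (n%:~R * twopi) - Re w2 * (m%:~R * twopi).
  by rewrite /bet [LHS]mulrC divfK.
by rewrite toCD toCN !toCM; ring.
Qed.

Lemma eigen_exp z :
  U [::] z = U [::] 0 * cexp (ii * toC (alp m n * Re z + bet m n * Im z)).
Proof.
have X y t : U [::] (y + toC t) = cexp (toC t * (ii * toC (alp m n))) * U [::] y.
  have := @pder_ode (fun t => U [::] (y + toC t)) (ii * toC (alp m n)).
  rewrite (_ : y + toC 0 = y) ?addr0//; apply => h.
  by apply: is_pder_eq (tower_x TU [::] y h) _; rewrite eigen_x.
have Y y t : U [::] (y + ii * toC t) = cexp (toC t * (ii * toC (bet m n))) * U [::] y.
  have := @pder_ode (fun t => U [::] (y + ii * toC t)) (ii * toC (bet m n)).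
  rewrite (_ : y + ii * toC 0 = y) ?mulr0 ?addr0//; apply => h.
  by apply: is_pder_eq (tower_y TU [::] y h) _; rewrite eigen_y.
have -> : U [::] z = U [::] (0 + toC (Re z) + ii * toC (Im z)).
  by rewrite add0r -complexE.
rewrite Y X mulrA mulrC -cexpD; congr (_ * cexp _).
by rewrite toCD !toCM; ring.
Qed.

(** The Laplacian multiplies a plane wave of frequency [g] by [- |g|^2]. *)
Lemma eigen_freq c z : (forall z, U [:: true; true] z + U [:: false; false] z = - toC c * U [::] z) ->
  U [::] z = 0 \/ alp m n ^+ 2 + bet m n ^+ 2 = c.
Proof.
move=> H; have := H z; rewrite !eigen_x !eigen_y => E.
have [->|U0] := eqVneq (U [::] z) 0; [by left|right].
have : toC (c - (alp m n ^+ 2 + bet m n ^+ 2)) * U [::] z = 0.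
  transitivity (toC c * U [::] z + ii * ii * (toC (alp m n) * toC (alp m n)
     + toC (bet m n) * toC (bet m n)) * U [::] z).
    by rewrite iiM toCD toCN toCD !expr2 !toCM; ring.
  apply/eqP; rewrite addrC addr_eq0 -mulNr -E; apply/eqP; ring.
move/eqP; rewrite mulf_eq0 (negbTE U0) orbF => /eqP [] /eqP.
by rewrite subr_eq0 => /eqP <-.
Qed.

(** [m] and [n] are scalar products of the frequency with the periods, so its length
    bounds them. *)
Lemma freq_bound (c : R) : alp m n ^+ 2 + bet m n ^+ 2 = c ->
  `|m%:~R * twopi| <= (`|Re w1| + `|Im w1| + (`|Re w2| + `|Im w2|)) * (1 + c) /\
  `|n%:~R * twopi| <= (`|Re w1| + `|Im w1| + (`|Re w2| + `|Im w2|)) * (1 + c).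
Proof.
move=> E.
have sq (a : R) : `|a| <= 1 + a ^+ 2.
  by rewrite -(real_normK (num_real a)); have := sqr_ge0 (`|a| - 1); have := normr_ge0 a; nra.
have a1 : `|alp m n| <= 1 + c.
  by apply: le_trans (sq _) _; rewrite -E; have := sqr_ge0 (bet m n); lra.
have b1 : `|bet m n| <= 1 + c.
  by apply: le_trans (sq _) _; rewrite -E; have := sqr_ge0 (alp m n); lra.
have c1 : 0 <= 1 + c by exact: le_trans a1.
have F (x y : R) : `|x * alp m n + y * bet m n| <= (`|x| + `|y|) * (1 + c).
  apply: le_trans (ler_normD _ _) _; rewrite mulrDl (normrM x) (normrM y).
  by apply: lerD; apply: ler_wpM2l.
have Em : m%:~R * twopi = Re w1 * alp m n + Im w1 * bet m n.
  by rewrite /alp /bet; field; exact: det0.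
have En : n%:~R * twopi = Re w2 * alp m n + Im w2 * bet m n.
  by rewrite /alp /bet; field; exact: det0.
rewrite Em En; split; apply: le_trans (F _ _) _; rewrite ler_wpM2r//.
  by rewrite lerDl addr_ge0.
by rewrite lerDr addr_ge0.
Qed.

End Eigen.

Lemma fcoef_comm U w w' m (k : C) s z : tower w1 w2 U ->
  (forall s z, Ddir U w' s z = k * U s z) ->
  Ddir (fun s => fcoef w m (U s)) w' s z = k * fcoef w m (U s) z.
Proof.
move=> TU H; have c1 := fcoef_ccont w m (true :: s) z TU.
have c2 := fcoef_ccont w m (false :: s) z TU; have c3 := fcoef_ccont w m s z TU.
rewrite /Ddir /fcoef -!CintZ// -CintD; last 2 first.
- by apply: ccontM => //; exact: ccont_cst.
- by apply: ccontM => //; exact: ccont_cst.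
by apply: eq_Cint => t _; rewrite [RHS]mulrA -H /Ddir; ring.
Qed.

Lemma freq_inj m n : freq m = freq n -> m = n.
Proof.
move/(mulfI (ii_neq0 R)) => -[] /mulIf E.
apply/(@intr_inj R)/E; rewrite mulrn_eq0 /=; apply: lt0r_neq0; exact: pi_gt0.
Qed.

(** The derivative along [w] acts on the coefficient both as the frequency of [n]
    and as the frequency of [m]. *)
Lemma fcoef_neq U w m n s z : tower w1 w2 U -> (forall s z, U s (z + w) = U s z) ->
  (forall s z, Ddir U w s z = freq n * U s z) -> m != n -> fcoef w m (U s) z = 0.
Proof.
move=> TU per H mn; apply/eqP.
have E : (freq n - freq m) * fcoef w m (U s) z = 0.
  by rewrite mulrBl -(fcoef_comm w m s z TU H) (fcoef_dir m s z TU per) subrr.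
move/eqP: E; rewrite mulf_eq0 subr_eq0 => /orP[/eqP /freq_inj E|//].
by rewrite E eqxx in mn.
Qed.

Lemma fcoef_eq U w n s z : tower w1 w2 U ->
  (forall s z, Ddir U w s z = freq n * U s z) -> fcoef w n (U s) z = U s z.
Proof.
move=> TU H; have D t : is_pder (fun t => U s (z + toC t * w) * echar n t) t 0.
  apply: is_pder_eq (is_pderM (tower_dir TU w s z t) (is_pder_echar n t)) _.
  by rewrite H toCN; ring.
rewrite /fcoef -[RHS]Cint_cst; apply: eq_Cint => t _.
rewrite (is_pder0_cst D t 0) echar0 mulr1 (_ : toC 0 * w = 0) ?addr0//.
by rewrite (_ : toC 0 = 0 :> C) ?mul0r.
Qed.

Lemma fcoef_sub U V w m s z : tower w1 w2 U -> tower w1 w2 V ->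
  fcoef w m (fun z => U s z - V s z) z = fcoef w m (U s) z - fcoef w m (V s) z.
Proof.
move=> TU TV; rewrite /fcoef -CintB; try exact: fcoef_ccont.
- by apply: eq_Cint => t _; rewrite mulrBl.
- exact: (fcoef_ccont w m s z TU).
- exact: (fcoef_ccont w m s z TV).
Qed.

Lemma fcoef_sum (I : Type) (r : seq I) (V : I -> seq bool -> C -> C) w m s z :
  (forall i, tower w1 w2 (V i)) ->
  fcoef w m (fun z => \sum_(i <- r) V i s z) z = \sum_(i <- r) fcoef w m (V i s) z.
Proof.
move=> H; elim: r => [|i r IH].
  rewrite big_nil /fcoef -[RHS]Cint_cst; apply: eq_Cint => t _.
  by rewrite big_nil mul0r.
rewrite big_cons -IH /fcoef -CintD.
- by apply: eq_Cint => t _; rewrite big_cons mulrDl.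
- exact: (fcoef_ccont w m s z (H i)).
- exact: (fcoef_ccont w m s z (tower_sum r H)).
Qed.

Lemma fcoef_complete U w : tower w1 w2 U -> (forall m z, fcoef w m (U [::]) z = 0) ->
  forall z, U [::] z = 0.
Proof.
move=> TU H z.
pose f t := U [::] (z - toC 2^-1 * w + toC t * w).
have -> : U [::] z = f 2^-1 by rewrite /f subrK.
apply: completeness; first exact: ccont_dir TU w _ _.
by move=> m; exact: H.
Qed.

Section Decomposition.
Variables (U : seq bool -> C -> C) (c : R).
Hypothesis TU : tower w1 w2 U.
Hypothesis LU : forall z, U [:: true; true] z + U [:: false; false] z = - toC c * U [::] z.

Definition coefU m n s : C -> C := fcoef w1 m (fcoef w2 n (U s)).

Lemma tower_B n : tower w1 w2 (fun s => fcoef w2 n (U s)).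
Proof. exact: tower_fcoef. Qed.

Lemma tower_coefU m n : tower w1 w2 (coefU m n).
Proof. exact: tower_fcoef (tower_B n). Qed.

Lemma per1 V : tower w1 w2 V -> forall s z, V s (z + w1) = V s z.
Proof. by move=> [_ _ _ H] s z; case: (H s z). Qed.

Lemma per2 V : tower w1 w2 V -> forall s z, V s (z + w2) = V s z.
Proof. by move=> [_ _ _ H] s z; case: (H s z). Qed.

Lemma coefU_D1 m n s z : Ddir (coefU m n) w1 s z = freq m * coefU m n s z.
Proof. exact: (fcoef_dir m s z (tower_B n) (per1 (tower_B n))). Qed.

Lemma coefU_D2 m n s z : Ddir (coefU m n) w2 s z = freq n * coefU m n s z.
Proof.
apply: (fcoef_comm _ m s z (tower_B n)) => s' z'.
exact: (fcoef_dir n s' z' TU (per2 TU)).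
Qed.

Lemma coefU_lap m n z :
  coefU m n [:: true; true] z + coefU m n [:: false; false] z = - toC c * coefU m n [::] z.
Proof.
have cc V s z' w' k : tower w1 w2 V -> ccont (fun t => V s (z' + toC t * w') * echar k t).
  exact: fcoef_ccont.
have step V w' k z' : tower w1 w2 V ->
  (forall z, V [:: true; true] z + V [:: false; false] z = - toC c * V [::] z) ->
  fcoef w' k (V [:: true; true]) z' + fcoef w' k (V [:: false; false]) z' =
  - toC c * fcoef w' k (V [::]) z'.
  move=> TV LV; rewrite /fcoef -CintD; try exact: cc.
  rewrite -CintZ; last exact: cc.
  by apply: eq_Cint => t _; rewrite -mulrDl LV mulrA.
apply: (step (fun s => fcoef w2 n (U s))); first exact: tower_B.
by move=> z'; apply: step.
Qed.

Lemma coefU_freq m n : (forall z, coefU m n [::] z = 0) \/ alp m n ^+ 2 + bet m n ^+ 2 = c.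
Proof.
have [H|H] := pselect (alp m n ^+ 2 + bet m n ^+ 2 = c); [by right|left] => z.
by have [] := eigen_freq (coefU_D1 m n) (coefU_D2 m n) z (coefU_lap m n).
Qed.

Variable M : nat.
Hypothesis HM : (`|Re w1| + `|Im w1| + (`|Re w2| + `|Im w2|)) * (1 + c) <= M%:R.
Local Notation idx i := ((nat_of_ord i)%:Z - M%:Z).
Local Notation I2 := ('I_(M.*2.+1) * 'I_(M.*2.+1))%type.

Lemma coefU_out m n : ~~ ((`|m| <= M)%N && (`|n| <= M)%N) -> forall z, coefU m n [::] z = 0.
Proof.
move=> H; have [//|E] := coefU_freq m n.
have [B1 B2] := freq_bound E.
have pi1 : 1 <= twopi :> R by have := pi_ge2 R; rewrite mulr2n; lra.
have K (k : int) : `|k%:~R * twopi| <= M%:R :> R -> (`|k| <= M)%N.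
  move=> h; rewrite -(ler_nat R); apply: le_trans h.
  rewrite normrM (ger0_norm (le_trans ler01 pi1)) -intr_norm -abszE natr_absz.
  by rewrite -[X in X <= _]mulr1 ler_wpM2l// ler0z.
by rewrite (K m (le_trans B1 HM)) (K n (le_trans B2 HM)) in H.
Qed.

Lemma idxP m : (`|m| <= M)%N -> exists i : 'I_(M.*2.+1), m = idx i.
Proof.
move=> hm; have hm2 : 0 <= m + M%:Z :> int by lia.
have lt : (absz (m + M%:Z)%R < M.*2.+1)%N by lia.
by exists (Ordinal lt); rewrite /=; lia.
Qed.

Lemma idx_inj i j : idx i = idx j -> i = j :> 'I_(M.*2.+1).
Proof. by move/addIr => -[] E; exact: val_inj. Qed.

(** The difference of the two sides has no Fourier coefficient: those in the range of
    the sum cancel by orthogonality, the others vanish since their frequency is too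
    long.  Completeness is applied along each period in turn. *)
Theorem fourier_decomposition z : U [::] z = \sum_(i : I2) coefU (idx i.1) (idx i.2) [::] z.
Proof.
pose S s z := \sum_(i : I2) coefU (idx i.1) (idx i.2) s z.
have TS : tower w1 w2 S by apply: tower_sum => i; exact: tower_coefU.
have TV := tower_sub TU TS.
suff H : U [::] z - S [::] z = 0 by apply/eqP; rewrite -subr_eq0; apply/eqP.
apply: (fcoef_complete (w := w2) TV) => n {}z.
apply: (fcoef_complete (w := w1) (tower_fcoef w2 n TV)) => m {}z.
have BS x : fcoef w2 n (S [::]) x = \sum_(i : I2 | idx i.2 == n) coefU (idx i.1) (idx i.2) [::] x.
  rewrite /S (@fcoef_sum _ (index_enum I2) (fun i => coefU (idx i.1) (idx i.2))); last first.
    by move=> i; exact: tower_coefU.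
  rewrite [RHS]big_mkcond; apply: eq_bigr => i _.
  have [E|E] := eqVneq (idx i.2) n.
    rewrite -E (fcoef_eq _ _ (tower_coefU _ _) (coefU_D2 _ _))//.
  apply: (fcoef_neq _ _ (tower_coefU _ _) (per2 (tower_coefU _ _)) (coefU_D2 _ _)).
  by rewrite eq_sym.
have -> : fcoef w1 m (fcoef w2 n (fun z => U [::] z - S [::] z)) z =
  coefU m n [::] z - fcoef w1 m (fun x => \sum_(i : I2 | idx i.2 == n) coefU (idx i.1) (idx i.2) [::] x) z.
  have -> : fcoef w2 n (fun z => U [::] z - S [::] z) =
    (fun x => fcoef w2 n (U [::]) x - fcoef w2 n (S [::]) x).
    by apply/funext => x; exact: (fcoef_sub w2 n [::] x TU TS).
  rewrite (fcoef_sub w1 m [::] z (tower_B n) (tower_fcoef w2 n TS)).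
  congr (_ - fcoef w1 m _ z); by apply/funext => x; exact: BS.
have -> : fcoef w1 m (fun x => \sum_(i : I2 | idx i.2 == n) coefU (idx i.1) (idx i.2) [::] x) z =
   \sum_(i : I2 | (idx i.2 == n) && (idx i.1 == m)) coefU (idx i.1) (idx i.2) [::] z.
  have -> : (fun x => \sum_(i : I2 | idx i.2 == n) coefU (idx i.1) (idx i.2) [::] x) =
    (fun x => \sum_(i <- [seq i <- index_enum I2 | idx i.2 == n]) coefU (idx i.1) (idx i.2) [::] x).
    by apply/funext => x; rewrite big_filter.
  rewrite (@fcoef_sum _ _ (fun i => coefU (idx i.1) (idx i.2))); last by move=> i; exact: tower_coefU.
  rewrite big_filter [LHS]big_mkcond [RHS]big_mkcond; apply: eq_bigr => i _ /=.
  case: (idx i.2 == n) => //=.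
  have [E|E] := eqVneq (idx i.1) m.
    by rewrite -E (fcoef_eq _ _ (tower_coefU _ _) (coefU_D1 _ _)).
  apply: (fcoef_neq _ _ (tower_coefU _ _) (per1 (tower_coefU _ _)) (coefU_D1 _ _)).
  by rewrite eq_sym.
apply/eqP; rewrite subr_eq0; apply/eqP.
have [/andP[hm hn]|out] := boolP ((`|m| <= M)%N && (`|n| <= M)%N).
  have [i Ei] := idxP hm; have [j Ej] := idxP hn.
  rewrite (big_pred1 (i, j)) /=; first by rewrite -Ei -Ej.
  move=> [a b] /=; rewrite Ei Ej; apply/andP/eqP => [[/eqP h1 /eqP h2]|[-> ->]].
    by rewrite (idx_inj h1) (idx_inj h2).
  by rewrite !eqxx.
rewrite (coefU_out out) big1// => i /andP[/eqP h1 /eqP h2].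
by rewrite h1 h2 (coefU_out out).
Qed.

End Decomposition.

(** The frequencies depend on the lattice and on [c] only, so the same ones serve
    for all the components of a vector-valued eigenfunction. *)
Theorem fourier_finite (c : R) : 0 <= c -> exists (N : nat) (g : 'I_N -> C),
  (forall k, Re (g k) ^+ 2 + Im (g k) ^+ 2 = c) /\
  forall U, tower w1 w2 U ->
    (forall z, U [:: true; true] z + U [:: false; false] z = - toC c * U [::] z) ->
    exists a : 'I_N -> C, forall z,
      U [::] z = \sum_k a k * cexp (ii * toC (Re (g k) * Re z + Im (g k) * Im z)).
Proof.
move=> c0.
pose B := (`|Re w1| + `|Im w1| + (`|Re w2| + `|Im w2|)) * (1 + c).
pose M := Num.bound B.
have HM : B <= M%:R.
  apply/ltW/archi_boundP; rewrite mulr_ge0 ?addr_ge0//.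
pose I2 := ('I_(M.*2.+1) * 'I_(M.*2.+1))%type.
pose al (i : I2) := alp ((i.1 : nat)%:Z - M%:Z) ((i.2 : nat)%:Z - M%:Z).
pose be (i : I2) := bet ((i.1 : nat)%:Z - M%:Z) ((i.2 : nat)%:Z - M%:Z).
pose G (i : I2) : C := if al i ^+ 2 + be i ^+ 2 == c then (al i +i* be i)%C
  else toC (Num.sqrt c).
(* Indices (m, n) off the circle have coefficient 0; any vector of length
   sqrt c can serve as their frequency. *)
exists #|{: I2}|, (fun k => G (enum_val k)); split.
  move=> k; rewrite /G; case: ifP => [/eqP //|_].
  by rewrite /= sqr_sqrtr// expr0n addr0.
move=> U TU LU.
pose A (i : I2) := coefU U ((i.1 : nat)%:Z - M%:Z) ((i.2 : nat)%:Z - M%:Z) [::] 0.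
exists (fun k => A (enum_val k)) => z.
rewrite (fourier_decomposition TU LU HM z).
rewrite [LHS](eq_bigr (fun i : I2 => A i
   * cexp (ii * toC (Re (G i) * Re z + Im (G i) * Im z)))).
  rewrite (reindex_onto (@enum_val I2 xpredT) enum_rank) /=.
    by apply: eq_bigl => k; rewrite enum_valK eqxx.
  by move=> i _; exact: enum_rankK.
move=> i _.
have E := eigen_exp (tower_coefU TU _ _) (coefU_D1 TU _ _) (coefU_D2 TU _ _) z.
rewrite E /G /A.
have [H|H] := coefU_freq TU LU ((i.1 : nat)%:Z - M%:Z) ((i.2 : nat)%:Z - M%:Z).
  by rewrite H !mul0r.
by rewrite /al /be H eqxx.
Qed.

End Spectral.

(** * Smooth functions on the plane *)

Section PlaneCalculus.
Variable R : realType.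
Local Notation C := R[i].
Local Notation Re := (@complex.Re R).
Local Notation Im := (@complex.Im R).
Local Notation normc := (@Normc.normc R).
Local Notation ii := ('i%C : C).
Implicit Types (u v : C -> R) (z w : C) (s : seq bool).

Lemma plane_contP v : continuous (v : C^o -> R) <-> forall z (e : R), 0 < e ->
  exists2 d, 0 < d & forall h, normc h < d -> `|v (z + h) - v z| <= e.
Proof.
split=> H z.
  move=> e e0; have /cvgrPdist_le /(_ e e0) [d /= d0 Hd] := H z.
  have [d0r dE] : 0 < Re d /\ d = (Re d)%:C%C.
    by move: d0; rewrite ltcE /= => /andP[/eqP ei er]; split=> //; apply: eq_ReIm.
  exists (Re d) => // h hd; have := Hd (z + h).
  rewrite /ball_ /= opprD addrA subrr sub0r normrN dE normrCE ltcR hd => /(_ isT).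
  by rewrite distrC.
apply/(cvgrPdist_le (FF := nbhs_filter (z : C^o))) => e e0.
have [d d0 Hd] := H z e e0.
apply/nbhs_ballP; exists d%:C%C => /=; first by rewrite ltcR.
move=> y /=; rewrite /ball /= distrC normrCE ltcR => hy.
have := Hd (y - z) hy; rewrite [z + _]addrC subrK; by rewrite distrC.
Qed.

Definition dx u v := forall z, is_derive (0 : R) 1 (line_x u z) (v z).
Definition dy u v := forall z, is_derive (0 : R) 1 (line_y u z) (v z).

Lemma dx_line u v : dx u v -> forall z (t : R), is_derive t 1 (line_x u z) (v (z + toC t)).
Proof. by move=> H z t; apply: is_derive_line_x. Qed.

Lemma dy_line u v : dy u v -> forall z (t : R), is_derive t 1 (line_y u z) (v (z + ii * toC t)).
Proof. by move=> H z t; apply: is_derive_line_y. Qed.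

Lemma dx_uniq u v : dx u v -> partial_x u = v.
Proof.
by move=> H; apply/funext => z; rewrite /partial_x derive1E; case: (H z).
Qed.

Lemma dy_uniq u v : dy u v -> partial_y u = v.
Proof.
by move=> H; apply/funext => z; rewrite /partial_y derive1E; case: (H z).
Qed.

Lemma normc_box (a b h : R) : `|a| <= h -> `|b| <= h -> normc (toC a + ii * toC b) <= 2 * h.
Proof.
move=> ha hb; apply: le_trans (normcD _ _) _; rewrite normcI !normc_toC; lra.
Qed.

Lemma toC0 : toC 0 = 0 :> C.
Proof. by []. Qed.

Section Schwarz.
Variables (u ux uy uxy uyx : C -> R) (z : C).
Hypotheses (Dx : dx u ux) (Dy : dy u uy) (Dxy : dy ux uxy) (Dyx : dx uy uyx).

Let Delta h := u (z + toC h + ii * toC h) - u (z + toC h) - u (z + ii * toC h) + u z.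

Lemma delta_xy h : 0 < h -> exists2 w, normc w <= 2 * h & Delta h = uxy (z + w) * h * h.
Proof.
move=> h0.
have [c cb Ec] := @mvt _ (line_x u (z + ii * toC h) - line_x u z)
  (fun t => ux (z + ii * toC h + toC t) - ux (z + toC t)) 0 h
  (fun t => is_deriveB (dx_line Dx _ t) (dx_line Dx _ t)).
have [b bb Eb] := @mvt _ (line_y ux (z + toC c)) (fun t => uxy (z + toC c + ii * toC t)) 0 h
  (dy_line Dxy (z + toC c)).
rewrite !subr0 in cb bb Ec Eb; rewrite (gtr0_norm h0) in cb bb.
exists (toC c + ii * toC b); first exact: normc_box.
rewrite [z + (_ + _)]addrA -Eb.
move: Ec; rewrite !fctE /line_x /line_y !toC0 mulr0 !addr0 => Ec.
rewrite [z + toC c + _]addrAC -Ec /Delta [z + toC h + _]addrAC; ring.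
Qed.

Lemma delta_yx h : 0 < h -> exists2 w, normc w <= 2 * h & Delta h = uyx (z + w) * h * h.
Proof.
move=> h0.
have [c cb Ec] := @mvt _ (line_y u (z + toC h) - line_y u z)
  (fun t => uy (z + toC h + ii * toC t) - uy (z + ii * toC t)) 0 h
  (fun t => is_deriveB (dy_line Dy _ t) (dy_line Dy _ t)).
have [b bb Eb] := @mvt _ (line_x uy (z + ii * toC c)) (fun t => uyx (z + ii * toC c + toC t)) 0 h
  (dx_line Dyx (z + ii * toC c)).
rewrite !subr0 in cb bb Ec Eb; rewrite (gtr0_norm h0) in cb bb.
exists (toC b + ii * toC c); first exact: normc_box.
rewrite [toC b + _]addrC [z + (_ + _)]addrA -Eb.
move: Ec; rewrite !fctE /line_x /line_y !toC0 mulr0 !addr0 => Ec.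
rewrite [z + _ + toC h]addrAC -Ec /Delta; ring.
Qed.

(** By the mean value theorem the second difference over a square of side [h] is
    [h^2] times either mixed derivative at some point near [z]. *)
Lemma schwarz : continuous (uxy : C^o -> R) -> continuous (uyx : C^o -> R) -> uxy z = uyx z.
Proof.
move=> /plane_contP /(_ z) c1 /plane_contP /(_ z) c2.
apply/eqP; rewrite -subr_eq0 -normr_le0 leNgt; apply/negP => e0.
set e := `|_| in e0.
have e4 : 0 < e / 4 by rewrite divr_gt0.
have [d1 d10 H1] := c1 _ e4; have [d2 d20 H2] := c2 _ e4.
pose h := Num.min d1 d2 / 4.
have m0 : 0 < Num.min d1 d2 by rewrite lt_min d10.
have h0 : 0 < h by rewrite divr_gt0.
have hd1 : 2 * h < d1.
  have : Num.min d1 d2 <= d1 by rewrite ge_min lexx.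
  by rewrite /h; lra.
have hd2 : 2 * h < d2.
  have : Num.min d1 d2 <= d2 by rewrite ge_min lexx orbT.
  by rewrite /h; lra.
have [a1 b1 E1] := delta_xy h0; have [a2 b2 E2] := delta_yx h0.
have E : uxy (z + a1) = uyx (z + a2).
  by apply: (mulIf (lt0r_neq0 h0)); apply: (mulIf (lt0r_neq0 h0)); rewrite -E1.
have := H1 _ (le_lt_trans b1 hd1); have := H2 _ (le_lt_trans b2 hd2).
rewrite E !ler_norml => /andP[p1 p2] /andP[p3 p4].
have : e <= e / 2 by rewrite /e ler_norml -/e; lra.
lra.
Qed.

End Schwarz.

Definition iter_partial s u : C -> R := 
  foldr (fun b v => if b then partial_x v else partial_y v) u s.

Lemma smooth_partial s u : smooth_plane u -> smooth_plane (iter_partial s u).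
Proof. by move=> H t; rewrite /iter_partial -foldr_cat; exact: H. Qed.

Lemma smooth_px u : smooth_plane u -> smooth_plane (partial_x u).
Proof. exact: (@smooth_partial [:: true]). Qed.

Lemma smooth_py u : smooth_plane u -> smooth_plane (partial_y u).
Proof. exact: (@smooth_partial [:: false]). Qed.

Lemma smooth_cont u : smooth_plane u -> continuous (u : C^o -> R).
Proof. by move=> /(_ [::]) []. Qed.

Lemma smooth_dx u : smooth_plane u -> dx u (partial_x u).
Proof. by move=> H z; exact: smooth_plane_derive_x. Qed.

Lemma smooth_dy u : smooth_plane u -> dy u (partial_y u).
Proof. by move=> H z; exact: smooth_plane_derive_y. Qed.

Lemma partial_comm u : smooth_plane u ->
  partial_y (partial_x u) = partial_x (partial_y u).
Proof.
move=> H; apply/funext => z.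
apply: (schwarz z (smooth_dx H) (smooth_dy H) (smooth_dy (smooth_px H)) (smooth_dx (smooth_py H))).
  exact: smooth_cont (smooth_py (smooth_px H)).
exact: smooth_cont (smooth_px (smooth_py H)).
Qed.

(** Closed under both partial derivatives, since differentiating a plane wave shifts
    its phase by [pi / 2]. *)
Inductive smooth_expr : (C -> R) -> Prop :=
| smooth_expr_base u : smooth_plane u -> smooth_expr u
| smooth_expr_cst (c : R) : smooth_expr (fun=> c)
| smooth_expr_cos (a b c : R) : smooth_expr (fun z => cos (a * Re z + b * Im z + c))
| smooth_expr_add u v : smooth_expr u -> smooth_expr v -> smooth_expr (fun z => u z + v z)
| smooth_expr_mul u v : smooth_expr u -> smooth_expr v -> smooth_expr (fun z => u z * v z).

Lemma affine_cont (a b c : R) : continuous ((fun z => a * Re z + b * Im z + c) : C^o -> R).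
Proof.
apply/plane_contP => z e e0; pose k := `|a| + `|b| + 1.
have k0 : 0 < k by rewrite ltr_wpDl// addr_ge0.
exists (e / k); first by rewrite divr_gt0.
move=> h; rewrite ltr_pdivlMr// => hk.
have -> : a * Re (z + h) + b * Im (z + h) + c - (a * Re z + b * Im z + c) = a * Re h + b * Im h.
  by rewrite ReD ImD; ring.
apply: le_trans (ler_normD _ _) _; rewrite (normrM a) (normrM b).
have n0 := normc_ge0 h.
have A : `|a| * `|Re h| <= `|a| * normc h by rewrite ler_wpM2l// Re_le_normc.
have B : `|b| * `|Im h| <= `|b| * normc h by rewrite ler_wpM2l// Im_le_normc.
move: hk; rewrite /k !mulrDr mulr1 ![normc h * _]mulrC; lra.
Qed.

Lemma is_derive_cos_line (l : R -> R) (d : R) :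
  is_derive (0 : R) 1 l d -> is_derive (0 : R) 1 (fun t => cos (l t)) (d * cos (l 0 + pi / 2)).
Proof.
move=> H; have -> : d * cos (l 0 + pi / 2) = - sin (l 0) * d.
  by rewrite cosDpihalf mulrC.
exact: (is_derive1_comp (f := @cos R) (g := l)).
Qed.

Lemma is_derive_affine (a b : R) : is_derive (0 : R) 1 (fun t => a + b * t) b.
Proof.
have -> : (fun t : R => a + b * t) = (fun=> a) + b *: id by apply/funext => t.
apply: (is_derive_eq (is_deriveD (is_derive_cst a (0 : R) 1) (is_deriveZ b (is_derive_id (0 : R) 1)))).
by rewrite add0r /GRing.scale /= mulr1.
Qed.

Lemma smooth_expr_step u : smooth_expr u -> continuous (u : C^o -> R) /\
  (exists2 v, smooth_expr v & dx u v) /\ (exists2 v, smooth_expr v & dy u v).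
Proof.
elim=> {u} [u su|c|a b c|u v eu [cu [[ux eux Dux] [uy euy Duy]]] ev [cv [[vx evx Dvx] [vy evy Dvy]]]
  |u v eu [cu [[ux eux Dux] [uy euy Duy]]] ev [cv [[vx evx Dvx] [vy evy Dvy]]]].
- split; first exact: smooth_cont.
  by split; [exists (partial_x u)|exists (partial_y u)];
    [exact/smooth_expr_base/smooth_px|exact: smooth_dx|exact/smooth_expr_base/smooth_py|exact: smooth_dy].
- split; first by move=> z; exact: cst_continuous.
  by split; exists (fun=> 0); try exact: smooth_expr_cst; move=> z; exact: is_derive_cst.
- split.
    move=> z; apply: (continuous_comp (f := (fun z => a * Re z + b * Im z + c) : C^o -> R)).
      exact: affine_cont.
    exact: continuous_cos.
  split.
    exists (fun z => a * cos (a * Re z + b * Im z + (c + pi / 2))).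
      exact: smooth_expr_mul (smooth_expr_cst _) (smooth_expr_cos _ _ _).
    move=> z; have := is_derive_cos_line (is_derive_affine (a * Re z + b * Im z + c) a).
    rewrite mulr0 addr0 addrA.
    suff -> : line_x (fun z => cos (a * Re z + b * Im z + c)) z =
      (fun t => cos (a * Re z + b * Im z + c + a * t)) by [].
    by apply/funext => t; rewrite /line_x ReD ImD /= addr0; congr cos; ring.
  exists (fun z => b * cos (a * Re z + b * Im z + (c + pi / 2))).
    exact: smooth_expr_mul (smooth_expr_cst _) (smooth_expr_cos _ _ _).
  move=> z; have := is_derive_cos_line (is_derive_affine (a * Re z + b * Im z + c) b).
  rewrite mulr0 addr0 addrA.
  suff -> : line_y (fun z => cos (a * Re z + b * Im z + c)) z =
      (fun t => cos (a * Re z + b * Im z + c + b * t)) by [].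
  apply/funext => t; rewrite /line_y ReD ImD Re_mul Im_mul /=.
  by congr cos; ring.
- split; first by move=> z; exact: (continuousD (cu z) (cv z)).
  split.
    exists (fun z => ux z + vx z); first exact: smooth_expr_add.
    by move=> z; exact: is_deriveD (Dux z) (Dvx z).
  exists (fun z => uy z + vy z); first exact: smooth_expr_add.
  by move=> z; exact: is_deriveD (Duy z) (Dvy z).
- split; first by move=> z; exact: (continuousM (cu z) (cv z)).
  split.
    exists (fun z => u z * vx z + v z * ux z); first by apply: smooth_expr_add; exact: smooth_expr_mul.
    move=> z; have := is_deriveM (Dux z) (Dvx z).
    by rewrite /GRing.scale /= /line_x toC0 addr0.
  exists (fun z => u z * vy z + v z * uy z); first by apply: smooth_expr_add; exact: smooth_expr_mul.
  move=> z; have := is_deriveM (Duy z) (Dvy z).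
  by rewrite /GRing.scale /= /line_y toC0 mulr0 addr0.
Qed.

Lemma smooth_expr_smooth u : smooth_expr u -> smooth_plane u.
Proof.
move=> eu s /=; rewrite -/(iter_partial s u).
have : smooth_expr (iter_partial s u).
  elim: s => [//|b s IH] /=.
  have [_ [[v ev Dv] [w ew Dw]]] := smooth_expr_step IH.
  by case: b; [rewrite (dx_uniq Dv)|rewrite (dy_uniq Dw)].
move=> {}eu; have [cu [[v _ Dv] [w _ Dw]]] := smooth_expr_step eu.
by split=> // z; split; [case: (Dv z)|case: (Dw z)].
Qed.

Lemma periodic_partial u w s : (forall z, u (z + w) = u z) -> forall z, iter_partial s u (z + w) = iter_partial s u z.
Proof.
move=> H; elim: s => [//|b s IH] z /=.
case: b; rewrite ?/partial_x ?/partial_y; congr (derive1 _ 0); apply/funext => t.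
  by rewrite /line_x addrAC IH.
by rewrite /line_y addrAC IH.
Qed.

Lemma periodic_int u w : (forall z, u (z + w) = u z) -> forall (m : int) z, u (z + w *~ m) = u z.
Proof.
move=> H.
have N (k : nat) z : u (z + w *+ k) = u z.
  by elim: k z => [|k IH] z; rewrite ?addr0// mulrSr addrA H IH.
case=> k z; first exact: N.
by rewrite NegzE mulrNz -(N k.+1 (z - _)) subrK.
Qed.

(** The values are already taken on the image of the compact unit square. *)
Lemma periodic_bounded u w1 w2 : Re w1 * Im w2 - Im w1 * Re w2 != 0 ->
  continuous (u : C^o -> R) ->
  (forall z, u (z + w1) = u z) -> (forall z, u (z + w2) = u z) ->
  exists K, forall z, `|u z| <= K.
Proof.
move=> d0 cu p1 p2; set d := (X in X != 0) in d0.
pose g (st : R^o * R^o) : C^o := toC st.1 * w1 + toC st.2 * w2.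
have cg : continuous g.
  move=> st; apply/cvgrPdist_le => e e0.
  have [e0r eE] : 0 < Re e /\ e = (Re e)%:C%C.
    by move: e0; rewrite ltcE /= => /andP[/eqP ei er]; split=> //; apply: eq_ReIm.
  pose k := normc w1 + normc w2 + 1.
  have k0 : 0 < k by rewrite ltr_wpDl// addr_ge0// normc_ge0.
  have dk : 0 < Re e / k by rewrite divr_gt0.
  exists (ball st.1 (Re e / k), ball st.2 (Re e / k)) => /=; first by split; exact: nbhsx_ballx.
  move=> [s' t'] /= []; rewrite /ball /= => h1 h2.
  rewrite /g /= eE normrCE lecR.
  have -> : toC st.1 * w1 + toC st.2 * w2 - (toC s' * w1 + toC t' * w2) =
    toC (st.1 - s') * w1 + toC (st.2 - t') * w2 by rewrite !toCD !toCN; ring.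
  apply: le_trans (normcD _ _) _; rewrite !Normc.normcM !normc_toC.
  have n1 := normc_ge0 w1; have n2 := normc_ge0 w2.
  have A : `|st.1 - s'| * normc w1 <= Re e / k * normc w1 by rewrite ler_wpM2r// ltW.
  have B : `|st.2 - t'| * normc w2 <= Re e / k * normc w2 by rewrite ler_wpM2r// ltW.
  apply: le_trans (lerD A B) _; rewrite -mulrDr -[X in _ <= X](divfK (lt0r_neq0 k0)).
  by rewrite ler_wpM2l ?(ltW dk)// /k; lra.
have cK : compact (`[0%R, 1%R] `*` `[0%R, 1%R] : set (R^o * R^o)).
  by apply: compact_setX; exact: segment_compact.
have cug : {within `[0%R, 1%R] `*` `[0%R, 1%R], continuous (u \o g : R^o * R^o -> R^o)}.
  apply: continuous_subspaceT => st; apply: continuous_comp; [exact: cg|exact: cu].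
have := continuous_compact cug cK.
move=> /compact_bounded [K0 [_ HK]].
exists (K0 + 1) => z.
pose s := (Re z * Im w2 - Im z * Re w2) / d.
pose t := (Re w1 * Im z - Im w1 * Re z) / d.
have zE : z = toC s * w1 + toC t * w2.
  by apply: eq_ReIm; rewrite !(ReD, ImD, Re_mul, Im_mul) /= /s /t /d; field.
pose m := Num.floor s; pose n := Num.floor t.
have Ei (k : int) (w : C) : toC k%:~R * w = w *~ k.
  by rewrite -[RHS]mulrzl; congr (_ * _); exact: (rmorph_int (@real_complex R)).
have -> : u z = u (g (s - m%:~R, t - n%:~R)).
  rewrite -(periodic_int p2 (- n)) -(periodic_int p1 (- m)); congr u.
  by rewrite /g /= -!Ei zE !mulrNz !toCD !toCN; ring.
apply: HK; first by rewrite ltrDl ltr01.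
exists (s - m%:~R, t - n%:~R) => //=.
have F (x : R) : 0 <= x - (Num.floor x)%:~R <= 1.
  by rewrite subr_ge0 floor_le_tmp /= lerBlDl -intrD1 ltW// floorD1_gt.
by split; rewrite /= in_itv /=; exact: F.
Qed.

Lemma smooth_tower u w1 w2 : Re w1 * Im w2 - Im w1 * Re w2 != 0 -> smooth_plane u ->
  (forall z, u (z + w1) = u z) -> (forall z, u (z + w2) = u z) ->
  tower w1 w2 (fun s z => toC (iter_partial s u z)).
Proof.
move=> d0 su p1 p2; split.
- move=> s z; split; last exact: is_derive_cst.
  exact: smooth_dx (smooth_partial s su) z.
- move=> s z; split; last exact: is_derive_cst.
  exact: smooth_dy (smooth_partial s su) z.
- move=> s; have [K HK] := periodic_bounded d0 (smooth_cont (smooth_partial s su))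
    (periodic_partial s p1) (periodic_partial s p2).
  by exists K => z; rewrite normc_toC.
- by move=> s z; rewrite !periodic_partial.
Qed.

End PlaneCalculus.

(** * The Dirac equation of a Hamiltonian stationary immersion *)

Section LineCalculus.
Variable R : realType.
Local Notation C := R[i].
Variable l : C -> R -> C.
Hypothesis l0 : forall z, l z 0 = z.
Implicit Types (u v : C -> R) (P Q : C -> 'cV[R]_4).

(** Derivative at 0 along curves [l z] starting from [z]; with the horizontal and
    the vertical lines both partial derivatives obey one set of rules. *)
Definition dl u v := forall z, is_derive (0 : R) 1 (fun t => u (l z t)) (v z).

Lemma dl_eq u v u' v' : dl u v -> u =1 u' -> v =1 v' -> dl u' v'.
Proof. by move=> + /funext <- /funext <-. Qed.

Lemma dlD u v u' v' : dl u u' -> dl v v' -> dl (fun z => u z + v z) (fun z => u' z + v' z).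
Proof. by move=> H K z; exact: is_deriveD (H z) (K z). Qed.

Lemma dlB u v u' v' : dl u u' -> dl v v' -> dl (fun z => u z - v z) (fun z => u' z - v' z).
Proof. by move=> H K z; exact: is_deriveB (H z) (K z). Qed.

Lemma dlM u v u' v' : dl u u' -> dl v v' ->
  dl (fun z => u z * v z) (fun z => u z * v' z + v z * u' z).
Proof.
by move=> H K z; have := is_deriveM (H z) (K z); rewrite /GRing.scale /= l0.
Qed.

Lemma dl_cst (c : R) : dl (fun=> c) (fun=> 0).
Proof. by move=> z; exact: is_derive_cst. Qed.

Lemma dl_uniq u v w : dl u v -> dl u w -> v = w.
Proof. by move=> H K; apply/funext => z; have [_ <-] := H z; have [_ <-] := K z. Qed.

Definition dlv P Q := forall i, dl (fun z => P z i 0) (fun z => Q z i 0).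

Lemma dlv_uniq P Q S : dlv P Q -> dlv P S -> Q = S.
Proof.
move=> H K; apply/funext => z; apply/matrixP => i j; rewrite ord1.
exact: (congr1 (fun v => v z) (dl_uniq (H i) (K i))).
Qed.

Lemma dlv_qmul P P' Q Q' : dlv P P' -> dlv Q Q' ->
  dlv (fun z => qmul (P z) (Q z)) (fun z => qmul (P' z) (Q z) + qmul (P z) (Q' z)).
Proof.
move=> H K; apply: I4_ind.
- apply: (dl_eq (dlB (dlB (dlB (dlM (H 0) (K 0)) (dlM (H 1) (K 1))) (dlM (H 2) (K 2)))
    (dlM (H 3) (K 3)))) => z; first by rewrite qmulE.
  by rewrite addqE !qmulE; ring.
- apply: (dl_eq (dlB (dlD (dlD (dlM (H 0) (K 1)) (dlM (H 1) (K 0))) (dlM (H 2) (K 3)))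
    (dlM (H 3) (K 2)))) => z; first by rewrite qmulE.
  by rewrite addqE !qmulE; ring.
- apply: (dl_eq (dlD (dlD (dlB (dlM (H 0) (K 2)) (dlM (H 1) (K 3))) (dlM (H 2) (K 0)))
    (dlM (H 3) (K 1)))) => z; first by rewrite qmulE.
  by rewrite addqE !qmulE; ring.
- apply: (dl_eq (dlD (dlB (dlD (dlM (H 0) (K 3)) (dlM (H 1) (K 2))) (dlM (H 2) (K 1)))
    (dlM (H 3) (K 0)))) => z; first by rewrite qmulE.
  by rewrite addqE !qmulE; ring.
Qed.

Lemma dlv_cst (q : 'cV[R]_4) : dlv (fun=> q) (fun=> 0).
Proof. by move=> i; apply: dl_eq (dl_cst (q i 0)) _ _ => // z; rewrite mxE. Qed.

Lemma dlv_qmull q Q Q' : dlv Q Q' -> dlv (fun z => qmul q (Q z)) (fun z => qmul q (Q' z)).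
Proof.
move=> H i; apply: dl_eq (dlv_qmul (dlv_cst q) H i) _ _ => // z.
by rewrite qmul0l add0r.
Qed.

Lemma dlvD P P' Q Q' : dlv P P' -> dlv Q Q' ->
  dlv (fun z => P z + Q z) (fun z => P' z + Q' z).
Proof. by move=> H K i; apply: dl_eq (dlD (H i) (K i)) _ _ => z; rewrite mxE. Qed.

Lemma dl_comp (g g' : R -> R) u u' : (forall x : R, is_derive x 1 g (g' x)) -> dl u u' ->
  dl (fun z => g (u z)) (fun z => g' (u z) * u' z).
Proof.
move=> Hg H z; have := is_derive1_comp (f := g) (g := fun t => u (l z t)) (x := 0).
rewrite l0; apply => //; exact: Hg.
Qed.

End LineCalculus.

Section Gauge.
Variable R : realType.
Local Notation C := R[i].
Local Notation Re := (@complex.Re R).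
Local Notation Im := (@complex.Im R).
Local Notation ii := ('i%C : C).
Implicit Types (u v : 'cV[R]_4).

Definition lx (z : C) (t : R) : C := z + toC t.
Definition ly (z : C) (t : R) : C := z + ii * toC t.

Lemma lx0 z : lx z 0 = z. Proof. by rewrite /lx toC0 addr0. Qed.
Lemma ly0 z : ly z 0 = z. Proof. by rewrite /ly toC0 mulr0 addr0. Qed.

(** In complex coordinates, [|u|^2 v = <v, u> u + det (u, v) j u] for all [u] and
    [v] in [C^2].  The Hermitian product [<v, u>] has real part [dotv u v] and
    imaginary part [omega u v], and the determinant is [Omega u v]. *)
Lemma frame_rotation u v (k C0 S0 : R) : k * k * dotv u u = 1 ->
  dotv u v = 0 -> omega u v = 0 -> Omega (k *: u) (k *: v) = (C0 +i* S0)%C ->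
  v = qmul (qv C0 S0 0 0) (qmul qj u).
Proof.
rewrite /dotv !sum4 /omega /Omega !scaleqE => k1 d o [Ec Es].
set u0 := u 0 0 in k1 d o Ec Es *; set u1 := u 1 0 in k1 d o Ec Es *.
set u2 := u 2 0 in k1 d o Ec Es *; set u3 := u 3 0 in k1 d o Ec Es *.
set v0 := v 0 0 in d o Ec Es *; set v1 := v 1 0 in d o Ec Es *.
set v2 := v 2 0 in d o Ec Es *; set v3 := v 3 0 in d o Ec Es *.
rewrite [u]qv_eta -/u0 -/u1 -/u2 -/u3 [v]qv_eta -/v0 -/v1 -/v2 -/v3 qj_mul qv_mul.
set D := (X in X = 0) in d; set O := (X in X = 0) in o; set E := (X in k * k * X) in k1.
have one x : x = k * k * E * x by rewrite k1 mul1r.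
rewrite -Ec -Es; apply: qv_eq.
- rewrite [LHS]one.
  transitivity (k * k * (D * u0 - O * u1) + (- (k * u0 * (k * v2) - k * u1 * (k * v3) -
   (k * u2 * (k * v0) - k * u3 * (k * v1))) * u2 -
   (k * u0 * (k * v3) + k * u1 * (k * v2) - (k * u2 * (k * v1) + k * u3 * (k * v0))) * u3)).
    by rewrite /E /D /O; ring.
  by rewrite d o; ring.
- rewrite [LHS]one.
  transitivity (k * k * (D * u1 + O * u0) + ((k * u0 * (k * v2) - k * u1 * (k * v3) -
   (k * u2 * (k * v0) - k * u3 * (k * v1))) * u3 -
   (k * u0 * (k * v3) + k * u1 * (k * v2) - (k * u2 * (k * v1) + k * u3 * (k * v0))) * u2)).
    by rewrite /E /D /O; ring.
  by rewrite d o; ring.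
- rewrite [LHS]one.
  transitivity (k * k * (D * u2 - O * u3) + ((k * u0 * (k * v2) - k * u1 * (k * v3) -
   (k * u2 * (k * v0) - k * u3 * (k * v1))) * u0 +
   (k * u0 * (k * v3) + k * u1 * (k * v2) - (k * u2 * (k * v1) + k * u3 * (k * v0))) * u1)).
    by rewrite /E /D /O; ring.
  by rewrite d o; ring.
- rewrite [LHS]one.
  transitivity (k * k * (D * u3 + O * u2) + (- (k * u0 * (k * v2) - k * u1 * (k * v3) -
   (k * u2 * (k * v0) - k * u3 * (k * v1))) * u1 +
   (k * u0 * (k * v3) + k * u1 * (k * v2) - (k * u2 * (k * v1) + k * u3 * (k * v0))) * u0)).
    by rewrite /E /D /O; ring.
  by rewrite d o; ring.
Qed.

Definition ph (h : R) : 'cV[R]_4 := qv (cos h) (sin h) 0 0.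

Lemma phD (h h' : R) : qmul (ph h) (ph h') = ph (h + h').
Proof. by rewrite /ph qv_mul cosD sinD; apply: qv_eq; ring. Qed.

Lemma ph0 : ph 0 = qv 1 0 0 0.
Proof. by rewrite /ph cos0 sin0. Qed.

Lemma phK (h : R) u : qmul (ph h) (qmul (ph (- h)) u) = u.
Proof. by rewrite qmulA phD subrr ph0 qmul1l. Qed.

Lemma phKN (h : R) u : qmul (ph (- h)) (qmul (ph h) u) = u.
Proof. by rewrite qmulA phD addrC subrr ph0 qmul1l. Qed.

Lemma ph_j (h : R) u : qmul (ph h) (qmul qj u) = qmul qj (qmul (ph (- h)) u).
Proof.
by rewrite !qmulA qjE /ph !qv_mul cosN sinN; congr qmul; apply: qv_eq; ring.
Qed.

Lemma qjj u : qmul qj (qmul qj u) = - u.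
Proof. by rewrite [u]qv_eta !qj_mul qv_opp. Qed.

(** The hypothesis is the equality of the mixed derivatives of a map with first
    derivatives [e^{i h} u] and [e^{i h} j u], divided by [e^{i h}], where [h] has
    gradient [(a, b)]. *)
Lemma dirac_of_schwarz (a b : R) u ux uy :
  qmul (qv 0 b 0 0) u + uy = qmul (qv 0 a 0 0) (qmul qj u) + qmul qj ux ->
  ux + qmul qj uy = qmul (qv 0 a 0 b) u.
Proof.
move=> H.
have -> : uy = qmul (qv 0 a 0 0) (qmul qj u) + qmul qj ux - qmul (qv 0 b 0 0) u.
  by rewrite -H addrC addKr.
rewrite qmulDr qmulDr qjj qmulNr.
rewrite [X in ux + X]addrAC [LHS]addrC subrK -qmulNr.
by rewrite [u]qv_eta !(qj_mul, qv_mul) qv_opp qj_mul qv_add; apply: qv_eq; ring.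
Qed.

(** Apply [d_x - j d_y] to the Dirac equation: [N = a i + b k] anticommutes with
    [j], and [N^2 = - (a^2 + b^2)]. *)
Lemma laplace_of_dirac (a b : R) u ux uy uxx uxy uyy :
  ux + qmul qj uy = qmul (qv 0 a 0 b) u ->
  uxx + qmul qj uxy = qmul (qv 0 a 0 b) ux ->
  uxy + qmul qj uyy = qmul (qv 0 a 0 b) uy ->
  uxx + uyy = - (a ^+ 2 + b ^+ 2) *: u.
Proof.
move=> H Hx Hy; set N := qv 0 a 0 b in H Hx Hy.
have -> : uyy = - qmul qj (qmul qj uyy) by rewrite qjj opprK.
have -> : qmul qj uyy = qmul N uy - uxy by rewrite -Hy addrC addKr.
have -> : uxx = qmul N ux - qmul qj uxy by rewrite -Hx addrK.
have jN w : qmul qj (qmul N w) = - qmul N (qmul qj w).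
  by rewrite /N [w]qv_eta !(qj_mul, qv_mul) qv_opp; apply: qv_eq; ring.
have NN w : qmul N (qmul N w) = - (a ^+ 2 + b ^+ 2) *: w.
  by rewrite /N [w]qv_eta !qv_mul qv_scale; apply: qv_eq; ring.
rewrite -NN -H qmulDr qmulDr jN qmulNr !opprD !opprK.
by rewrite addrACA [- _ + _]addrC subrr addr0.
Qed.

Variables (Y : C -> 'cV[R]_4) (f beta : C -> R) (a b k : R).
Hypothesis cli : conformal_lagrangian_immersion Y f.
Hypothesis angle : forall z, Omega (expR (- f z) *: vpartial_x Y z)
  (expR (- f z) *: vpartial_y Y z) = (cos (beta z) +i* sin (beta z))%C.
Let h (z : C) : R := a * Re z + b * Im z + k.
Hypothesis betaE : forall z, beta z = h z + h z.

(** Rotating [X_x] back by half the angle makes the equations linear with constant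
    coefficients. *)
Definition spinor (z : C) : 'cV[R]_4 := qmul (ph (- h z)) (vpartial_x Y z).

Lemma vx_spinor z : vpartial_x Y z = qmul (ph (h z)) (spinor z).
Proof. by rewrite /spinor phK. Qed.

Lemma vx_neq0 z : vpartial_x Y z != 0.
Proof.
have [_ /(_ z) [nx _] _ _] := cli.
apply/eqP => E; move: nx; rewrite E /normv /dotv sum4 !zeroqE !mul0r !addr0 sqrtr0.
by move/eqP; rewrite lt_eqF// expR_gt0.
Qed.

Lemma vy_spinor z : vpartial_y Y z = qmul (ph (h z)) (qmul qj (spinor z)).
Proof.
have [_ /(_ z) [nx _] /(_ z) d /(_ z) o] := cli.
have k1 : expR (- f z) * expR (- f z) * dotv (vpartial_x Y z) (vpartial_x Y z) = 1.
  have -> : dotv (vpartial_x Y z) (vpartial_x Y z) = expR (f z) * expR (f z).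
    rewrite -nx -expr2 /normv sqr_sqrtr// /dotv sum4.
    by rewrite !addr_ge0// -expr2 sqr_ge0.
  by rewrite mulrACA -expRD addNr expR0 mulr1.
rewrite (frame_rotation k1 d o (angle z)) -/(ph (beta z)) betaE -phD -qmulA ph_j.
by rewrite -/(spinor z).
Qed.

Let sY i : smooth_plane (fun z => Y z i 0). Proof. by case: cli. Qed.

Lemma smooth_expr_cosh : smooth_expr (fun z => cos (h z)). Proof. exact: smooth_expr_cos. Qed.
Lemma smooth_expr_sinh : smooth_expr (fun z => sin (h z)).
Proof.
have -> : (fun z => sin (h z)) = (fun z => cos (a * Re z + b * Im z + (k - pi / 2))).
  by apply/funext => z; rewrite addrA cosBpihalf.
exact: smooth_expr_cos.
Qed.

Lemma spinor_smooth i : smooth_plane (fun z => spinor z i 0).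
Proof.
apply: smooth_expr_smooth; move: i.
have B i : smooth_expr (partial_x (fun w => Y w i 0)) by apply/smooth_expr_base/smooth_px.
have S := smooth_expr_sinh; have K := smooth_expr_cosh.
have N (g : C -> R) : smooth_expr g -> smooth_expr (fun z => - g z).
  move=> eg; have -> : (fun z => - g z) = (fun z => -1 * g z).
    by apply/funext => z; rewrite mulN1r.
  exact: smooth_expr_mul (smooth_expr_cst _) eg.
apply: I4_ind.
- have -> : (fun z => spinor z 0 0) = (fun z => cos (h z) * partial_x (fun w => Y w 0 0) z +
     sin (h z) * partial_x (fun w => Y w 1 0) z).
    by apply/funext => z; rewrite /spinor /ph qmulE !qvE cosN sinN !mxE; ring.
  by apply: smooth_expr_add; exact: smooth_expr_mul.
- have -> : (fun z => spinor z 1 0) = (fun z => cos (h z) * partial_x (fun w => Y w 1 0) z +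
     - (sin (h z) * partial_x (fun w => Y w 0 0) z)).
    by apply/funext => z; rewrite /spinor /ph qmulE !qvE cosN sinN !mxE; ring.
  by apply: smooth_expr_add; [|apply: N]; exact: smooth_expr_mul.
- have -> : (fun z => spinor z 2 0) = (fun z => cos (h z) * partial_x (fun w => Y w 2 0) z +
     sin (h z) * partial_x (fun w => Y w 3 0) z).
    by apply/funext => z; rewrite /spinor /ph qmulE !qvE cosN sinN !mxE; ring.
  by apply: smooth_expr_add; exact: smooth_expr_mul.
- have -> : (fun z => spinor z 3 0) = (fun z => cos (h z) * partial_x (fun w => Y w 3 0) z +
     - (sin (h z) * partial_x (fun w => Y w 2 0) z)).
    by apply/funext => z; rewrite /spinor /ph qmulE !qvE cosN sinN !mxE; ring.
  by apply: smooth_expr_add; [|apply: N]; exact: smooth_expr_mul.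
Qed.

Lemma dlv_x (Q : C -> 'cV[R]_4) : (forall i, smooth_plane (fun z => Q z i 0)) ->
  dlv lx Q (vpartial_x Q).
Proof. by move=> H i z; rewrite mxE; exact: smooth_dx. Qed.

Lemma dlv_y (Q : C -> 'cV[R]_4) : (forall i, smooth_plane (fun z => Q z i 0)) ->
  dlv ly Q (vpartial_y Q).
Proof. by move=> H i z; rewrite mxE; exact: smooth_dy. Qed.

Lemma vsmooth_x (Q : C -> 'cV[R]_4) : (forall i, smooth_plane (fun z => Q z i 0)) ->
  forall i, smooth_plane (fun z => vpartial_x Q z i 0).
Proof.
move=> H i; have -> : (fun z => vpartial_x Q z i 0) = partial_x (fun z => Q z i 0).
  by apply/funext => z; rewrite mxE.
exact: smooth_px.
Qed.

Lemma vsmooth_y (Q : C -> 'cV[R]_4) : (forall i, smooth_plane (fun z => Q z i 0)) ->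
  forall i, smooth_plane (fun z => vpartial_y Q z i 0).
Proof.
move=> H i; have -> : (fun z => vpartial_y Q z i 0) = partial_y (fun z => Q z i 0).
  by apply/funext => z; rewrite mxE.
exact: smooth_py.
Qed.

Lemma vschwarz (Q : C -> 'cV[R]_4) : (forall i, smooth_plane (fun z => Q z i 0)) ->
  vpartial_y (vpartial_x Q) = vpartial_x (vpartial_y Q).
Proof.
move=> H; apply/funext => z; apply/matrixP => i j; rewrite [LHS]mxE [RHS]mxE.
have -> : (fun w => vpartial_x Q w i 0) = partial_x (fun z => Q z i 0).
  by apply/funext => w; rewrite mxE.
have -> : (fun w => vpartial_y Q w i 0) = partial_y (fun z => Q z i 0).
  by apply/funext => w; rewrite mxE.
by rewrite partial_comm.
Qed.

Lemma dlv_ph l (d : R) : (forall z, l z 0 = z) -> dl l h (fun=> d) ->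
  dlv l (fun z => ph (h z)) (fun z => qmul (ph (h z)) (qv 0 d 0 0)).
Proof.
move=> l0 dh.
have dc := dl_comp l0 (@is_derive_cos R) dh; have ds := dl_comp l0 (@is_derive_sin R) dh.
apply: I4_ind.
- by apply: dl_eq dc _ _ => z; rewrite /ph ?qv_mul ?qvE//; ring.
- by apply: dl_eq ds _ _ => z; rewrite /ph ?qv_mul ?qvE//; ring.
- by apply: dl_eq (dl_cst l 0) _ _ => z; rewrite /ph ?qv_mul ?qvE//; ring.
- by apply: dl_eq (dl_cst l 0) _ _ => z; rewrite /ph ?qv_mul ?qvE//; ring.
Qed.

Lemma dlh_x : dl lx h (fun=> a).
Proof.
move=> z; suff -> : (fun t => h (lx z t)) = (fun t => h z + a * t) by exact: is_derive_affine.
by apply/funext => t; rewrite /h /lx ReD ImD /= addr0; ring.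
Qed.

Lemma dlh_y : dl ly h (fun=> b).
Proof.
move=> z; suff -> : (fun t => h (ly z t)) = (fun t => h z + b * t) by exact: is_derive_affine.
by apply/funext => t; rewrite /h /ly ReD ImD Re_mul Im_mul /=; ring.
Qed.

Lemma vxy_spinor z : vpartial_y (vpartial_x Y) z =
  qmul (ph (h z)) (qmul (qv 0 b 0 0) (spinor z) + vpartial_y spinor z).
Proof.
have := dlv_qmul ly0 (dlv_ph ly0 dlh_y) (dlv_y spinor_smooth).
have -> : (fun z => qmul (ph (h z)) (spinor z)) = vpartial_x Y.
  by apply/funext => w; rewrite vx_spinor.
move=> /(dlv_uniq (dlv_y (vsmooth_x sY))) ->.
by rewrite qmulDr qmulA.
Qed.

Lemma vyx_spinor z : vpartial_x (vpartial_y Y) z =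
  qmul (ph (h z)) (qmul (qv 0 a 0 0) (qmul qj (spinor z)) + qmul qj (vpartial_x spinor z)).
Proof.
have := dlv_qmul lx0 (dlv_ph lx0 dlh_x) (dlv_qmull lx0 qj (dlv_x spinor_smooth)).
have -> : (fun z => qmul (ph (h z)) (qmul qj (spinor z))) = vpartial_y Y.
  by apply/funext => w; rewrite vy_spinor.
move=> /(dlv_uniq (dlv_x (vsmooth_y sY))) ->.
by rewrite qmulDr !qmulA.
Qed.

Lemma dirac z : vpartial_x spinor z + qmul qj (vpartial_y spinor z) = qmul (qv 0 a 0 b) (spinor z).
Proof.
apply: dirac_of_schwarz.
have := congr1 (fun V => qmul (ph (- h z)) (V z)) (vschwarz sY).
by rewrite vxy_spinor vyx_spinor !phKN.
Qed.

Lemma spinor_laplace z : vpartial_x (vpartial_x spinor) z + vpartial_y (vpartial_y spinor) z =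
  - (a ^+ 2 + b ^+ 2) *: spinor z.
Proof.
have E : (fun z => vpartial_x spinor z + qmul qj (vpartial_y spinor z)) =
  (fun z => qmul (qv 0 a 0 b) (spinor z)) by apply/funext => w; exact: dirac.
apply: (laplace_of_dirac (uxy := vpartial_y (vpartial_x spinor) z) (dirac z)).
  have H := dlvD (dlv_x (vsmooth_x spinor_smooth)) (dlv_qmull lx0 qj (dlv_x (vsmooth_y spinor_smooth))).
  have K := dlv_qmull lx0 (qv 0 a 0 b) (dlv_x spinor_smooth).
  rewrite E in H; rewrite (vschwarz spinor_smooth).
  exact: (congr1 (fun V => V z) (dlv_uniq H K)).
have H := dlvD (dlv_y (vsmooth_x spinor_smooth)) (dlv_qmull ly0 qj (dlv_y (vsmooth_y spinor_smooth))).
have K := dlv_qmull ly0 (qv 0 a 0 b) (dlv_y spinor_smooth).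
rewrite E in H.
exact: (congr1 (fun V => V z) (dlv_uniq H K)).
Qed.

(** The rotation [e^{i h}] is constant and can be taken out of the derivatives, which
    leaves [Z_x + j Z_y = 0]. *)
Lemma harmonic_of_constant_angle z : a = 0 -> b = 0 ->
  vpartial_x (vpartial_x Y) z + vpartial_y (vpartial_y Y) z = 0.
Proof.
move=> a0 b0.
have -> : vpartial_x (vpartial_x Y) z = qmul (ph (h z)) (vpartial_x spinor z).
  have := dlv_qmul lx0 (dlv_ph lx0 dlh_x) (dlv_x spinor_smooth).
  have -> : (fun z => qmul (ph (h z)) (spinor z)) = vpartial_x Y.
    by apply/funext => w; rewrite vx_spinor.
  move=> /(dlv_uniq (dlv_x (vsmooth_x sY))) ->.
  rewrite a0; have -> : qv 0 0 0 0 = 0 :> 'cV[R]_4 by apply: cV4_eq; rewrite qvE mxE.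
  by rewrite qmulr0 qmul0l add0r.
have -> : vpartial_y (vpartial_y Y) z = qmul (ph (h z)) (qmul qj (vpartial_y spinor z)).
  have := dlv_qmul ly0 (dlv_ph ly0 dlh_y) (dlv_qmull ly0 qj (dlv_y spinor_smooth)).
  have -> : (fun z => qmul (ph (h z)) (qmul qj (spinor z))) = vpartial_y Y.
    by apply/funext => w; rewrite vy_spinor.
  move=> /(dlv_uniq (dlv_y (vsmooth_y sY))) ->.
  rewrite b0; have -> : qv 0 0 0 0 = 0 :> 'cV[R]_4 by apply: cV4_eq; rewrite qvE mxE.
  by rewrite qmulr0 qmul0l add0r.
rewrite -qmulDr dirac a0 b0.
have -> : qv 0 0 0 0 = 0 :> 'cV[R]_4 by apply: cV4_eq; rewrite qvE mxE.
by rewrite qmul0l qmulr0.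
Qed.

End Gauge.

(** * Lattices and the Lagrangian angle *)

Section Periods.
Variable R : realType.
Local Notation C := R[i].
Local Notation Re := (@complex.Re R).
Local Notation Im := (@complex.Im R).
Local Notation ii := ('i%C : C).
Local Notation det w1 w2 := (Re w1 * Im w2 - Im w1 * Re w2).

Lemma lattice_periods (Gamma : set C) : is_lattice Gamma -> exists w1 w2 : C,
  [/\ det w1 w2 != 0, Gamma w1 /\ Gamma w2,
      forall v w, Gamma v -> Gamma w -> Gamma (v + w) &
      forall w, Gamma w -> Gamma (- w)].
Proof.
move=> [w1 [w2 [ind ->]]]; exists w1, w2; split.
- apply/eqP => d0.
  have [a1 a2] : Im w2 = 0 /\ - Im w1 = 0.
    by apply: ind; apply: eq_ReIm; rewrite !(ReD, ImD, Re_mul, Im_mul) /=;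
      [rewrite -[RHS]d0|]; ring.
  have [a3 a4] : Re w2 = 0 /\ - Re w1 = 0.
    by apply: ind; apply: eq_ReIm; rewrite !(ReD, ImD, Re_mul, Im_mul) /=;
      [|rewrite -[RHS]oppr0 -[in RHS]d0]; ring.
  have E : w1 = 0.
    by apply: eq_ReIm => /=; apply: oppr_inj; rewrite oppr0.
  have [] := ind 1 0; first by rewrite E mulr0 add0r toC0 mul0r.
  by move/eqP; rewrite oner_eq0.
- split; first by exists 1, 0; rewrite mulr1z mulr0z addr0.
  by exists 0, 1; rewrite mulr1z mulr0z add0r.
- move=> v w [m [n ->]] [m' [n' ->]]; exists (m + m'), (n + n').
  by rewrite !mulrzDr addrACA.
- by move=> w [m [n ->]]; exists (- m), (- n); rewrite !mulrNz opprD.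
Qed.

Lemma cover_periodic (Gamma : set C) (X : torus Gamma -> 'cV[R]_4) (w : C) :
  (forall v w, Gamma v -> Gamma w -> Gamma (v + w)) ->
  (forall w, Gamma w -> Gamma (- w)) -> Gamma w ->
  forall z, universal_cover_map X (z + w) = universal_cover_map X z.
Proof.
move=> GD GN Gw z; rewrite /universal_cover_map; congr X.
have E : lattice_coset Gamma (z + w) = lattice_coset Gamma z.
  apply/seteqP; split => x [g Gg <-].
    by exists (w + g); rewrite ?addrA//; exact: GD.
  by exists (g - w); [exact: GD (GN _ Gw)|rewrite -addrA [w + _]addrC subrK].
rewrite /torus_proj; move: (ex_intro _ _ _) (ex_intro _ _ _); rewrite E => p q.
by rewrite (Prop_irrelevance p q).
Qed.

Section Harmonic.
Variables (w1 w2 : C).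
Hypothesis det0 : det w1 w2 != 0.

(** The only frequency of length 0 is 0. *)
Lemma periodic_harmonic_cst u : smooth_plane u ->
  (forall z, u (z + w1) = u z) -> (forall z, u (z + w2) = u z) ->
  (forall z, laplacian u z = 0) -> forall z, u z = u 0.
Proof.
move=> su p1 p2 lu.
have [N [g [g0 H]]] := fourier_finite det0 (lexx (0 : R)).
have [|a Ha] := H _ (smooth_tower det0 su p1 p2).
  move=> z; rewrite -toCD; have -> : toC 0 = 0 :> C by [].
  by rewrite oppr0 mul0r; have := lu z; rewrite /laplacian /= => ->.
have gz k : Re (g k) = 0 /\ Im (g k) = 0.
  have := g0 k; move/eqP; rewrite paddr_eq0 ?sqr_ge0// !sqrf_eq0.
  by move=> /andP[/eqP-> /eqP->].
move=> z; have E : toC (u z) = toC (u 0) :> C.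
  have := Ha z; rewrite /= => ->; have := Ha 0; rewrite /= => ->.
  by apply: eq_bigr => k _; have [-> ->] := gz k; rewrite !mul0r.
by case: E.
Qed.

Lemma trig_injective (c s p q : R) : c ^+ 2 + s ^+ 2 = 1 -> c * p = c * q -> s * p = s * q ->
  p = q.
Proof.
move=> cs cp sp; have -> : p = c * (c * p) + s * (s * p).
  by rewrite !mulrA -mulrDl -!expr2 cs mul1r.
by rewrite cp sp !mulrA -mulrDl -!expr2 cs mul1r.
Qed.

Section Angle.
Variable beta : C -> R.
Hypothesis sb : smooth_plane beta.

(** The derivatives of [cos beta] and [sin beta] determine the gradient of [beta]. *)
Lemma partial_angle_periodic w :
  (forall z, cos (beta (z + w)) = cos (beta z) /\ sin (beta (z + w)) = sin (beta z)) ->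
  (forall z, partial_x beta (z + w) = partial_x beta z) /\
  (forall z, partial_y beta (z + w) = partial_y beta z).
Proof.
move=> per.
have pc z : cos (beta (z + w)) = cos (beta z) by case: (per z).
have ps z : sin (beta (z + w)) = sin (beta z) by case: (per z).
have cs z : cos (beta z) ^+ 2 + (- sin (beta z)) ^+ 2 = 1 by rewrite sqrrN cos2Dsin2.
split=> z.
- have Hc := dl_comp (@lx0 R) (@is_derive_cos R) (smooth_dx sb).
  have Hs := dl_comp (@lx0 R) (@is_derive_sin R) (smooth_dx sb).
  have := @periodic_partial _ (fun z => cos (beta z)) w [:: true] pc z.
  have := @periodic_partial _ (fun z => sin (beta z)) w [:: true] ps z.
  rewrite /= (dx_uniq Hc) (dx_uniq Hs) /= pc ps.
  by move=> h1 h2; apply: trig_injective (cs z) h1 h2.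
- have Hc := dl_comp (@ly0 R) (@is_derive_cos R) (smooth_dy sb).
  have Hs := dl_comp (@ly0 R) (@is_derive_sin R) (smooth_dy sb).
  have := @periodic_partial _ (fun z => cos (beta z)) w [:: false] pc z.
  have := @periodic_partial _ (fun z => sin (beta z)) w [:: false] ps z.
  rewrite /= (dy_uniq Hc) (dy_uniq Hs) /= pc ps.
  by move=> h1 h2; apply: trig_injective (cs z) h1 h2.
Qed.

(** Both components of the gradient are periodic, and harmonic by the commutation of
    partial derivatives; hence they are constant. *)
Lemma harmonic_angle_affine : (forall z, laplacian beta z = 0) ->
  (forall z, cos (beta (z + w1)) = cos (beta z) /\ sin (beta (z + w1)) = sin (beta z)) ->
  (forall z, cos (beta (z + w2)) = cos (beta z) /\ sin (beta (z + w2)) = sin (beta z)) ->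
  exists a b : R, forall z, beta z = a * Re z + b * Im z + beta 0.
Proof.
move=> lap /partial_angle_periodic [x1 y1] /partial_angle_periodic [x2 y2].
have sx := smooth_px sb; have sy := smooth_py sb.
have l0 : laplacian beta = fun=> 0 by apply/funext.
have Lx z : laplacian (partial_x beta) z = 0.
  rewrite /laplacian (partial_comm sb) (partial_comm sy).
  have H := dlD (smooth_dx (smooth_px sx)) (smooth_dx (smooth_py sy)).
  have := @dx_uniq _ (laplacian beta) _ H; rewrite l0 => /(congr1 (fun v => v z)) <-.
  by rewrite (@dx_uniq _ (fun=> 0) (fun=> 0))// => ?; exact: is_derive_cst.
have Ly z : laplacian (partial_y beta) z = 0.
  rewrite /laplacian -(partial_comm sb) -(partial_comm sx).
  have H := dlD (smooth_dy (smooth_px sx)) (smooth_dy (smooth_py sy)).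
  have := @dy_uniq _ (laplacian beta) _ H; rewrite l0 => /(congr1 (fun v => v z)) <-.
  by rewrite (@dy_uniq _ (fun=> 0) (fun=> 0))// => ?; exact: is_derive_cst.
have Cx := periodic_harmonic_cst sx x1 x2 Lx.
have Cy := periodic_harmonic_cst sy y1 y2 Ly.
exists (partial_x beta 0), (partial_y beta 0) => z.
set a := partial_x beta 0; set b := partial_y beta 0.
pose D z := beta z - (a * Re z + b * Im z + 0).
suff : D z = D 0.
  by rewrite /D /= !mulr0 !addr0 subr0 => /eqP; rewrite subr_eq addrC => /eqP.
apply: plane_cst => {}z.
  have := dlB (smooth_dx sb) (@dlh_x _ a b 0) z.
  by rewrite (Cx z) subrr.
have := dlB (smooth_dy sb) (@dlh_y _ a b 0) z.
by rewrite (Cy z) subrr.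
Qed.

End Angle.
End Harmonic.

Lemma re_wave (c x x0 : C) (g : C) : let th := Re g * Re (x - x0) + Im g * Im (x - x0) in
  let th0 := Re g * Re x0 + Im g * Im x0 in
  Re (c * cexp (ii * toC (Re g * Re x + Im g * Im x))) =
  cos th * (Re c * cos th0 - Im c * sin th0) + sin th * (- Re c * sin th0 - Im c * cos th0).
Proof.
move=> th th0.
have -> : Re g * Re x + Im g * Im x = th + th0.
  by rewrite /th /th0 !(ReD, ImD, ReN, ImN); ring.
clearbody th th0; rewrite -on_circleE Re_mul /=.
by rewrite cosD sinD; ring.
Qed.

End Periods.

(** * Plane wave solutions of the Dirac equation *)

Section DiracModes.
Variable R : realType.
Local Notation C := R[i].
Local Notation Re := (@complex.Re R).
Local Notation Im := (@complex.Im R).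
Local Notation ii := ('i%C : C).

Lemma map_qmul (u v : 'cV[R]_4) :
  map_mx toC (qmul u v) = qmul (map_mx toC u) (map_mx toC v) :> 'cV[C]_4.
Proof.
by apply: cV4_eq; rewrite !(mxE, qmulE) /= !(toCD, toCN, toCM).
Qed.

Lemma map_qv (a b c d : R) : map_mx toC (qv a b c d) = qv (toC a) (toC b) (toC c) (toC d) :> 'cV[C]_4.
Proof. by apply: cV4_eq; rewrite !mxE. Qed.

Lemma toC_Re (w : C) : (w + w^*%C) / 2 = toC (Re w).
Proof.
apply: (mulIf (two_neq0 R)); rewrite divfK ?two_neq0//.
by rewrite mulr_natr mulr2n; apply: eq_ReIm; case: w => x y /=; rewrite ?subrr ?addr0.
Qed.

Lemma toC_Im (w : C) : (w - w^*%C) / (2 * ii) = toC (Im w).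
Proof.
have t0 : 2 * ii != 0 by rewrite mulf_neq0 ?two_neq0 ?ii_neq0.
apply: (mulIf t0); rewrite divfK//.
have -> : toC (Im w) * (2 * ii) = (toC (Im w) + toC (Im w)) * ii by ring.
apply: eq_ReIm; case: w => x y;
  rewrite !(Re_mul, Im_mul, ReD, ImD, ReN, ImN) /=; ring.
Qed.

Lemma fth_unit (r : R) (n z : C) : `|n| = 1 ->
  fth r n z = toC (r * (Re n * Re z + Im n * Im z)).
Proof.
move=> n1; rewrite /fth -(unit_conj n1).
have -> : z * n^*%C + z^*%C * n = (z * n^*%C) + (z * n^*%C)^*%C.
  by rewrite conjcM conjcK.
rewrite mulrAC -mulrA toC_Re -toCM; congr (toC (r * _)).
by case: z => x y; case: (n) => u v /=; ring.
Qed.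

Lemma fphi_unit (r : R) (p z : C) : `|p| = 1 ->
  fphi r p z 1 = toC (r * (Re p * Re z + Im p * Im z)).
Proof. by move=> p1; rewrite -fth_unit// /fphi /fth invr1 !expr1n !mulr1. Qed.

Lemma unit_of_sqr (x y r : R) : 0 < r -> x ^+ 2 + y ^+ 2 = r ^+ 2 ->
  `|((x / r) +i* (y / r))%C| = 1 :> C.
Proof.
move=> r0 E; rewrite normrCE /= !exprMn -mulrDl E -exprMn mulfV ?lt0r_neq0//.
by rewrite expr1n sqrtr1.
Qed.

Lemma dlvZ l (c c' : C -> R) (V : 'cV[R]_4) : (forall z, l z 0 = z) -> dl l c c' ->
  dlv l (fun z => c z *: V) (fun z => c' z *: V).
Proof.
move=> l0 H i; apply: dl_eq (dlM l0 H (dl_cst l (V i 0))) _ _ => z; rewrite mxE //.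
by rewrite mulr0 add0r mulrC.
Qed.

Lemma dlv_sum l (I : Type) (s : seq I) (P Q : I -> C -> 'cV[R]_4) :
  (forall k, dlv l (P k) (Q k)) ->
  dlv l (fun z => \sum_(k <- s) P k z) (fun z => \sum_(k <- s) Q k z).
Proof.
move=> H; elim: s => [|k s IH].
  move=> i; apply: dl_eq (dlv_cst l 0 i) _ _ => z; by rewrite big_nil.
move=> i; apply: dl_eq (dlvD (H k) IH i) _ _ => z; by rewrite big_cons.
Qed.

Variables (a b r : R) (z0 : C) (N : nat) (g : 'I_N -> C) (A B : 'I_N -> 'cV[R]_4).
Variable Z : C -> 'cV[R]_4.
Hypotheses (r0 : 0 < r) (rE : a ^+ 2 + b ^+ 2 = r ^+ 2).
Hypothesis gE : forall k, Re (g k) ^+ 2 + Im (g k) ^+ 2 = r ^+ 2.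
Hypothesis sZ : forall i, smooth_plane (fun z => Z z i 0).
Hypothesis DZ : forall z,
  vpartial_x Z z + qmul qj (vpartial_y Z z) = qmul (qv 0 a 0 b) (Z z).
Let th k (z : C) : R := Re (g k) * Re (z - z0) + Im (g k) * Im (z - z0).
Hypothesis ZE : forall z, Z z = \sum_k (cos (th k z) *: A k + sin (th k z) *: B k).

Definition angle_dir : C := ((a / r) +i* (b / r))%C.
Definition wave_dir k : C := ((Re (g k) / r) +i* (Im (g k) / r))%C.
Definition modeJ k : 'cV[R]_4 := qv 0 (Re (wave_dir k * angle_dir)) 0 (Im (wave_dir k * angle_dir)).
Definition amplitude k : 'cV[R]_4 := 2^-1 *: (A k - qmul (modeJ k) (B k)).

Lemma angle_dir1 : `|angle_dir| = 1. Proof. exact: unit_of_sqr. Qed.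
Lemma wave_dir1 k : `|wave_dir k| = 1. Proof. exact: unit_of_sqr. Qed.

Lemma modeJ_sqr k u : qmul (modeJ k) (qmul (modeJ k) u) = - u.
Proof.
have E : Re (wave_dir k * angle_dir) ^+ 2 + Im (wave_dir k * angle_dir) ^+ 2 = 1.
  have r1 : r != 0 by rewrite lt0r_neq0.
  apply: (@mulfI _ (r ^+ 2 * r ^+ 2)); first by rewrite mulf_neq0 ?expf_neq0.
  transitivity ((Re (g k) ^+ 2 + Im (g k) ^+ 2) * (a ^+ 2 + b ^+ 2)).
    by rewrite /wave_dir /angle_dir /=; field.
  by rewrite rE gE mulr1.
move: E; rewrite /modeJ; move: (Re _) (Im _) => x y E.
rewrite qmulA qv_mul.
have -> : qv (0 * 0 - x * x - 0 * 0 - y * y) (0 * x + x * 0 + 0 * y - y * 0)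
  (0 * 0 - x * y + 0 * 0 + y * x) (0 * y + x * 0 - 0 * x + y * 0) = - qv 1 0 0 0.
  by rewrite qv_opp -E; apply: qv_eq; ring.
by rewrite qmulNl qmul1l.
Qed.

Let dth_x k : dl (@lx R) (th k) (fun=> Re (g k)).
Proof.
move=> z; suff -> : (fun t => th k (lx z t)) = (fun t => th k z + Re (g k) * t).
  exact: is_derive_affine.
by apply/funext => t; rewrite /th /lx !(ReD, ImD) /=; ring.
Qed.

Let dth_y k : dl (@ly R) (th k) (fun=> Im (g k)).
Proof.
move=> z; suff -> : (fun t => th k (ly z t)) = (fun t => th k z + Im (g k) * t).
  exact: is_derive_affine.
by apply/funext => t; rewrite /th /ly !(ReD, ImD, Re_mul, Im_mul) /=; ring.
Qed.

Let W k z : 'cV[R]_4 := cos (th k z) *: B k - sin (th k z) *: A k.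

Lemma wave_derive l (d : 'I_N -> R) : (forall z, l z 0 = z) ->
  (forall k, dl l (th k) (fun=> d k)) -> dlv l Z (fun z => \sum_k d k *: W k z).
Proof.
move=> l0 H.
have -> : Z = fun z => \sum_k (cos (th k z) *: A k + sin (th k z) *: B k).
  by apply/funext.
apply: dlv_sum => k i.
have dc := dlvZ (A k) l0 (dl_comp l0 (@is_derive_cos R) (H k)).
have ds := dlvZ (B k) l0 (dl_comp l0 (@is_derive_sin R) (H k)).
apply: dl_eq (dlvD dc ds i) _ _ => z //.
by rewrite /W !(qlinE); ring.
Qed.

(** The product of [N] with the direction of the wave points along [J]. *)
Lemma qmul_Ngj k u : qmul (qv 0 a 0 b) (Re (g k) *: u + qmul qj (Im (g k) *: u)) =
  r ^+ 2 *: qmul (modeJ k) u.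
Proof.
have r1 : r != 0 by rewrite lt0r_neq0.
rewrite /modeJ /wave_dir /angle_dir /= [u]qv_eta; move: (u 0 0) (u 1 0) (u 2 0) (u 3 0) => x y v w.
rewrite !qv_mul !qv_scale qj_mul qv_add qv_mul.
by apply: qv_eq; field.
Qed.

(** By the Dirac equation [Z] is half the sum of [Z] and [- N (Z_x + j Z_y) / r^2].
    On a plane wave [A cos th + B sin th] this operation yields
    [(cos th + J sin th) (A - J B) / 2]. *)
Lemma dirac_modes z : Z z = \sum_k qmul (qv (cos (th k z)) (Re (wave_dir k * angle_dir) * sin (th k z)) 0
   (Im (wave_dir k * angle_dir) * sin (th k z))) (amplitude k).
Proof.
have r1 : r ^+ 2 != 0 by rewrite expf_neq0// lt0r_neq0.
have Ex : vpartial_x Z z = \sum_k Re (g k) *: W k z.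
  exact: (congr1 (fun V => V z) (dlv_uniq (dlv_x sZ) (wave_derive (@lx0 R) dth_x))).
have Ey : vpartial_y Z z = \sum_k Im (g k) *: W k z.
  exact: (congr1 (fun V => V z) (dlv_uniq (dlv_y sZ) (wave_derive (@ly0 R) dth_y))).
have NN w : qmul (qv 0 a 0 b) (qmul (qv 0 a 0 b) w) = - (r ^+ 2 *: w).
  by rewrite -rE [w]qv_eta !qv_mul qv_scale qv_opp; apply: qv_eq; ring.
have E2 : Z z = - \sum_k qmul (modeJ k) (W k z).
  apply: (scalerI r1); rewrite -[LHS]opprK -NN -DZ Ex Ey qmul_sumr -big_split /= qmul_sumr.
  rewrite scalerN scaler_sumr; congr (- _); apply: eq_bigr => k _.
  exact: qmul_Ngj.
have -> : Z z = 2^-1 *: (Z z + Z z).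
  have e2 : 2^-1 + 2^-1 = 1 :> R by field.
  by rewrite scalerDr -scalerDl e2 scale1r.
rewrite {1}ZE E2 -sumrB scaler_sumr; apply: eq_bigr => k _.
rewrite /amplitude qmulZr; congr (_ *: _).
have -> : qv (cos (th k z)) (Re (wave_dir k * angle_dir) * sin (th k z)) 0 (Im (wave_dir k * angle_dir) * sin (th k z)) =
  cos (th k z) *: qv 1 0 0 0 + sin (th k z) *: modeJ k.
  by rewrite /modeJ !qv_scale qv_add; apply: qv_eq; ring.
rewrite qmulDl !qmulZl qmul1l /W !qmulDr !qmulNr !qmulZr modeJ_sqr.
move: (qmul _ _) (qmul _ _) => u v; move: (cos _) (sin _) => c s.
by apply/matrixP => i j; rewrite !mxE; ring.
Qed.

Lemma dirac_modeW z : map_mx toC (Z z) = modeW r angle_dir wave_dir amplitude (z - z0).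
Proof.
rewrite dirac_modes /modeW.
have -> : map_mx toC (\sum_k qmul (qv (cos (th k z)) (Re (wave_dir k * angle_dir) * sin (th k z)) 0
   (Im (wave_dir k * angle_dir) * sin (th k z))) (amplitude k)) = \sum_k map_mx toC (qmul (qv (cos (th k z))
   (Re (wave_dir k * angle_dir) * sin (th k z)) 0 (Im (wave_dir k * angle_dir) * sin (th k z))) (amplitude k)) :> 'cV[C]_4.
  exact: (raddf_sum (map_mx (@real_complex R))).
apply: eq_bigr => k _; rewrite map_qmul map_qv; congr qmul.
have np1 : `|wave_dir k * angle_dir| = 1 by rewrite normrM angle_dir1 wave_dir1 mulr1.
have tE : fth r (wave_dir k) (z - z0) = toC (th k z).
  rewrite fth_unit ?wave_dir1//; congr toC; rewrite /wave_dir /th /=; field.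
  by rewrite lt0r_neq0.
rewrite /mE tE ccos_toC csin_toC -(unit_conj np1) toC_Re toC_Im.
by rewrite !toCM.
Qed.

End DiracModes.

(** * Periodicity of the Dirac solution *)

Section PeriodicGauge.
Variable R : realType.
Local Notation C := R[i].
Local Notation Re := (@complex.Re R).
Local Notation Im := (@complex.Im R).
Local Notation ii := ('i%C : C).
Local Notation det w1 w2 := (Re w1 * Im w2 - Im w1 * Re w2).

Lemma vpartial_periodic (Q : C -> 'cV[R]_4) w : (forall z, Q (z + w) = Q z) ->
  (forall z, vpartial_x Q (z + w) = vpartial_x Q z) /\
  (forall z, vpartial_y Q (z + w) = vpartial_y Q z).
Proof.
move=> per; have pc i z : Q (z + w) i 0 = Q z i 0 by rewrite per.
split=> z; apply/matrixP => i j; rewrite !mxE.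
  exact: (@periodic_partial _ (fun z => Q z i 0) w [:: true] (pc i)).
exact: (@periodic_partial _ (fun z => Q z i 0) w [:: false] (pc i)).
Qed.

Variables (Y : C -> 'cV[R]_4) (f beta : C -> R).
Hypothesis cli : conformal_lagrangian_immersion Y f.
Hypothesis angle : forall z, Omega (expR (- f z) *: vpartial_x Y z)
  (expR (- f z) *: vpartial_y Y z) = (cos (beta z) +i* sin (beta z))%C.

Lemma angle_periodic w : (forall z, Y (z + w) = Y z) ->
  forall z, cos (beta (z + w)) = cos (beta z) /\ sin (beta (z + w)) = sin (beta z).
Proof.
move=> per z; have [px py] := vpartial_periodic per.
have [_ nm _ _] := cli.
have fE : f (z + w) = f z.
  by apply: expR_inj; have [<- _] := nm (z + w); have [<- _] := nm z; rewrite px.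
have := angle (z + w); rewrite fE px py angle.
by case=> -> ->.
Qed.

Section DoubledPeriod.
Variables (a b k : R) (w : C).
Hypothesis betaE : forall z, beta z = (a * Re z + b * Im z + k) + (a * Re z + b * Im z + k).

(** The half angle [h] changes by a multiple of [pi] along a period, which may
    reverse the sign of [e^{- i h}]. *)
Lemma spinor_periodic : (forall z, Y (z + w) = Y z) ->
  forall z, spinor Y a b k (z + (w + w)) = spinor Y a b k z.
Proof.
move=> per z; have [px _] := vpartial_periodic per.
rewrite /spinor addrA !px; set h0 := a * Re z + b * Im z + k.
pose e := 2 * (a * Re w + b * Im w).
have [c1 s1] := angle_periodic per z.
have bE : beta (z + w) = beta z + e.
  by rewrite !betaE /e !(ReD, ImD); ring.
have ce : cos e = 1.
  have -> : e = beta (z + w) - beta z by rewrite bE addrC addKr.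
  by rewrite cosB c1 s1 -!expr2 cos2Dsin2.
have se : sin e = 0.
  have -> : e = beta (z + w) - beta z by rewrite bE addrC addKr.
  by rewrite sinB c1 s1; ring.
have -> : - (a * Re (z + w + w) + b * Im (z + w + w) + k) = - h0 + - e.
  by rewrite /h0 /e !(ReD, ImD); ring.
by rewrite -phD -qmulA {2}/ph cosN sinN ce se oppr0 qmul1l.
Qed.

End DoubledPeriod.

(** [X] would be harmonic on the torus, hence constant. *)
Lemma constant_angle_absurd w1 w2 (k : R) : det w1 w2 != 0 ->
  (forall z, Y (z + w1) = Y z) -> (forall z, Y (z + w2) = Y z) ->
  (forall z, beta z = k + k) -> False.
Proof.
move=> d0 p1 p2 betaE.
have bE z : beta z = (0 * Re z + 0 * Im z + k) + (0 * Re z + 0 * Im z + k).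
  by rewrite betaE; ring.
have sY i : smooth_plane (fun z => Y z i 0) by case: cli.
have cst i : forall z, Y z i 0 = Y 0 i 0.
  apply: (periodic_harmonic_cst d0 (sY i)) => z; rewrite ?p1 ?p2//.
  have := harmonic_of_constant_angle cli angle bE z erefl erefl.
  move=> /(congr1 (fun V : 'cV[R]_4 => V i 0)); rewrite addqE zeroqE [X in X + _]mxE [X in _ + X]mxE.
  have -> : (fun w => vpartial_x Y w i 0) = partial_x (fun z => Y z i 0).
    by apply/funext => w; rewrite mxE.
  have -> : (fun w => vpartial_y Y w i 0) = partial_y (fun z => Y z i 0).
    by apply/funext => w; rewrite mxE.
  by [].
have := vx_neq0 cli 0; apply/negP; rewrite negbK; apply/eqP.
apply/matrixP => i j; rewrite !mxE.
have -> : (fun w => Y w i 0) = fun=> Y 0 i 0 by apply/funext => z; exact: cst.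
by rewrite (@dx_uniq _ (fun=> Y 0 i 0) (fun=> 0))// => ?; exact: is_derive_cst.
Qed.

Lemma eigenmodes (W : C -> 'cV[R]_4) w1 w2 (c : R) z0 : det w1 w2 != 0 -> 0 <= c ->
  (forall i, smooth_plane (fun z => W z i 0)) ->
  (forall z, W (z + w1) = W z) -> (forall z, W (z + w2) = W z) ->
  (forall z, vpartial_x (vpartial_x W) z + vpartial_y (vpartial_y W) z = - c *: W z) ->
  exists (N : nat) (g : 'I_N -> C) (A B : 'I_N -> 'cV[R]_4),
    (forall k, Re (g k) ^+ 2 + Im (g k) ^+ 2 = c) /\
    forall z, W z = \sum_k (cos (Re (g k) * Re (z - z0) + Im (g k) * Im (z - z0)) *: A k +
      sin (Re (g k) * Re (z - z0) + Im (g k) * Im (z - z0)) *: B k).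
Proof.
move=> d0 c0 sW p1 p2 LW.
have [N [g [gE H]]] := fourier_finite d0 c0.
have q1 i z : W (z + w1) i 0 = W z i 0 by rewrite p1.
have q2 i z : W (z + w2) i 0 = W z i 0 by rewrite p2.
have /choice [al Hal] : forall i : 'I_4, exists al : 'I_N -> C, forall z,
    toC (W z i 0) = \sum_k al k * cexp (ii * toC (Re (g k) * Re z + Im (g k) * Im z)).
  move=> i; apply: (H _ (smooth_tower d0 (sW i) (q1 i) (q2 i))) => z /=.
  rewrite -toCD -toCN -toCM; congr toC.
  have := congr1 (fun V : 'cV[R]_4 => V i 0) (LW z); rewrite addqE scaleqE [X in X + _]mxE [X in _ + X]mxE => <-.
  have -> : (fun w => vpartial_x W w i 0) = partial_x (fun z => W z i 0).
    by apply/funext => w; rewrite mxE.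
  have -> : (fun w => vpartial_y W w i 0) = partial_y (fun z => W z i 0).
    by apply/funext => w; rewrite mxE.
  by [].
pose t0 k := Re (g k) * Re z0 + Im (g k) * Im z0.
exists N, g, (fun k => \col_i (Re (al i k) * cos (t0 k) - Im (al i k) * sin (t0 k))),
  (fun k => \col_i (- Re (al i k) * sin (t0 k) - Im (al i k) * cos (t0 k))); split=> // z.
apply/matrixP => i j; rewrite ord1 {j} summxE.
have -> : W z i 0 = Re (toC (W z i 0)) by [].
rewrite Hal (big_morph Re (@ReD R) (erefl : Re 0 = 0)); apply: eq_bigr => k _.
by rewrite (re_wave _ z z0) !mxE.
Qed.

End PeriodicGauge.

(** * The theorem *)

Theorem theorem10 (R : realType) (Gamma : set R[i]) (X : torus Gamma -> 'cV[R]_4)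
    (f : R[i] -> R) (z0 : R[i]) :
  is_lattice Gamma ->
  conformal_lagrangian_immersion (universal_cover_map X) f ->
  hamiltonian_stationary (universal_cover_map X) f ->
  finite_type z0 X.
Proof.
move=> /lattice_periods [w1 [w2 [d0 [G1 G2] GD GN]]] cli [beta [[sb angle] lap]].
set Y := universal_cover_map X in cli angle.
have p1 : forall z, Y (z + w1) = Y z by apply: cover_periodic.
have p2 : forall z, Y (z + w2) = Y z by apply: cover_periodic.
have [a [b bE]] : exists a b : R, forall z, beta z =
    (a * complex.Re z + b * complex.Im z + beta 0 / 2) +
    (a * complex.Re z + b * complex.Im z + beta 0 / 2).
  have [a [b bE]] := harmonic_angle_affine d0 sb lap (angle_periodic cli angle p1)
    (angle_periodic cli angle p2).
  by exists (a / 2), (b / 2) => z; rewrite [LHS]bE; field.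
set k := beta 0 / 2 in bE.
pose r := Num.sqrt (a ^+ 2 + b ^+ 2).
have s0 : 0 <= a ^+ 2 + b ^+ 2 by rewrite addr_ge0// sqr_ge0.
have rE : a ^+ 2 + b ^+ 2 = r ^+ 2 by rewrite sqr_sqrtr.
have r0 : 0 < r.
  rewrite lt_neqAle sqrtr_ge0 andbT; apply/eqP => r0.
  move/eqP: rE; rewrite -r0 expr0n paddr_eq0 ?sqr_ge0// !sqrf_eq0 => /andP[/eqP a0 /eqP b0].
  apply: (constant_angle_absurd cli angle d0 p1 p2 (k := k)) => z.
  by rewrite bE a0 b0; ring.
pose Z := spinor Y a b k.
have sZ : forall i, smooth_plane (fun z => Z z i 0) by move=> i; exact: (spinor_smooth a b k cli i).
have d2 : complex.Re (w1 + w1) * complex.Im (w2 + w2) -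
    complex.Im (w1 + w1) * complex.Re (w2 + w2) != 0.
  rewrite !(ReD, ImD); set d := (X in X != 0).
  have -> : d = 4 * (complex.Re w1 * complex.Im w2 - complex.Im w1 * complex.Re w2).
    by rewrite /d; ring.
  by rewrite mulf_neq0.
have LZ z : vpartial_x (vpartial_x Z) z + vpartial_y (vpartial_y Z) z =
    - r ^+ 2 *: Z z.
  by rewrite -rE; exact: (spinor_laplace cli angle bE).
have [N [g [A [B [gE ZE]]]]] := eigenmodes z0 d2 (sqr_ge0 r) sZ
  (spinor_periodic cli angle bE p1) (spinor_periodic cli angle bE p2) LZ.
have DZ : forall z, vpartial_x Z z + qmul qj (vpartial_y Z z) = qmul (qv 0 a 0 b) (Z z).
  exact: (dirac cli angle bE).
have modes := dirac_modeW r0 rE gE sZ DZ ZE.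
pose h z : R := a * complex.Re z + b * complex.Im z + k.
have phase z u : map_mx toC (rotq (cos (h z0)) (- sin (h z0)) *m qmul (ph (h z)) u) =
    qmul (ei (fphi r (angle_dir a b r) (z - z0) 1)) (map_mx toC u).
  rewrite rotqE; have -> : qv (cos (h z0)) (- sin (h z0)) 0 0 = ph (- h z0).
    by rewrite /ph cosN sinN.
  rewrite qmulA phD map_qmul; congr qmul.
  rewrite (fphi_unit _ _ (angle_dir1 r0 rE)) /ei ccos_toC csin_toC /ph map_qv.
  have -> : r * (complex.Re (angle_dir a b r) * complex.Re (z - z0) +
     complex.Im (angle_dir a b r) * complex.Im (z - z0)) = - h z0 + h z.
    rewrite /angle_dir /h !(ReD, ImD, ReN, ImN) /=; field.
    by rewrite lt0r_neq0.
  by [].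
apply: (@modes_finite_type _ N r (angle_dir a b r) (wave_dir r g) (amplitude a b r g A B) r0 (angle_dir1 r0 rE)
  (wave_dir1 r0 gE) _ _ _ (h z0)).
- by case: cli.
- by move=> z; rewrite (vx_spinor Y a b k) phase -modes.
- move=> z; rewrite (vy_spinor cli angle bE) phase map_qmul -modes; congr qmul.
  by rewrite !qjE map_qv.
Qed.
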